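(* Let $m\ge 2$ and $n\ge 0$ be integers with $2n+1\le m$, let $\mathfrak g=\mathfrak{so}_{2m}(\mathbb C)$, and let $X_n$ and the affine subspace $\mathcal S_n\subset\mathfrak g$ of matrices $S(a_i,y_i,z_j,d_k)$ ($1\le i\le n$, $1\le j\le n+1$, $1\le k\le m-n-1$) be as in the context. Then $\mathcal S_n$ is $\lambda$-invariant and transverse to the adjoint orbit of $X_n$. Moreover, the characteristic polynomial $\chi_S(t)=\det(tI-S)$ of $S=S(a_i,y_i,z_j,d_k)\in\mathcal S_n$ is $$\chi_S(t)=t^2A(t)D(t)+(-1)^mB(t)B(-t),$$ where $$A(t)=t^{2n}-a_1t^{2(n-1)}+\cdots+(-1)^na_n,$$ $$D(t)=4d_1t^{2(m-n-2)}-4d_2t^{2(m-n-3)}+\cdots+(-1)^{m-n}4d_{m-n-1},$$ $$B(t)=y_1+y_2t+\cdots+y_nt^{n-1}-t^n\bigl(z_1-z_2t+\cdots+(-1)^nz_{n+1}t^n+(-1)^{m-n}t^{m-n}\bigr).$$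
   Context: $\mathfrak{so}_{2m}(\mathbb C)$ is the Lie algebra of block matrices $\begin{pmatrix}P&Q\\ R&-P^{\top}\end{pmatrix}$ with $P,Q,R$ complex $m\times m$ matrices, $Q,R$ antisymmetric; $SO_{2m}(\mathbb C)$ acts on it by the adjoint action. Put $p=m-n$. $J_l$ is the $l\times l$ nilpotent Jordan block with ones on the superdiagonal; $\mathcal E_{j,k}$ is the $j\times k$ matrix with $1$ in position $(j,k)$ and zeros elsewhere; $\mathcal F_l$ is the $l\times l$ matrix with $1$ in position $(l-1,l)$, $-1$ in position $(l,l-1)$ and zeros elsewhere. With block sizes $p,n,p,n$, $$X_n=\begin{pmatrix}J_p&0&\mathcal F_p&\mathcal E_{p,n}\\0&J_n&-\mathcal E_{n,p}&0\\0&0&-J_p^{\top}&0\\0&0&0&-J_n^{\top}\end{pmatrix}.$$ For complex numbers $a_i,y_i,z_j,d_k$ define: $M_d$, the antisymmetric $p\times p$ matrix whose superdiagonal is $(d_{p-1},d_{p-2},\dots,d_1)$, whose subdiagonal is the negative of this, other entries $0$; $M_a$, the antisymmetric $n\times n$ matrix whose superdiagonal is $(a_n,a_{n-1},\dots,a_2)$, whose subdiagonal is the negative of this, other entries $0$; $M_y$, the $p\times n$ matrix with first row $(y_1,\dots,y_n)$ and other rows $0$; $M_{z,d}$, the $p\times p$ matrix that is the sum of the matrix with last row $(z_1,\dots,z_{n+1},0,\dots,0)$ and other rows $0$, and of the matrix with the single nonzero entry $d_1$ in position $(p,p-1)$. Then $$S(a_i,y_i,z_j,d_k)=X_n+\begin{pmatrix}-M_{z,d}&a_1\mathcal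 E_{p,n}&0&0\\0&0&0&0\\ M_d&M_y&M_{z,d}^{\top}&0\\-M_y^{\top}&M_a&-a_1\mathcal E_{n,p}&0\end{pmatrix},$$ and $\mathcal S_n$ is the set of all these matrices. Transverse to the adjoint orbit of $X_n$ means: the tangent space of $\mathcal S_n$ at $X_n$ is complementary to $[\mathfrak g,X_n]$ in $\mathfrak g$. $\lambda$-invariant means invariant under the $\mathbb C^*$-action $\lambda_r(Y)=r\exp(-\log(r)H/2)\,Y\,\exp(\log(r)H/2)$, where $H=H_n=\mathrm{diag}(\alpha_p,\beta_n,-\alpha_p,-\beta_n)$, with $\alpha_k=\mathrm{diag}(2(k-1),2(k-2),\dots,0)$ and $\beta_k=\mathrm{diag}(2k,2(k-1),\dots,2)$, is the semisimple element of a Jacobson–Morozov triple with nilpositive element $X_n$. *)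

(* Defs.v *)
From HB Require Import structures.
From mathcomp Require Import all_boot all_order all_algebra.
From mathcomp Require Import complex.
From mathcomp Require Import all_classical all_reals all_analysis.

Set Implicit Arguments.
Unset Strict Implicit.
Unset Printing Implicit Defensive.

Import Order.TTheory GRing.Theory Num.Theory.
Import numFieldNormedType.Exports.
Local Open Scope classical_set_scope.
Local Open Scope ring_scope.
Local Open Scope complex_scope.

(* The complex numbers are [R[i]] for [R : realType].  The families
   (a_i), (y_i), (z_j), (d_k) are functions [nat -> R[i]] used at the
   1-based indices of the mathematics; other values are irrelevant.
   Row and column indices of matrices are 0-based. *)

(* Stated over a [numFieldType], whose topology is that of its norm, and used
   at [R[i]], which carries no topology of its own in the library. *)
Section Exponential.
Variable K : numFieldType.

Definition expC (w : K) : K :=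
  limn (series (fun k : nat => w ^+ k / k`!%:R)).

Definition expmx (N : nat) (A : 'M[K]_N) : 'M[K]_N :=
  limn (series (fun k : nat => k`!%:R^-1 *: A ^+ k)).

End Exponential.

Section LieAlgebra.
Variable R : realType.

Definition so (k : nat) : set 'M[R[i]]_(k + k) :=
  [set Y | exists P Q B : 'M[R[i]]_k,
     [/\ Q^T = - Q, B^T = - B & Y = block_mx P Q B (- P^T)]].

Definition lie (N : nat) (Y X : 'M[R[i]]_N) : 'M[R[i]]_N :=
  Y *m X - X *m Y.

Definition complementary (N : nat) (g T U : set 'M[R[i]]_N) : Prop :=
  g = [set Y + Z | Y in T & Z in U] /\ T `&` U = [set 0].

(* For an affine subspace [S] through [X], the tangent space at [X] is the
   direction of [S]. *)
Definition tangent_space (N : nat) (S : set 'M[R[i]]_N) (X : 'M[R[i]]_N) :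
    set 'M[R[i]]_N :=
  [set Y - X | Y in S].

Definition transverse (N : nat) (g S : set 'M[R[i]]_N) (X : 'M[R[i]]_N) :
    Prop :=
  complementary g (tangent_space S X) [set lie Y X | Y in g].

(* [lambda_act H r w] is lambda_r computed with [w] as the value of log(r). *)
Definition lambda_act (N : nat) (H : 'M[R[i]]_N) (r w : R[i])
    (Y : 'M[R[i]]_N) : 'M[R[i]]_N :=
  r *: (expmx (- (w / 2%:R) *: H) *m Y *m expmx ((w / 2%:R) *: H)).

(* Invariance is required for every determination [w] of log(r). *)
Definition lambda_invariant (N : nat) (H : 'M[R[i]]_N)
    (S : set 'M[R[i]]_N) : Prop :=
  forall r : R[i], r != 0 -> forall w : R[i], expC w = r ->
    [set lambda_act H r w Y | Y in S] = S.

End LieAlgebra.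

Section Slice.
Variable R : realType.

Definition jordan_nil (l : nat) : 'M[R[i]]_l :=
  \matrix_(i < l, j < l) (j == i.+1 :> nat)%:R.

Definition Emx (j k : nat) : 'M[R[i]]_(j, k) :=
  \matrix_(r < j, s < k) ((r.+1 == j) && (s.+1 == k))%:R.

Definition Fmx (l : nat) : 'M[R[i]]_l :=
  \matrix_(i < l, j < l)
    (if (i.+2 == l) && (j.+1 == l) then 1
     else if (i.+1 == l) && (j.+2 == l) then -1
     else 0).

Definition nilX (p n : nat) : 'M[R[i]]_((p + n) + (p + n)) :=
  block_mx
    (block_mx (jordan_nil p) 0 0 (jordan_nil n))
    (block_mx (Fmx p) (Emx p n) (- Emx n p) 0)
    0
    (block_mx (- (jordan_nil p)^T) 0 0 (- (jordan_nil n)^T)).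

Definition alpha (k : nat) : 'rV[R[i]]_k := \row_(i < k) (2 * (k - i.+1))%:R.
Definition beta (k : nat) : 'rV[R[i]]_k := \row_(i < k) (2 * (k - i))%:R.

Definition semisimpleH (p n : nat) : 'M[R[i]]_((p + n) + (p + n)) :=
  diag_mx (row_mx (row_mx (alpha p) (beta n))
                  (row_mx (- alpha p) (- beta n))).

(* Antisymmetric tridiagonal matrix with superdiagonal u 1, ..., u (l - 1). *)
Definition antisym_tridiag (l : nat) (u : nat -> R[i]) : 'M[R[i]]_l :=
  \matrix_(i < l, j < l)
    (if j == i.+1 :> nat then u i.+1
     else if i == j.+1 :> nat then - u j.+1
     else 0).

Definition Md (p : nat) (d : nat -> R[i]) : 'M[R[i]]_p :=
  antisym_tridiag p (fun i => d (p - i)%N).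

Definition Ma (n : nat) (a : nat -> R[i]) : 'M[R[i]]_n :=
  antisym_tridiag n (fun i => a (n.+1 - i)%N).

Definition My (p n : nat) (y : nat -> R[i]) : 'M[R[i]]_(p, n) :=
  \matrix_(i < p, j < n) (if i == 0%N :> nat then y j.+1 else 0).

Definition Mzd (p n : nat) (z d : nat -> R[i]) : 'M[R[i]]_p :=
  (\matrix_(i < p, j < p)
     (if (i.+1 == p) && (j < n.+1)%N then z j.+1 else 0))
  + (\matrix_(i < p, j < p)
     (if (i.+1 == p) && (j.+2 == p) then d 1%N else 0)).

(* Block sizes are p, n, p, n with p = m - n. *)
Definition sliceS (p n : nat) (a y z d : nat -> R[i]) :
    'M[R[i]]_((p + n) + (p + n)) :=
  nilX p n +
  block_mx
    (block_mx (- Mzd p n z d) (a 1%N *: Emx p n) 0 0)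
    0
    (block_mx (Md p d) (My p n y) (- (My p n y)^T) (Ma n a))
    (block_mx (Mzd p n z d)^T 0 (- (a 1%N *: Emx n p)) 0).

Definition slice (p n : nat) : set 'M[R[i]]_((p + n) + (p + n)) :=
  [set Y | exists a y z d : nat -> R[i], Y = sliceS p n a y z d].

Definition polA (n : nat) (a : nat -> R[i]) : {poly R[i]} :=
  'X^(2 * n) + \sum_(1 <= i < n.+1) ((-1) ^+ i * a i) *: 'X^(2 * (n - i)).

Definition polD (m n : nat) (d : nat -> R[i]) : {poly R[i]} :=
  \sum_(1 <= k < m - n)
     ((-1) ^+ k.+1 * 4%:R * d k) *: 'X^(2 * (m - n - k.+1)).

Definition polB (m n : nat) (y z : nat -> R[i]) : {poly R[i]} :=
  \sum_(1 <= i < n.+1) y i *: 'X^(i.-1)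
  - 'X^n * (\sum_(1 <= j < n.+2) ((-1) ^+ j.-1 * z j) *: 'X^(j.-1)
            + (-1) ^+ (m - n) *: 'X^(m - n)).

End Slice.

Arguments so R k : clear implicits.
Arguments nilX R p n : clear implicits.
Arguments semisimpleH R p n : clear implicits.
Arguments slice R p n : clear implicits.

(* Main.v *)
Require Import Defs.
From HB Require Import structures.
From mathcomp Require Import all_boot all_order all_algebra all_fingroup.
From mathcomp Require Import complex.
From mathcomp Require Import all_classical all_reals all_analysis.
From mathcomp Require Import zify ring.

Set Implicit Arguments.
Unset Strict Implicit.
Unset Printing Implicit Defensive.

(** The symmetric form [dot], of Gram matrix [[0, 1], [1, 0]], identifies the
    orthogonal Lie algebra with the exterior square of the space: [wedge v w]
    is the skew matrix [x |-> dot w x *: v - dot v x *: w].  Write e, f, e', f'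
    for the standard basis vectors of the four blocks and [X] for [nilX].  Two
    chains carry the whole argument: [h_i = (-X)^i e'_0] for [i < p] and
    [g_i = (-X)^i f'_0] for [i <= n] (indices start at 0).  They are explicit,
    [h_i = e'_i] and [g_i = f'_i] except for [h_(p-1) = e'_(p-1) + e_(p-1)] and
    [g_n = - e_(p-1)], and in terms of them a slice element is
    [[
      X + sum_(i < p-1) d_(p-1-i) h_i ^ h_(i+1) + sum_(i < n) a_(n-i) g_i ^ g_(i+1)
        + sum_(j < n) y_(j+1) h_0 ^ g_j + sum_(j <= n) z_(j+1) g_n ^ h_j
    ]]
    ([sliceSE]).  The three claims are read off from this formula.

    Invariance.  The vectors [h_i] and [g_i] are eigenvectors of [H], so
    conjugation by the exponential multiplies every wedge by a power of [r],
    while [X], being of degree 2, is fixed ([lambda_slice]).  Two facts about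
    exponentials are used: the functional equation of the complex exponential
    ([expCD]) and the exponential of a diagonal matrix ([expmx_diag]).

    Characteristic polynomial.  There are two vectors [kerv1 t], [kerv2 t],
    polynomial in [t], which [t - X] maps into the span of [h_0] and [g_0] and
    which are dual to the chains: [dot (kerv1 t) h_i = t^i],
    [dot (kerv2 t) g_i = t^i], the other two pairings being zero.  Eliminating
    all constant pivots of [t - S] leaves the two by two matrix of the numbers
    [dot (kerv_a (-t)) ((t - S) kerv_b t)], to which a wedge of chain vectors
    contributes an antisymmetric product of powers of [t] and [-t].  Its
    entries are multiples of [t D], [B (t)], [B (-t)] and [t A]
    ([char_poly_pencil], [pencil11E], [pencil12E], [pencil21E], [pencil22E]).

    Transversality.  Since [X v ^ w + v ^ X w] is a commutator with [X], every
    wedge of chain vectors is congruent to [h_0 ^ h_k], [h_0 ^ g_k] or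
    [g_0 ^ g_k] up to sign.  For even [k] the first and the last vanish; for
    the remaining small [k] the wedge is a slice direction; for large [k] the
    relation between the two chains reduces it to a previous case.  Hence slice
    directions and commutators fill the algebra ([skew_covered]).  Conversely,
    if a slice direction [M] is a commutator with [X], the numbers
    [dot (kerv_a (-t)) (M kerv_b t)] are combinations of the images of the
    polynomial vectors under [t - X], hence divisible by a power of [t] larger
    than their degree, and all the coordinates of [M] vanish
    ([slice_dir_comm0]). *)

Import Order.TTheory GRing.Theory Num.Theory.
Local Open Scope ring_scope.

(** * Wedges and skew matrices *)

Lemma sum_pick (A : pzSemiRingType) (I : nat) (c : nat -> A) j :
  \sum_(i < I) c i * (i == j :> nat)%:R = if (j < I)%N then c j else 0.
Proof.
case: ltnP => h; last first.
  by rewrite big1 // => i _; rewrite (_ : _ == _ = false) ?mulr0 //; have := ltn_ord i; lia.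
rewrite (bigD1 (Ordinal h)) //= eqxx mulr1 big1 ?addr0 // => i ij.
by rewrite (negPf (ij : i != j :> nat)) mulr0.
Qed.

Lemma sum_ord_pred (V : nmodType) (F : nat -> V) k : (0 < k)%N ->
  \sum_(i < k) F i = \sum_(i < k.-1) F i + F k.-1.
Proof. by case: k => // k _; rewrite big_ord_recr. Qed.

Section StandardVectors.
Variable A : comNzRingType.

Definition dv (l k : nat) : 'cV[A]_l := \col_i (i == k :> nat)%:R.

Lemma dv_out l k : (l <= k)%N -> dv l k = 0.
Proof.
move=> lk; apply/colP => i; rewrite !mxE (_ : _ == _ = false) //.
by have := ltn_ord i; lia.
Qed.

Lemma mul_dv m l (B : 'M[A]_(m, l)) (k : 'I_l) : B *m dv l k = col k B.
Proof.
apply/colP => i; rewrite !mxE (bigD1 k) //= mxE eqxx mulr1 big1 ?addr0 //.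
by move=> j jk; rewrite mxE (negPf (jk : j != k :> nat)) mulr0.
Qed.

Lemma dv_sum q (v : 'cV[A]_q) : v = \sum_(k < q) v k 0 *: dv q k.
Proof.
apply/colP => i; rewrite summxE (bigD1 i) //= !mxE eqxx mulr1 big1 ?addr0 //.
by move=> j ji; rewrite !mxE eq_sym (negPf (ji : j != i :> nat)) mulr0.
Qed.

End StandardVectors.

Section Form.
Variables (A : comNzRingType) (q : nat).
Local Notation N := (q + q)%N.

Definition Jmx : 'M[A]_N := block_mx 0 1%:M 1%:M 0.

Definition dot (v w : 'cV[A]_N) : A := (v^T *m Jmx *m w) 0 0.

(** The element of the orthogonal Lie algebra attached to the bivector of [v]
    and [w]. *)
Definition wedge (v w : 'cV[A]_N) : 'M[A]_N :=
  v *m (w^T *m Jmx) - w *m (v^T *m Jmx).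

Lemma trJmx : Jmx^T = Jmx.
Proof. by rewrite /Jmx tr_block_mx !trmx0 !trmx1. Qed.

Lemma JmxK : Jmx *m Jmx = 1%:M.
Proof.
by rewrite /Jmx mulmx_block !mul0mx !mulmx0 !mul1mx !addr0 !add0r -scalar_mx_block.
Qed.

Lemma dotC v w : dot v w = dot w v.
Proof.
have h : (w^T *m Jmx *m v)^T = v^T *m Jmx *m w.
  by rewrite !trmx_mul !trmxK trJmx mulmxA.
by rewrite /dot -h mxE.
Qed.

Lemma dotDr u v w : dot u (v + w) = dot u v + dot u w.
Proof. by rewrite /dot mulmxDr mxE. Qed.
Lemma dotZr c u v : dot u (c *: v) = c * dot u v.
Proof. by rewrite /dot -scalemxAr mxE. Qed.
Lemma dotNr u v : dot u (- v) = - dot u v.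
Proof. by rewrite /dot mulmxN mxE. Qed.
Lemma dot0r u : dot u 0 = 0.
Proof. by rewrite /dot mulmx0 mxE. Qed.
Lemma dot_sumr I (r : seq I) (P : pred I) u (F : I -> 'cV[A]_N) :
  dot u (\sum_(i <- r | P i) F i) = \sum_(i <- r | P i) dot u (F i).
Proof. by rewrite /dot mulmx_sumr summxE. Qed.
Lemma dotDl u v w : dot (u + v) w = dot u w + dot v w.
Proof. by rewrite dotC dotDr !(dotC w). Qed.
Lemma dotZl c u v : dot (c *: u) v = c * dot u v.
Proof. by rewrite dotC dotZr dotC. Qed.
Lemma dotNl u v : dot (- u) v = - dot u v.
Proof. by rewrite dotC dotNr dotC. Qed.
Lemma dot0l u : dot 0 u = 0.
Proof. by rewrite dotC dot0r. Qed.
Lemma dot_suml I (r : seq I) (P : pred I) u (F : I -> 'cV[A]_N) :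
  dot (\sum_(i <- r | P i) F i) u = \sum_(i <- r | P i) dot (F i) u.
Proof. by rewrite dotC dot_sumr; apply: eq_bigr => i _; rewrite dotC. Qed.

Lemma wedge_mul v w x : wedge v w *m x = dot w x *: v - dot v x *: w.
Proof.
rewrite /wedge mulmxBl -!mulmxA ![_^T *m (Jmx *m x)]mulmxA.
by congr (_ - _); rewrite [_ *m x]mx11_scalar mul_mx_scalar.
Qed.

Lemma dot_wedge u v w x : dot u (wedge v w *m x) =
  dot w x * dot u v - dot v x * dot u w.
Proof. by rewrite wedge_mul dotDr dotNr !dotZr. Qed.

Lemma wedgeC v w : wedge v w = - wedge w v.
Proof. by rewrite /wedge opprB. Qed.
Lemma wedge_self v : wedge v v = 0.
Proof. by rewrite /wedge subrr. Qed.
Lemma wedgeDl u v w : wedge (u + v) w = wedge u w + wedge v w.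
Proof. by rewrite /wedge linearD /= !mulmxDl mulmxDr opprD addrACA. Qed.
Lemma wedgeZl c v w : wedge (c *: v) w = c *: wedge v w.
Proof. by rewrite /wedge linearZ /= -!scalemxAl -scalemxAr scalerBr. Qed.
Lemma wedgeNl v w : wedge (- v) w = - wedge v w.
Proof. by rewrite -scaleN1r wedgeZl scaleN1r. Qed.
Lemma wedge0l w : wedge 0 w = 0.
Proof. by rewrite -(scale0r 0) wedgeZl scale0r. Qed.
Lemma wedgeDr u v w : wedge u (v + w) = wedge u v + wedge u w.
Proof. by rewrite wedgeC wedgeDl opprD -!wedgeC. Qed.
Lemma wedgeZr c v w : wedge v (c *: w) = c *: wedge v w.
Proof. by rewrite wedgeC wedgeZl -scalerN -wedgeC. Qed.
Lemma wedgeNr v w : wedge v (- w) = - wedge v w.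
Proof. by rewrite wedgeC wedgeNl -wedgeC. Qed.
Lemma wedge0r v : wedge v 0 = 0.
Proof. by rewrite wedgeC wedge0l oppr0. Qed.
Lemma wedge_sumr I (r : seq I) (P : pred I) u (F : I -> 'cV[A]_N) :
  wedge u (\sum_(i <- r | P i) F i) = \sum_(i <- r | P i) wedge u (F i).
Proof. exact: (big_morph (wedge u) (@wedgeDr u) (wedge0r u)). Qed.

Definition skew (Y : 'M[A]_N) : Prop := Y^T *m Jmx = - (Jmx *m Y).

Lemma skew_wedge v w : skew (wedge v w).
Proof.
rewrite /skew /wedge linearB /= !trmx_mul !trmxK trJmx.
rewrite mulmxBl mulmxBr opprB -!mulmxA.
by rewrite !mulmxA.
Qed.

Lemma skewD Y Z : skew Y -> skew Z -> skew (Y + Z).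
Proof. by rewrite /skew => hY hZ; rewrite linearD mulmxDl mulmxDr hY hZ opprD. Qed.
Lemma skewZ c Y : skew Y -> skew (c *: Y).
Proof. by rewrite /skew => hY; rewrite linearZ /= -scalemxAl -scalemxAr hY scalerN. Qed.
Lemma skew0 : skew 0.
Proof. by rewrite /skew trmx0 mul0mx mulmx0 oppr0. Qed.
Lemma skew_sum I (r : seq I) (P : pred I) (F : I -> 'M[A]_N) :
  (forall i, P i -> skew (F i)) -> skew (\sum_(i <- r | P i) F i).
Proof.
move=> h; elim/big_ind: _ => //; [exact: skew0 | exact: skewD].
Qed.
Lemma skew_comm X Y : skew X -> skew Y -> skew (Y *m X - X *m Y).
Proof.
rewrite /skew => hX hY; rewrite linearB /= !trmx_mul mulmxBl mulmxBr.
rewrite -!mulmxA hX hY !mulmxN !mulmxA hX hY !mulNmx !opprK -!mulmxA.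
by rewrite opprB.
Qed.

Lemma skew_dot Y v w : skew Y -> dot (Y *m v) w = - dot v (Y *m w).
Proof.
rewrite /skew => hY; rewrite /dot trmx_mul -[_ *m Y^T *m _]mulmxA hY mulmxN mulNmx mxE.
by rewrite !mulmxA.
Qed.

(** Because [Y] is skew, left multiplication of [t - Y] by the transpose of
    [v] is right multiplication of [t + Y] by [v]: left kernel vectors at [t]
    are right kernel vectors at [-t]. *)
Lemma skew_resolvent t Y (v : 'cV[A]_N) : skew Y ->
  (v^T *m Jmx) *m (t%:M - Y) = (t *: v + Y *m v)^T *m Jmx.
Proof.
rewrite /skew => hY.
have -> : (t *: v + Y *m v)^T = t *: v^T + v^T *m Y^T.
  by rewrite linearD linearZ /= trmx_mul.
rewrite [in RHS]mulmxDl.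
rewrite -(mulmxA _ Y^T) hY mulmxN mulmxBr !mulmxA.
by rewrite mul_mx_scalar scalemxAl.
Qed.

(** A skew matrix acts on the exterior square as a derivation; this makes
    commutators with [X] computable on wedges. *)
Lemma comm_wedge X v w : skew X ->
  X *m wedge v w - wedge v w *m X = wedge (X *m v) w + wedge v (X *m w).
Proof.
rewrite /skew => hX; have h u : (X *m u)^T *m Jmx = - (u^T *m Jmx *m X).
  by rewrite trmx_mul -(mulmxA _ X^T) hX mulmxN mulmxA.
rewrite /wedge !h mulmxBr mulmxBl !mulmxN !opprK !mulmxA.
by rewrite opprB addrACA; congr (_ + _); rewrite addrC.
Qed.

(** The value of [t - X], kept as a map on vectors so that [t] may be a scalar
    of any coefficient ring. *)
Definition resid (X : 'M[A]_N) (t : A) (w : 'cV[A]_N) := t *: w - X *m w.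

Lemma residD X t v w : resid X t (v + w) = resid X t v + resid X t w.
Proof. by rewrite /resid scalerDr mulmxDr opprD addrACA. Qed.
Lemma residZ X t c v : resid X t (c *: v) = c *: resid X t v.
Proof. by rewrite /resid -scalemxAr scalerBr !scalerA mulrC. Qed.
Lemma residN X t v : resid X t (- v) = - resid X t v.
Proof. by rewrite /resid mulmxN scalerN opprB opprK addrC. Qed.
Lemma residB X t v w : resid X t (v - w) = resid X t v - resid X t w.
Proof. by rewrite residD residN. Qed.

Definition bv (k : nat) : 'cV[A]_N := dv A N k.

Lemma mul_bv m (B : 'M[A]_(m, N)) (k : 'I_N) : B *m bv k = col k B.
Proof. exact: mul_dv. Qed.

Lemma bv_sum (v : 'cV[A]_N) : v = \sum_(k < N) v k 0 *: bv k.
Proof. exact: dv_sum. Qed.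

Lemma dot_bv i j : (i < N)%N -> (j < N)%N ->
  dot (bv i) (bv j) = ((j == i + q) || (i == j + q))%:R.
Proof.
move=> hi hj; rewrite /dot.
rewrite -[bv i]/(bv (Ordinal hi)) -[bv j]/(bv (Ordinal hj)).
rewrite mul_bv mxE -trJmx -trmx_mul mul_bv !mxE.
case: splitP => a /= ha; rewrite mxE; case: splitP => b /= hb; rewrite !mxE;
  have := ltn_ord a; have := ltn_ord b.
- by move=> ? ?; rewrite (_ : _ || _ = false) //; lia.
- by move=> ? ?; rewrite -val_eqE /=; congr (_%:R); lia.
- by move=> ? ?; rewrite -val_eqE /=; congr (_%:R); lia.
- by move=> ? ?; rewrite (_ : _ || _ = false) //; lia.
Qed.

(** Write [Z] as the sum of [Z e_k e_k^T]; skewness of [Z] turns the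
    antisymmetrised sum into [Z] counted twice. *)
Lemma skew_sum_wedge (Z : 'M[A]_N) : skew Z ->
  Z *+ 2 = \sum_(k < N) wedge (Z *m bv k) (Jmx *m bv k).
Proof.
move=> hZ; rewrite /wedge sumrB.
have S1 : \sum_(k < N) bv k *m (bv k)^T = 1%:M.
  apply/matrixP => i j; rewrite summxE !mxE (bigD1 i) //= big1 => [|k ki].
    by rewrite addr0 !mxE big_ord1 !mxE eqxx mul1r eq_sym.
  by rewrite !mxE big_ord1 !mxE eq_sym (negPf (ki : k != i :> nat)) mul0r.
transitivity (Z *m (\sum_(k < N) bv k *m (bv k)^T)
   - Jmx *m (\sum_(k < N) bv k *m (bv k)^T) *m Z^T *m Jmx).
  by rewrite S1 !mulmx1 -mulmxA hZ mulmxN opprK mulmxA JmxK mul1mx mulr2n.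
rewrite mulmx_sumr [Jmx *m \sum_(_ < _) _]mulmx_sumr !mulmx_suml.
congr (_ - _); apply: eq_bigr => k _; rewrite !trmx_mul ?trJmx !mulmxA //.
by rewrite -[_ *m Jmx *m Jmx]mulmxA JmxK mulmx1.
Qed.

End Form.
Arguments Jmx {A q}.
Arguments bv {A q} k.

Section DotEntries.
Variables (A : comNzRingType) (q : nat).
Lemma trJ_entry (v : 'cV[A]_(q + q)) (j : 'I_(q + q)) : (v^T *m Jmx) 0 j = dot v (bv j).
Proof. by rewrite /dot mul_bv [RHS]mxE. Qed.
Lemma Jmx_bv (k : nat) : (k < q + q)%N ->
  Jmx *m bv k = bv (if (k < q)%N then k + q else k - q)%N :> 'cV[A]_(q + q).
Proof.
move=> hk; rewrite -[bv k]/(bv (Ordinal hk)) mul_bv; apply/colP => i; rewrite !mxE.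
case: splitP => j; rewrite mxE; case: splitP => k' /= hk' hj; rewrite !mxE -?val_eqE /=;
  have := ltn_ord k'; have := ltn_ord j; case: (ltnP k q) => *;
  first [ exfalso; lia | by congr (_%:R); lia | by rewrite (_ : _ == _ = false) //; lia ].
Qed.
Lemma dot_entry (v : 'cV[A]_(q + q)) (i : 'I_(q + q)) :
  v i 0 = dot v (bv (if (i < q)%N then i + q else i - q)%N).
Proof.
have -> : @bv A q (if (i < q)%N then i + q else i - q)%N = Jmx *m bv i.
  by rewrite Jmx_bv.
by rewrite /dot mulmxA -(mulmxA _ Jmx Jmx) JmxK mulmx1 mul_bv !mxE.
Qed.
End DotEntries.

(** * Nilpotent chains and polynomial kernel vectors *)

Section Slice.
Variables (A : comNzRingType) (p n : nat).
Local Notation N := ((p + n) + (p + n))%N.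
Local Notation bv := (@bv A (p + n)).

(** The index is shifted by one, so that [X] maps [Ev j.+1] to [Ev j] also for
    [j = 0], where [Ev 0 = 0]; likewise for [Fv]. *)
Definition Ev (j : nat) : 'cV[A]_N := if j is j'.+1 then bv j' else 0.
Definition Fv (j : nat) : 'cV[A]_N := if j is j'.+1 then bv (p + j') else 0.

(** The chains issued from the first vectors of the third and fourth blocks.
    At the end of each of them the matrix [X] returns to the first block,
    which explains the two exceptional vectors [hv p.-1] and [gv n]. *)
Definition hv (i : nat) : 'cV[A]_N :=
  bv (p + n + i) + (if i.+1 == p then Ev p else 0).
Definition gv (i : nat) : 'cV[A]_N :=
  if (i < n)%N then bv (p + n + p + i) else - Ev p.

(** The action of the nilpotent matrix on the chains; together with skewness
    it determines [X] and is all that is used of it until its entries are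
    compared with the definition. *)
Record chains (X : 'M[A]_N) : Prop := Chains {
  chE : forall j, (j < p)%N -> X *m Ev j.+1 = Ev j;
  chF : forall j, (j < n)%N -> X *m Fv j.+1 = Fv j;
  chh : forall i, (i.+1 < p)%N -> X *m hv i = - hv i.+1;
  chhp : X *m hv p.-1 = Ev p.-1 *+ 2 - Fv n;
  chg : forall i, (i < n)%N -> X *m gv i = - gv i.+1;
  ch_skew : skew X }.

(** The difference of a slice element and the nilpotent matrix ([sliceSE]). *)
Definition slice_dir (a y z d : nat -> A) : 'M[A]_N :=
  \sum_(i < p.-1) d (p.-1 - i)%N *: wedge (hv i) (hv i.+1)
  + \sum_(i < n) a (n - i)%N *: wedge (gv i) (gv i.+1)
  + \sum_(j < n) y j.+1 *: wedge (hv 0) (gv j)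
  + \sum_(j < n.+1) z j.+1 *: wedge (gv n) (hv j).

(** Solutions of [(t - X) w = 0] except along [hv 0] and [gv 0], obtained by
    solving the equations one coordinate at a time; [kerv1] starts from the
    first vector of the first block and [kerv2] from the first vector of the
    second. *)
Definition kerv1 (t : A) : 'cV[A]_N :=
  \sum_(i < p) t ^+ i *: Ev i.+1
  + t ^+ p *: \sum_(i < n) (- t) ^+ (n.-1 - i) *: gv i.
Definition kerv2 (t : A) : 'cV[A]_N :=
  t ^+ n *: (Ev p *+ 2) + \sum_(i < n) t ^+ i *: Fv i.+1
  - t ^+ n *: (\sum_(i < p) (- t) ^+ (p.-1 - i) *: hv i)
  + (t ^+ n.+1 *+ 2) *: \sum_(i < n) (- t) ^+ (n.-1 - i) *: gv i.

Section Chains.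
Variable X : 'M[A]_N.
Hypothesis hX : chains X.
Hypotheses (p_gt1 : (1 < p)%N) (pn : (n < p)%N).

Local Notation resid := (resid X).

(** The sum telescopes; [E 0 = 0] removes the term at the bottom of the chain. *)
Lemma resid_up t (E : nat -> 'cV[A]_N) k :
  E 0%N = 0 -> (forall j, (j < k)%N -> X *m E j.+1 = E j) ->
  resid t (\sum_(i < k) t ^+ i *: E i.+1) = t ^+ k *: E k.
Proof.
move=> E0; elim: k => [|k IH] hE.
  by rewrite big_ord0 E0 /resid mulmx0 !scaler0 subrr.
rewrite big_ord_recr /= residD residZ IH => [|j hj]; last by apply: hE; lia.
by rewrite /resid hE // scalerBr addrC addrNK scalerA -exprSr.
Qed.

Lemma resid_down t (g : nat -> 'cV[A]_N) k :
  (forall j, (j < k)%N -> X *m g j = - g j.+1) ->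
  resid t (\sum_(i < k) (- t) ^+ (k.-1 - i) *: g i) = g k - (- t) ^+ k *: g 0%N.
Proof.
elim: k => [|k IH] hg; first by rewrite big_ord0 /resid mulmx0 scaler0 expr0 scale1r !subrr.
rewrite big_ord_recr /= subnn expr0 scale1r residD.
have -> : \sum_(i < k) (- t) ^+ (k - i) *: g i
   = (- t) *: \sum_(i < k) (- t) ^+ (k.-1 - i) *: g i.
  rewrite scaler_sumr; apply: eq_bigr => i _; rewrite scalerA -exprS.
  by congr (_ ^+ _ *: _); have := ltn_ord i; lia.
rewrite residZ IH => [|j hj]; last by apply: hg; lia.
rewrite /resid hg // opprK scalerBr scalerA -exprS addrC -!addrA addrCA.
by congr (_ + _); rewrite scaleNr addrA subrr add0r.
Qed.

Lemma gvn : gv n = - Ev p.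
Proof. by rewrite /gv ltnn. Qed.

Lemma resid_kerv1 t : resid t (kerv1 t) = - (t ^+ p * (- t) ^+ n) *: gv 0.
Proof.
rewrite /kerv1 residD residZ resid_up //; last exact: (chE hX).
rewrite resid_down; last exact: (chg hX).
by rewrite gvn scalerBr scalerN addrA addrN add0r scalerA scaleNr.
Qed.

Lemma resid_kerv2 t : resid t (kerv2 t) =
  (t ^+ n * (- t) ^+ p) *: hv 0 - (t ^+ n.+1 * (- t) ^+ n *+ 2) *: gv 0.
Proof.
rewrite /kerv2 residD residB !residD !residZ resid_up //; last exact: (chF hX).
rewrite [resid t (\sum_(i < n) _ *: gv _)]resid_down; last exact: (chg hX).
pose h' i := if (i < p)%N then hv i else Fv n - Ev p.-1 *+ 2.
have -> : \sum_(i < p) (- t) ^+ (p.-1 - i) *: hv i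
        = \sum_(i < p) (- t) ^+ (p.-1 - i) *: h' i.
  by apply: eq_bigr => i _; rewrite /h' ltn_ord.
rewrite resid_down => [|j hj]; last first.
  rewrite /h' hj; case: ltnP => jp; first exact: (chh hX).
  have -> : j = p.-1 by lia.
  by rewrite (chhp hX) opprB.
have -> : h' p = Fv n - Ev p.-1 *+ 2 by rewrite /h' ltnn.
have -> : h' 0%N = hv 0 by rewrite /h'; case: ltnP => //; lia.
rewrite /resid -scaler_nat -scalemxAr.
have -> : X *m Ev p = Ev p.-1.
  by have := chE hX (j := p.-1); rewrite (ltn_predK p_gt1); apply; lia.
rewrite gvn; apply/colP => i; rewrite !mxE exprS; move: (t ^+ n) ((- t) ^+ p) ((- t) ^+ n) (_%:R + _) => c1 c2 c3 c4; ring.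
Qed.

End Chains.

Hypotheses (p_gt1 : (1 < p)%N) (pn : (n < p)%N).

Lemma Ev_p : Ev p = bv p.-1.
Proof. by rewrite /Ev; case: p p_gt1. Qed.

Ltac dots := rewrite ?(dotDl, dotDr, dotNl, dotNr, dotZl, dotZr, dot0l, dot0r).

Lemma dot_Eh i j : (i < p)%N -> (j < p)%N -> dot (Ev i.+1) (hv j) = (i == j)%:R.
Proof.
move=> hi hj; rewrite /hv /Ev; case: p p_gt1 hi hj => // p' _ hi hj.
dots; rewrite dot_bv; try lia.
by case: (j.+1 =P _) => _; dots; rewrite ?dot_bv ?addr0 -?natrD; try lia; congr (_%:R); lia.
Qed.

Lemma dot_Eg i j : (i < p)%N -> (j <= n)%N -> dot (Ev i.+1) (gv j) = 0.
Proof.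
move=> hi hj; rewrite /gv /Ev; case: ltnP => hjn.
  by rewrite dot_bv; try lia; rewrite (_ : _ || _ = false) //; lia.
case: p p_gt1 hi => // p' _ hi.
by dots; rewrite dot_bv; try lia; rewrite (_ : _ || _ = false) ?oppr0 //; lia.
Qed.

Lemma dot_Eph j : (j < p)%N -> dot (Ev p) (hv j) = (p.-1 == j)%:R.
Proof.
by move=> hj; have := @dot_Eh p.-1 j; rewrite (ltn_predK p_gt1); apply; lia.
Qed.

Lemma dot_Epg j : (j <= n)%N -> dot (Ev p) (gv j) = 0.
Proof.
by move=> hj; have := @dot_Eg p.-1 j; rewrite (ltn_predK p_gt1); apply; lia.
Qed.

Lemma dot_Fh i j : (i < n)%N -> (j < p)%N -> dot (Fv i.+1) (hv j) = 0.
Proof.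
move=> hi hj; rewrite /hv /Ev /Fv; case: p p_gt1 pn hi hj => // p' _ _ hi hj.
dots; rewrite dot_bv; try lia.
rewrite (_ : _ || _ = false); last lia.
case: (j.+1 =P _) => _; dots; rewrite ?addr0 //.
by rewrite add0r dot_bv; try lia; rewrite (_ : _ || _ = false) //; lia.
Qed.

Lemma dot_Fg i j : (i < n)%N -> (j <= n)%N -> dot (Fv i.+1) (gv j) = (i == j)%:R.
Proof.
move=> hi hj; rewrite /gv /Ev /Fv; case: ltnP => hjn.
  by rewrite dot_bv; try lia; congr (_%:R); lia.
case: p p_gt1 pn => // p' _ pn'.
rewrite dotNr.
rewrite dot_bv; [ | lia | lia].
rewrite (_ : _ || _ = false); last lia.
rewrite (_ : (i == j) = false); last lia.
by rewrite oppr0.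
Qed.

Lemma dot_hh i j : (i < p)%N -> (j < p)%N ->
  dot (hv i) (hv j) = ((i == p.-1) && (j == p.-1)).*2%:R.
Proof.
move=> hi hj; rewrite {1}/hv dotDl.
have -> : dot (if i.+1 == p then Ev p else 0) (hv j) =
    ((i == p.-1) && (j == p.-1))%:R.
  case: (i.+1 =P _) => e1; last by rewrite dot0l (_ : _ && _ = false) //; lia.
  by rewrite dot_Eph //; congr (_%:R); lia.
rewrite /hv dotDr dot_bv; [ | lia | lia].
rewrite (_ : _ || _ = false); last lia.
case: (j.+1 =P _) => e2; last first.
  by rewrite dot0r !add0r (_ : _ && _ = false) //; lia.
rewrite /Ev; case: p p_gt1 hi hj e2 => // p' _ hi hj e2.
rewrite dot_bv; [ | lia | lia].
by rewrite add0r -natrD; congr (_%:R); lia.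
Qed.

Lemma dot_gg i j : (i <= n)%N -> (j <= n)%N -> dot (gv i) (gv j) = 0.
Proof.
move=> hi hj; rewrite {1}/gv; case: ltnP => e1; last first.
  by rewrite dotNl dot_Epg ?oppr0.
rewrite /gv; case: ltnP => e2.
  by rewrite dot_bv; [rewrite (_ : _ || _ = false) //; lia | lia | lia].
rewrite /Ev; case: p p_gt1 pn => // p' _ pn'.
by rewrite dotNr dot_bv; [rewrite (_ : _ || _ = false) ?oppr0 //; lia | lia | lia].
Qed.

Lemma dot_gh i j : (i <= n)%N -> (j < p)%N ->
  dot (gv i) (hv j) = - ((i == n) && (j == p.-1))%:R.
Proof.
move=> hi hj; rewrite /gv; case: ltnP => e1; last first.
  rewrite dotNl dot_Eph //; congr (- _%:R); lia.
rewrite (_ : _ && _ = false); last lia.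
rewrite /hv /Ev; case: p p_gt1 pn hj => // p' _ pn' hj.
rewrite dotDr dot_bv; [ | lia | lia].
rewrite (_ : _ || _ = false); last lia.
case: (j.+1 =P _) => _; rewrite ?dot0r ?addr0 ?oppr0 //.
rewrite dot_bv; [ | lia | lia].
by rewrite (_ : _ || _ = false) ?addr0 //; lia.
Qed.

(** This lemma and the next three say that the polynomial vectors are dual to
    the two chains. *)
Lemma dot_kerv1h t j : (j < p)%N -> dot (kerv1 t) (hv j) = t ^+ j.
Proof.
move=> hj; rewrite /kerv1 dotDl dotZl !dot_suml.
under eq_bigr => i _ do rewrite dotZl dot_Eh //.
rewrite (sum_pick p (fun i => t ^+ i)) hj big1 ?mulr0 ?addr0 // => i _.
by have hi := ltn_ord i; rewrite dotZl dot_gh; try lia; rewrite (_ : _ && _ = false) ?oppr0 ?mulr0 //; lia.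
Qed.

Lemma dot_kerv1g t j : (j <= n)%N -> dot (kerv1 t) (gv j) = 0.
Proof.
move=> hj; rewrite /kerv1 dotDl dotZl !dot_suml !big1 ?mulr0 ?addr0 // => i _.
  by rewrite dotZl dot_gg ?mulr0 //; have := ltn_ord i; lia.
by rewrite dotZl dot_Eg ?mulr0.
Qed.

Lemma dot_kerv2h t j : (j < p)%N -> dot (kerv2 t) (hv j) = 0.
Proof.
move=> hj; rewrite /kerv2 !dotDl dotNl !dotZl !dot_suml.
have -> : \sum_(i < n) dot (t ^+ i *: Fv i.+1) (hv j) = 0.
  by apply: big1 => i _; rewrite dotZl dot_Fh ?mulr0.
have -> : \sum_(i < n) dot ((- t) ^+ (n.-1 - i) *: gv i) (hv j) = 0.
  apply: big1 => i _; have hi := ltn_ord i.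
  by rewrite dotZl dot_gh; try lia; rewrite (_ : _ && _ = false) ?oppr0 ?mulr0 //; lia.
have -> : \sum_(i < p) dot ((- t) ^+ (p.-1 - i) *: hv i) (hv j) = (j == p.-1)%:R *+ 2.
  under eq_bigr => i _ do rewrite dotZl dot_hh //.
  case: (j =P p.-1) => jp; last first.
    by rewrite mul0rn; apply: big1 => i _; rewrite andbF mulr0.
  under eq_bigr => i _ do rewrite andbT -muln2 natrM mulr_natr mulrnAr.
  rewrite sumrMnl (sum_pick p (fun i => (- t) ^+ (p.-1 - i))).
  by rewrite (_ : p.-1 < p)%N ?subnn //; lia.
by rewrite mulr2n dotDl !dot_Eph // eq_sym -mulr2n addr0 mulr0 addr0 subrr.
Qed.

Lemma dot_kerv2g t j : (j <= n)%N -> dot (kerv2 t) (gv j) = t ^+ j.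
Proof.
move=> hj; rewrite /kerv2 !dotDl dotNl !dotZl !dot_suml.
have -> : \sum_(i < n) dot ((- t) ^+ (n.-1 - i) *: gv i) (gv j) = 0.
  apply: big1 => i _; have hi := ltn_ord i.
  by rewrite dotZl dot_gg ?mulr0 //; lia.
have -> : \sum_(i < n) dot (t ^+ i *: Fv i.+1) (gv j) = if (j < n)%N then t ^+ j else 0.
  under eq_bigr => i _ do rewrite dotZl dot_Fg //.
  exact: (sum_pick n (fun i => t ^+ i)).
have -> : \sum_(i < p) dot ((- t) ^+ (p.-1 - i) *: hv i) (gv j) = - (j == n)%:R.
  under eq_bigr => i _ do rewrite dotZl dotC dot_gh //.
  case: (j =P n) => jn; last first.
    by rewrite [RHS]oppr0; apply: big1 => i _; rewrite andFb oppr0 mulr0.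
  under eq_bigr => i _ do rewrite mulrN.
  rewrite sumrN (sum_pick p (fun i => (- t) ^+ (p.-1 - i))).
  by rewrite (_ : p.-1 < p)%N ?subnn //; lia.
rewrite mulr2n dotDl dot_Epg // addr0 !mulr0 add0r addr0.
case: ltnP => h; first by rewrite (_ : (j == n) = false) ?oppr0 ?mulr0 ?subr0 //; lia.
have -> : j = n by lia.
by rewrite eqxx add0r mulrN mulr1 opprK.
Qed.

(** Each wedge of chain vectors contributes an antisymmetric product of
    pairings with the chains; by duality these are powers of [s] and [t] in
    the four lemmas that follow. *)
Lemma dotM u x a y z d : dot u (slice_dir a y z d *m x) =
  \sum_(i < p.-1) d (p.-1 - i)%N *
     (dot (hv i.+1) x * dot u (hv i) - dot (hv i) x * dot u (hv i.+1))
  + \sum_(i < n) a (n - i)%N *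
     (dot (gv i.+1) x * dot u (gv i) - dot (gv i) x * dot u (gv i.+1))
  + \sum_(j < n) y j.+1 *
     (dot (gv j) x * dot u (hv 0) - dot (hv 0) x * dot u (gv j))
  + \sum_(j < n.+1) z j.+1 *
     (dot (hv j) x * dot u (gv n) - dot (gv n) x * dot u (hv j)).
Proof.
rewrite /slice_dir !mulmxDl 3!dotDr !mulmx_suml !dot_sumr.
by congr (_ + _ + _ + _); apply: eq_bigr => i _;
   rewrite -scalemxAl dotZr dot_wedge.
Qed.

Lemma dotM11 s t a y z d : dot (kerv1 s) (slice_dir a y z d *m kerv1 t) =
  \sum_(i < p.-1) d (p.-1 - i)%N * (t ^+ i.+1 * s ^+ i - t ^+ i * s ^+ i.+1).
Proof.
rewrite dotM [X in _ + X]big1 ?[X in _ + X + _]big1 ?[X in _ + X + _ + _]big1 ?addr0.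
- apply: eq_bigr => i _; have hi := ltn_ord i.
  by rewrite !(dotC _ (kerv1 t)) !dot_kerv1h //; lia.
- move=> i _; have hi := ltn_ord i.
  by rewrite !(dotC _ (kerv1 t)) !dot_kerv1g ?mul0r ?subr0 ?mulr0 //; lia.
- move=> i _; have hi := ltn_ord i.
  by rewrite !(dotC (gv _) (kerv1 t)) !dot_kerv1g ?mul0r ?mulr0 ?subr0 ?mulr0 //; lia.
- move=> i _; have hi := ltn_ord i.
  by rewrite !(dotC (gv _) (kerv1 t)) !dot_kerv1g ?mul0r ?mulr0 ?subr0 ?mulr0 //; lia.
Qed.

Lemma dotM12 s t a y z d : dot (kerv1 s) (slice_dir a y z d *m kerv2 t) =
  \sum_(j < n) y j.+1 * t ^+ j - t ^+ n * \sum_(j < n.+1) z j.+1 * s ^+ j.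
Proof.
rewrite dotM big1 ?add0r => [|i _]; last first.
  have hi := ltn_ord i.
  by rewrite !(dotC _ (kerv2 t)) !dot_kerv2h ?mul0r ?subr0 ?mulr0 //; lia.
rewrite big1 ?add0r => [|i _]; last first.
  have hi := ltn_ord i.
  by rewrite !dot_kerv1g ?mulr0 ?subr0 ?mulr0 //; lia.
rewrite mulr_sumr -sumrN; congr (_ + _); apply: eq_bigr => i _; have hi := ltn_ord i.
  rewrite !(dotC _ (kerv2 t)) dot_kerv2g ?dot_kerv1h ?dot_kerv2h ?mul0r ?subr0 ?mulr1 //; lia.
rewrite !(dotC _ (kerv2 t)) dot_kerv2h ?mul0r ?sub0r; last lia.
rewrite dot_kerv2g // dot_kerv1h ?mulrN //; [ring | lia].
Qed.

Lemma skewM a y z d : skew (slice_dir a y z d).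
Proof.
rewrite /slice_dir; do !apply: skewD; apply: skew_sum => i _; apply: skewZ; exact: skew_wedge.
Qed.

Lemma dotM21 s t a y z d : dot (kerv2 s) (slice_dir a y z d *m kerv1 t) =
  s ^+ n * (\sum_(j < n.+1) z j.+1 * t ^+ j) - \sum_(j < n) y j.+1 * s ^+ j.
Proof.
by rewrite dotC skew_dot ?dotM12 ?opprB //; exact: skewM.
Qed.

Lemma dotM22 s t a y z d : dot (kerv2 s) (slice_dir a y z d *m kerv2 t) =
  \sum_(i < n) a (n - i)%N * (t ^+ i.+1 * s ^+ i - t ^+ i * s ^+ i.+1).
Proof.
rewrite dotM big1 ?add0r => [|i _]; last first.
  have hi := ltn_ord i.
  by rewrite !(dotC _ (kerv2 t)) !dot_kerv2h ?mul0r ?subr0 ?mulr0 //; lia.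
rewrite [X in _ + X]big1 ?[X in _ + X + _]big1 ?addr0.
- apply: eq_bigr => i _; have hi := ltn_ord i.
  by rewrite !(dotC _ (kerv2 t)) !dot_kerv2g //; lia.
- move=> i _; have hi := ltn_ord i.
  by rewrite !(dotC _ (kerv2 t)) !dot_kerv2h ?mul0r ?mulr0 ?subrr ?mulr0 //; lia.
- move=> i _; have hi := ltn_ord i.
  by rewrite !(dotC _ (kerv2 t)) !dot_kerv2h ?mul0r ?mulr0 ?subrr ?mulr0 //; lia.
Qed.

End Slice.

(** * Entries, and passage to polynomial coefficients *)

Section Entries.
Variables (A : comNzRingType) (p n : nat).
Hypotheses (p_gt1 : (1 < p)%N) (pn : (n < p)%N).
Local Notation N := ((p + n) + (p + n))%N.
Local Notation bv := (@bv A (p + n)).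
Local Notation Ev := (Ev A p n). Local Notation Fv := (Fv A p n).
Local Notation hv := (hv A p n). Local Notation gv := (gv A p n).

Lemma bvE k (i : 'I_N) : bv k i 0 = (i == k :> nat)%:R.
Proof. by rewrite mxE. Qed.
Lemma EvE k (i : 'I_N) : Ev k i 0 = (i.+1 == k :> nat)%:R.
Proof. by case: k => [|k]; rewrite /Ev ?bvE ?mxE //. Qed.
Lemma FvE k (i : 'I_N) : Fv k i 0 = ((0 < k)%N && (i.+1 == (p + k)%N :> nat))%:R.
Proof.
case: k => [|k]; rewrite /Fv ?bvE ?mxE // addnS eqSS //.
Qed.
Lemma hvE k (i : 'I_N) :
  hv k i 0 = (i == (p + n + k)%N :> nat)%:R + ((k.+1 == p) && (i.+1 == p :> nat))%:R.
Proof.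
by rewrite /hv mxE bvE; congr (_ + _); case: ifP => _; rewrite ?EvE ?mxE.
Qed.
Lemma gvE k (i : 'I_N) : gv k i 0 =
  if (k < n)%N then (i == (p + n + p + k)%N :> nat)%:R else - (i.+1 == p :> nat)%:R.
Proof. by rewrite /gv; case: ifP => _; rewrite ?bvE // mxE EvE. Qed.

Lemma bv_h k : (k.+1 < p)%N -> bv (p + n + k) = hv k.
Proof. by move=> h; rewrite /hv (_ : (k.+1 == p) = false) ?addr0 //; lia. Qed.
Lemma bv_hp : bv (p + n + p.-1) = hv p.-1 - Ev p.
Proof. by rewrite /hv (ltn_predK p_gt1) eqxx addrK. Qed.
Lemma bv_g k : (k < n)%N -> bv (p + n + p + k) = gv k.
Proof. by move=> h; rewrite /gv h. Qed.

Section MatrixEntries.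
Variable X : 'M[A]_N.
Hypothesis hX : chains X.

(** The entries of [X] as a function of numerical indices, so that statements
    on supports become linear arithmetic. *)
Definition xentry (r k : nat) : A :=
  if (k < p)%N then (r.+1 == k)%:R
  else if (k < p + n)%N then ((p < k)%N && (r.+1 == k))%:R
  else if (k.+1 < p + n + p)%N then
    - (r == k.+1)%:R - ((k.+2 == p + n + p)%N && (r.+1 == p))%:R
  else if (k < p + n + p)%N then (r.+2 == p)%:R - ((0 < n)%N && (r.+1 == p + n)%N)%:R
  else if (k.+1 < p + n + p + n)%N then - (r == k.+1)%:R
  else (r.+1 == p)%:R.

Lemma chain_entry (r k : 'I_N) : X r k = xentry r k.
Proof.
have -> : X r k = (X *m bv k) r 0 by rewrite mul_bv mxE.
have hk := ltn_ord k; rewrite /xentry.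
case: ltnP => h1; first by rewrite (chE hX h1) EvE.
case: ltnP => h2.
  have {1}-> : nat_of_ord k = (p + (k - p))%N by lia.
  rewrite -[bv _]/(Fv (k - p).+1) (chF hX); last lia.
  by rewrite FvE; congr (_%:R); lia.
case: ltnP => h3.
  have {1}-> : nat_of_ord k = (p + n + (k - (p + n)))%N by lia.
  rewrite bv_h; last lia.
  rewrite (chh hX); last lia.
  by rewrite mxE hvE opprD; congr (- _%:R - _%:R); lia.
case: ltnP => h4.
  have {1}-> : nat_of_ord k = (p + n + p.-1)%N by lia.
  rewrite bv_hp mulmxBr (chhp hX).
  have -> : X *m Ev p = Ev p.-1.
    by have := chE hX (j := p.-1); rewrite (ltn_predK p_gt1); apply; lia.
  rewrite mulr2n !mxE !EvE FvE.
  have -> : (r.+1 == p.-1) = (r.+2 == p) by lia.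
  by rewrite addrAC addrK; congr (_ - _%:R); lia.
have {1}-> : nat_of_ord k = (p + n + p + (k - (p + n + p)))%N by lia.
rewrite bv_g; last lia.
rewrite (chg hX); last lia.
rewrite mxE gvE; case: ltnP => h5; case: ltnP => h6; try lia.
  by congr (- _%:R); lia.
by rewrite opprK.
Qed.

End MatrixEntries.

(** The rows met by no chain vector and, in [lower_col], the columns
    orthogonal to all of them.  There a slice direction vanishes and the slice
    element coincides with [X]. *)
Definition upper_row (k : nat) := (k.+1 < p)%N || (p <= k < p + n)%N.
Definition lower_col (k : nat) := (p + n <= k < (p + n + p).-1)%N || (p + n + p <= k)%N.

Lemma hv_upper k (i : 'I_N) : (k < p)%N -> upper_row i -> hv k i 0 = 0.
Proof.
rewrite /upper_row => hk hi; have := ltn_ord i => hN; rewrite hvE.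
have -> : (i == (p + n + k)%N :> nat) = false by lia.
by rewrite (_ : _ && _ = false) ?addr0 //; lia.
Qed.
Lemma gv_upper k (i : 'I_N) : upper_row i -> gv k i 0 = 0.
Proof.
rewrite /upper_row => hi; rewrite gvE; case: ifP => _.
  by rewrite (_ : _ == _ = false) //; lia.
by rewrite (_ : _ == _ = false) ?oppr0 //; lia.
Qed.

Lemma dot_hv_lower k i : (k < p)%N -> (i < N)%N -> lower_col i -> dot (hv k) (bv i) = 0.
Proof.
rewrite /lower_col => hk hN hi; rewrite /hv dotDl dot_bv; [|lia|lia].
rewrite (_ : _ || _ = false); last lia.
case: ifP => _; rewrite ?dot0l ?addr0 //.
rewrite /Ev; case: p p_gt1 pn hi hN hk => // p' _ _ hi hN hk.
by rewrite dot_bv; [|lia|lia]; rewrite (_ : _ || _ = false) ?addr0 //; lia.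
Qed.
Lemma dot_gv_lower k i : (i < N)%N -> lower_col i -> dot (gv k) (bv i) = 0.
Proof.
rewrite /lower_col => hN hi; rewrite /gv; case: ltnP => hk.
  by rewrite dot_bv; [|lia|lia]; rewrite (_ : _ || _ = false) //; lia.
rewrite /Ev; case: p p_gt1 pn hi hN => // p' _ _ hi hN.
by rewrite dotNl dot_bv; [|lia|lia]; rewrite (_ : _ || _ = false) ?oppr0 //; lia.
Qed.

Lemma wedge_row0 (v w : 'cV[A]_N) (x : 'cV[A]_N) (i : 'I_N) :
  v i 0 = 0 -> w i 0 = 0 -> (wedge v w *m x) i 0 = 0.
Proof. by move=> hv hw; rewrite wedge_mul !mxE hv hw !mulr0 subr0. Qed.

Lemma slice_dir_upper (a y z d : nat -> A) (x : 'cV[A]_N) (i : 'I_N) : upper_row i -> (slice_dir p n a y z d *m x) i 0 = 0.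
Proof.
move=> hi; rewrite /slice_dir !mulmxDl !mulmx_suml 3!mxE !summxE.
rewrite !big1 ?addr0 // => k _; have hk := ltn_ord k; rewrite -scalemxAl mxE.
- by rewrite wedge_row0 ?mulr0 //; [exact: gv_upper | apply: hv_upper => //; lia].
- by rewrite wedge_row0 ?mulr0 //; [apply: hv_upper => //; lia | exact: gv_upper].
- by rewrite wedge_row0 ?mulr0 //; exact: gv_upper.
- by rewrite wedge_row0 ?mulr0 //; apply: hv_upper => //; lia.
Qed.

Lemma slice_dir_lower (a y z d : nat -> A) i : (i < N)%N -> lower_col i -> slice_dir p n a y z d *m bv i = 0.
Proof.
move=> hN hi; rewrite /slice_dir !mulmxDl !mulmx_suml.
rewrite !big1 ?addr0 // => k _; have hk := ltn_ord k; rewrite -scalemxAl wedge_mul.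
- by rewrite dot_gv_lower ?dot_hv_lower ?scale0r ?subr0 ?scaler0 //; lia.
- by rewrite dot_gv_lower ?dot_hv_lower ?scale0r ?subr0 ?scaler0 //; lia.
- by rewrite !dot_gv_lower ?scale0r ?subr0 ?scaler0 //; lia.
- by rewrite !dot_hv_lower ?scale0r ?subr0 ?scaler0 //; lia.
Qed.

End Entries.

Section Mapping.
Variables (K : comNzRingType) (p n : nat).
Local Notation N := ((p + n) + (p + n))%N.
Local Notation "v ^P" := (map_mx (@polyC K) v) (at level 2).

Lemma map_Jmx q : (@Jmx K q)^P = Jmx.
Proof. by rewrite /Jmx map_block_mx !map_mx0 !map_mx1. Qed.
Lemma map_bv q k : (@bv K q k)^P = bv k.
Proof. by apply/matrixP => i j; rewrite !mxE rmorph_nat. Qed.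
Lemma map_Ev j : (Ev K p n j)^P = Ev _ p n j.
Proof. by case: j => [|j]; rewrite /Ev ?map_bv ?map_mx0. Qed.
Lemma map_Fv j : (Fv K p n j)^P = Fv _ p n j.
Proof. by case: j => [|j]; rewrite /Fv ?map_bv ?map_mx0. Qed.
Lemma map_hv j : (hv K p n j)^P = hv _ p n j.
Proof. by rewrite /hv map_mxD map_bv; case: ifP; rewrite ?map_Ev ?map_mx0. Qed.
Lemma map_gv j : (gv K p n j)^P = gv _ p n j.
Proof. by rewrite /gv; case: ifP; rewrite ?map_bv ?map_mxN ?map_Ev. Qed.
Lemma map_wedge q (v w : 'cV[K]_(q + q)) : (wedge v w)^P = wedge v^P w^P.
Proof. by rewrite /wedge map_mxB !map_mxM -!map_trmx map_Jmx. Qed.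

Lemma map_skew q (Y : 'M[K]_(q + q)) : skew Y -> skew Y^P.
Proof. by rewrite /skew -map_Jmx map_trmx -!map_mxM => ->; rewrite map_mxN. Qed.

Lemma map_chains (X : 'M[K]_N) : chains X -> chains X^P.
Proof.
move=> hX; split.
- by move=> j hj; rewrite -!map_Ev -map_mxM (chE hX).
- by move=> j hj; rewrite -!map_Fv -map_mxM (chF hX).
- by move=> j hj; rewrite -!map_hv -map_mxM (chh hX) // map_mxN.
- by rewrite -map_hv -map_Ev -map_Fv -map_mxM (chhp hX) mulr2n map_mxB map_mxD mulr2n.
- by move=> j hj; rewrite -!map_gv -map_mxM (chg hX) // map_mxN.
- exact: map_skew (ch_skew hX).
Qed.

Lemma map_slice_dir a y z d : (slice_dir p n a y z d : 'M[K]_N)^P =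
  slice_dir p n (polyC \o a) (polyC \o y) (polyC \o z) (polyC \o d).
Proof.
rewrite /slice_dir !map_mxD !(big_morph _ (@map_mxD _ _ _ _ _) (map_mx0 _ _ _)).
congr (_ + _ + _ + _); apply: eq_bigr => i _;
  by rewrite map_mxZ map_wedge ?map_hv ?map_gv.
Qed.

End Mapping.

(** * Determinants by elimination *)

Section Det.
Variables (K : comNzRingType) (N : nat).
Implicit Types (A : 'M[K]_N).

(** In the Leibniz expansion, a permutation with a nonzero term never raises
    [rho], hence preserves it, since the sum of its values does not change.
    It therefore fixes every index outside [c1], [c2], and either fixes or
    exchanges these two. *)
Lemma det_ranked2 A (c1 c2 : 'I_N) (rho : 'I_N -> nat) :
  c1 != c2 -> rho c1 = rho c2 ->
  (forall i j, A i j != 0 ->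
     [|| i == j, (rho j < rho i)%N | (i \in pred2 c1 c2) && (j \in pred2 c1 c2)]) ->
  \det A = (A c1 c1 * A c2 c2 - A c1 c2 * A c2 c1)
           * \prod_(i | i \notin pred2 c1 c2) A i i.
Proof.
move=> c12 rho12 hA.
have split_prod (s : 'S_N) : \prod_i A i (s i) =
    A c1 (s c1) * A c2 (s c2) * \prod_(i | i \notin pred2 c1 c2) A i (s i).
  rewrite (bigD1 c1) //= (bigD1 c2) 1?eq_sym //= mulrA; congr (_ * _).
  by apply: eq_bigl => i; rewrite !inE negb_or.
rewrite /determinant (bigD1 1%g) //= (bigD1 (tperm c1 c2)) /=; last first.
  apply/eqP => /permP/(_ c1); rewrite tpermL perm1 => e.
  by rewrite e eqxx in c12.
rewrite [X in _ + (_ + X)]big1 ?addr0 => [|s /andP[s1 st]]; last first.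
  case: (pickP (fun i => A i (s i) == 0)) => [i /eqP hi|hs0].
    by rewrite (bigD1 i) //= hi mul0r mulr0.
  have hs i : A i (s i) != 0 by rewrite hs0.
  exfalso.
  (* nonzero entries never raise [rho] along [s] *)
  have hle i : (rho (s i) <= rho i)%N.
    case/or3P: (hA _ _ (hs i)) => [/eqP <- //|/ltnW //|].
    by rewrite !inE => /andP[/orP[]/eqP-> /orP[]/eqP->] //; rewrite rho12.
  have hs_id (i : 'I_N) : i \notin pred2 c1 c2 -> s i = i.
    move=> ic; case/or3P: (hA _ _ (hs i)) => [/eqP <- //||]; last by rewrite (negPf ic).
    have : (\sum_(i < N) rho (s i) = \sum_(i < N) rho i)%N.
      by rewrite [RHS](reindex_inj (@perm_inj _ s)).
    rewrite (bigD1 i) //= [RHS](bigD1 i) //= => e lt.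
    have : (\sum_(j < N | j != i) rho (s j) <= \sum_(j < N | j != i) rho j)%N.
      by apply: leq_sum.
    by move=> /(leq_add lt); rewrite addSn e ltnn.
  have hin i : i \in pred2 c1 c2 -> s i \in pred2 c1 c2.
    move=> ic; apply: contraT => h.
    by have := hs_id _ h => /perm_inj e; rewrite e ic in h.
  have [h1 h2] : s c1 \in pred2 c1 c2 /\ s c2 \in pred2 c1 c2.
    by split; apply: hin; rewrite !inE eqxx ?orbT.
  have n12 : s c1 != s c2 by rewrite (inj_eq (@perm_inj _ s)).
  move: h1 h2 n12; rewrite !inE => /orP[]/eqP e1 /orP[]/eqP e2; rewrite e1 e2 ?eqxx // => _.
    case/eqP: s1; apply/permP => i; rewrite perm1.
    case: (boolP (i \in pred2 c1 c2)) => [|/hs_id //].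
    by rewrite !inE => /orP[]/eqP->.
  case/eqP: st; apply/permP => i.
  case: (boolP (i \in pred2 c1 c2)) => [|h].
    by rewrite !inE => /orP[]/eqP->; rewrite ?tpermL ?tpermR.
  rewrite (hs_id _ h) tpermD //; apply/eqP => e; move: h;
  by rewrite !inE e eqxx ?orbT.
rewrite odd_perm1 odd_tperm c12 expr0 expr1 mul1r mulN1r !split_prod.
rewrite !perm1 tpermL tpermR mulrBl; congr (_ * _ - _ * _).
  by apply: eq_bigr => i _; rewrite perm1.
apply: eq_bigr => i; rewrite !inE negb_or => /andP[i1 i2].
by rewrite tpermD // eq_sym.
Qed.

Definition rowrepl (r1 r2 : 'I_N) (l1 l2 : 'rV[K]_N) : 'M[K]_N :=
  \matrix_(i, j) if i == r1 then l1 0 j else if i == r2 then l2 0 j else (i == j)%:R.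

Lemma rowreplM r1 r2 l1 l2 A i j : (rowrepl r1 r2 l1 l2 *m A) i j =
  if i == r1 then (l1 *m A) 0 j else if i == r2 then (l2 *m A) 0 j else A i j.
Proof.
rewrite !mxE; case: eqP => [->|/eqP n1]; last case: eqP => [e2|/eqP n2].
- by apply: eq_bigr => k _; rewrite mxE eqxx.
- by apply: eq_bigr => k _; rewrite mxE (negPf n1) e2 eqxx.
- rewrite (bigD1 i) //= big1 ?addr0 => [|k ki].
    by rewrite mxE (negPf n1) (negPf n2) eqxx mul1r.
  by rewrite mxE (negPf n1) (negPf n2) eq_sym (negPf ki) mul0r.
Qed.

Lemma det_rowrepl r1 r2 l1 l2 : r1 != r2 ->
  \det (rowrepl r1 r2 l1 l2) = l1 0 r1 * l2 0 r2 - l1 0 r2 * l2 0 r1.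
Proof.
move=> r12; rewrite (@det_ranked2 _ r1 r2 (fun i => i \in pred2 r1 r2)) //.
- rewrite !mxE !eqxx [r2 == r1]eq_sym (negPf r12) big1 ?mulr1 // => i.
  by rewrite !inE negb_or !mxE eqxx => /andP[/negPf-> /negPf->].
- by rewrite !inE !eqxx orbT.
- move=> i j; rewrite !mxE !inE.
  case: (i == r1); case: (i == r2); case: (j == r1); case: (j == r2);
    case: (i == j); rewrite //= ?eqxx //.
Qed.

(** Elimination in one step.  Replace the rows [s c1], [s c2] of [A] by
    combinations [l1 *m A], [l2 *m A] of its rows, and its columns [c1], [c2]
    by [A *m v1], [A *m v2].  This multiplies the determinant by two minors of
    order two, and the rows of the result, permuted by [s], satisfy the
    triangularity condition of [det_ranked2]. *)
Lemma det_reduce A (s : 'S_N) (c1 c2 : 'I_N) (rho : 'I_N -> nat)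
    (l1 l2 : 'rV[K]_N) (v1 v2 : 'cV[K]_N) (dg : 'I_N -> K) :
  c1 != c2 -> rho c1 = rho c2 ->
  (forall i : 'I_N, i \notin pred2 c1 c2 -> A (s i) i = dg i) ->
  (forall i j : 'I_N, i \notin pred2 c1 c2 -> j \notin pred2 c1 c2 ->
     A (s i) j != 0 -> (i == j) || (rho j < rho i)%N) ->
  (forall i : 'I_N, i \notin pred2 c1 c2 ->
     ((A *m v1) (s i) 0 != 0) || ((A *m v2) (s i) 0 != 0) -> (rho c1 < rho i)%N) ->
  (forall j : 'I_N, j \notin pred2 c1 c2 ->
     ((l1 *m A) 0 j != 0) || ((l2 *m A) 0 j != 0) -> (rho j < rho c1)%N) ->
  (l1 0 (s c1) * l2 0 (s c2) - l1 0 (s c2) * l2 0 (s c1)) * \det A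
    * (v1 c1 0 * v2 c2 0 - v1 c2 0 * v2 c1 0) =
  (-1) ^+ s * \prod_(i | i \notin pred2 c1 c2) dg i
  * ((l1 *m A *m v1) 0 0 * (l2 *m A *m v2) 0 0
     - (l1 *m A *m v2) 0 0 * (l2 *m A *m v1) 0 0).
Proof.
move=> c12 rho12 hdg hA hv hl.
have s12 : s c1 != s c2 by rewrite (inj_eq (@perm_inj _ s)).
pose L := rowrepl (s c1) (s c2) l1 l2.
pose U := (rowrepl c1 c2 v1^T v2^T)^T.
pose B := row_perm s (L *m A *m U).
have UE m (C : 'M[K]_(m, N)) i j : (C *m U) i j =
   if j == c1 then (C *m v1) i 0 else if j == c2 then (C *m v2) i 0 else C i j.
  have -> : C *m U = (rowrepl c1 c2 v1^T v2^T *m C^T)^T by rewrite trmx_mul trmxK.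
  rewrite !mxE; case: eqP => [->|/eqP n1]; last case: eqP => [->|/eqP n2].
  - by apply: eq_bigr => k _; rewrite !mxE eqxx mulrC.
  - by apply: eq_bigr => k _; rewrite !mxE eqxx eq_sym (negPf c12) mulrC.
  - rewrite (bigD1 j) //= big1 ?addr0 => [|k kj].
      by rewrite !mxE (negPf n1) (negPf n2) eqxx mul1r.
    by rewrite !mxE (negPf n1) (negPf n2) eq_sym (negPf kj) mul0r.
have BE i j : B i j =
   let l := if i == c1 then l1 else if i == c2 then l2 else row (s i) A in
   let x := if i == c1 then l1 *m A else if i == c2 then l2 *m A else row (s i) A in
   if j == c1 then (x *m v1) 0 0 else if j == c2 then (x *m v2) 0 0 else x 0 j.
  rewrite mxE UE /=.
  have R k : row (s i) (L *m A) 0 k = (if i == c1 then l1 *m A else if i == c2 then l2 *m A else row (s i) A) 0 k.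
    rewrite [LHS]mxE rowreplM !(inj_eq (@perm_inj _ s)).
    by case: ifP => _; [|case: ifP => _]; rewrite // mxE.
  have RM (w : 'cV_N) : (L *m A *m w) (s i) 0 =
     ((if i == c1 then l1 *m A else if i == c2 then l2 *m A else row (s i) A) *m w) 0 0.
    by rewrite [LHS]mxE [RHS]mxE; apply: eq_bigr => k _; rewrite -R [in RHS]mxE.
  by rewrite 2!RM; have := R j; rewrite [X in X = _ -> _]mxE => ->.
have detB : \det B = (-1) ^+ s * (\det L * \det A * \det U).
  by rewrite /B row_permE !det_mulmx det_perm.
have detU : \det U = v1 c1 0 * v2 c2 0 - v1 c2 0 * v2 c1 0.
  by rewrite det_tr det_rowrepl // !mxE.
have -> : (l1 0 (s c1) * l2 0 (s c2) - l1 0 (s c2) * l2 0 (s c1)) * \det A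
    * (v1 c1 0 * v2 c2 0 - v1 c2 0 * v2 c1 0) = (-1) ^+ s * \det B.
  by rewrite detB signrMK -detU det_rowrepl.
rewrite -mulrA; congr (_ * _).
rewrite (@det_ranked2 B c1 c2 rho) //; last first.
  move=> i j; rewrite BE !inE /=.
  case: (eqVneq i c1) => [->|i1].
    case: (eqVneq j c1) => [->|j1] //; case: (eqVneq j c2) => [->|j2]; rewrite ?orbT // orbF.
    by move=> h; rewrite hl ?orbT // ?inE ?negb_or ?j1 ?j2 ?h.
  case: (eqVneq i c2) => [->|i2].
    case: (eqVneq j c1) => [->|j1]; rewrite ?orbT //; case: (eqVneq j c2) => [->|j2]; rewrite ?orbT // ?orbF.
    by move=> h; rewrite -rho12 hl ?orbT // ?inE ?negb_or ?j1 ?j2 ?h ?orbT.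
  have ic : i \notin pred2 c1 c2 by rewrite !inE negb_or i1.
  rewrite !orbF -!row_mul mxE.
  case: (eqVneq j c1) => [->|j1] h; first by rewrite hv ?orbT ?h.
  move: h; case: (eqVneq j c2) => [->|j2]; rewrite mxE => h.
    by rewrite -rho12 hv ?orbT ?h ?orbT.
  by apply: hA; rewrite // !inE negb_or j1.
rewrite mulrC; congr (_ * _).
  apply: eq_bigr => i ic; rewrite BE /=; have := ic.
  by rewrite !inE negb_or => /andP[/negPf-> /negPf->]; rewrite mxE hdg.
by rewrite !BE /= !eqxx [c2 == c1]eq_sym (negPf c12).
Qed.

End Det.

(** * The characteristic polynomial as a two by two determinant *)

Section Pivots.
Variables (K : comNzRingType) (p n : nat).
Hypotheses (p_gt1 : (1 < p)%N) (pn : (n < p)%N).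
Local Notation N := ((p + n) + (p + n))%N.

(** The row of the constant pivot that eliminates column [k] of [t - X].  The
    columns [col1] and [col2] have no pivot and are sent to the two rows that
    are replaced.  The second column is the first one of the second block, or,
    when that block is empty, the last one of the third block. *)
Definition pivn (k : nat) : nat := (
  if k == 0%N then p + n
  else if (k < p)%N then k.-1
  else if (k < p + n)%N then (if k == p then p + n + p else k.-1)
  else if k == (p + n + p).-1 then (p + n).-1
  else if k == (p + n + p + n).-1 then p.-1
  else k.+1)%N.

Lemma pivn_lt k : (k < N)%N -> (pivn k < N)%N.
Proof. by rewrite /pivn => hk; repeat (case: ifP; cbv iota); lia. Qed.

Lemma pivn_inj i j : (i < N)%N -> (j < N)%N -> pivn i = pivn j -> i = j.
Proof.
by rewrite /pivn => hi hj; repeat (case: ifP; cbv iota); lia.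
Qed.

Definition piv_ord (i : 'I_N) : 'I_N := Ordinal (pivn_lt (ltn_ord i)).
Lemma piv_ord_inj : injective piv_ord.
Proof.
move=> i j /(congr1 (@nat_of_ord _)) /= h; apply: val_inj.
exact: (pivn_inj (ltn_ord i) (ltn_ord j) h).
Qed.
Definition piv : 'S_N := perm piv_ord_inj.
Lemma pivE i : nat_of_ord (piv i) = pivn i.
Proof. by rewrite permE. Qed.

Lemma col1_lt : (0 < N)%N. Proof. lia. Qed.
Definition col1 : 'I_N := Ordinal col1_lt.
Definition col2n : nat := (if n == 0 then (p + n + p).-1 else p)%N.
Lemma col2_lt : (col2n < N)%N. Proof. by rewrite /col2n; case: ifP; lia. Qed.
Definition col2 : 'I_N := Ordinal col2_lt.

(** The order in which the columns are eliminated: the second block and the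
    last column of the third, then the first block, then the two special
    columns, then the third and the fourth block backwards. *)
Definition pivot_rank (k : nat) : nat := (
  if k == 0%N then n + p
  else if k == col2n then n + p
  else if (k < p)%N then n + k
  else if (k < p + n)%N then k - p
  else if k == (p + n + p).-1 then n
  else if (k < p + n + p)%N then n + p + (p - (k - (p + n)))
  else n + p + p + (n - (k - (p + n + p))) + 1)%N.

(** Whether the pivot of column [k] is -1 rather than 1. *)
Definition pivsign (k : nat) : bool :=
  (k < p + n)%N || ((0 < n)%N && (k == (p + n + p + n).-1)).

Lemma notin_cols (i : 'I_N) : (i \notin pred2 col1 col2) = (i != 0%N :> nat) && (i != col2n :> nat).
Proof. by rewrite !inE negb_or. Qed.

Lemma boolR_eq0 (A : nzRingType) (b : bool) : ((b%:R : A) == 0) = ~~ b.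
Proof. by case: b; rewrite ?eqxx ?oner_eq0. Qed.

Lemma pivn_upper k : (k < N)%N -> k != 0%N -> k != col2n -> ~~ lower_col p n k -> upper_row p n (pivn k).
Proof.
rewrite /upper_row /lower_col /pivn /col2n => hN h0 h2 hi.
by move: h2; repeat (case: ifP; cbv iota); lia.
Qed.

Lemma pivot_rank_lower k : (k < N)%N -> lower_col p n k -> (n + p < pivot_rank k)%N.
Proof.
rewrite /pivot_rank /lower_col /col2n => hN hi.
by repeat (case: ifP; cbv iota); lia.
Qed.
Lemma pivot_rank_nlower k : (k < N)%N -> k != 0%N -> k != col2n -> ~~ lower_col p n k -> (pivot_rank k < n + p)%N.
Proof.
rewrite /pivot_rank /lower_col /col2n => hN h0 h2 hi.
by move: h2; repeat (case: ifP; cbv iota); lia.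
Qed.

Section Pencil.
Variables (X : 'M[K]_N) (a y z d : nat -> K).
Hypothesis hX : chains X.
Local Notation "v ^P" := (map_mx (@polyC K) v) (at level 2).
Local Notation M := (slice_dir p n (polyC \o a) (polyC \o y) (polyC \o z) (polyC \o d)).
Let S := X + slice_dir p n a y z d.
Let T := char_poly_mx S.
Local Notation kerv1 := (@kerv1 {poly K} p n).
Local Notation kerv2 := (@kerv2 {poly K} p n).

Let hXP := map_chains hX.

Lemma pencilE : T = 'X%:M - X^P - M.
Proof. by rewrite /T /char_poly_mx /S map_mxD map_slice_dir opprD addrA. Qed.

Lemma pencil_mul v : T *m v = resid X^P 'X v - M *m v.
Proof. by rewrite pencilE !mulmxBl mul_scalar_mx. Qed.

Lemma skewS : skew (X^P + M).
Proof. by apply: skewD; [exact: ch_skew | exact: skewM]. Qed.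

Lemma mul_pencil (v : 'cV[{poly K}]_N) :
  (v^T *m Jmx) *m T = - ((resid X^P (- 'X) v - M *m v)^T *m Jmx).
Proof.
have -> : T = 'X%:M - (X^P + M) by rewrite pencilE -addrA -opprD.
have -> : resid X^P (- 'X) v - M *m v = - ('X *: v + (X^P + M) *m v).
  rewrite /resid [(_ + M) *m v]mulmxDl; move: (M *m v) => Mv.
  by rewrite scaleNr opprD opprD addrA.
by rewrite skew_resolvent ?linearN ?mulNmx ?opprK //; exact: skewS.
Qed.

Lemma pencil_entry (i j : 'I_N) : T i j =
  'X *+ (i == j) - xentry {poly K} p n i j - (M *m bv j) i 0.
Proof.
have E (B C D : 'M[{poly K}]_N) : (B - C - D) i j = B i j - C i j - D i j.
  by rewrite !mxE.
by rewrite pencilE E (chain_entry p_gt1 pn hXP) mul_bv [('X%:M : 'M[{poly K}]_N) i j]mxE [(col _ _) _ _]mxE.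
Qed.

Lemma pencil_piv (i : 'I_N) : i \notin pred2 col1 col2 ->
  T (piv i) i = (-1) ^+ (pivsign i).
Proof.
rewrite notin_cols => /andP[h0 h2]; have hi := ltn_ord i.
have M0 : (M *m bv i) (piv i) 0 = 0.
  case: (boolP (lower_col p n i)) => hin; first by rewrite slice_dir_lower // mxE.
  by apply: slice_dir_upper => //; rewrite pivE; exact: pivn_upper.
rewrite pencil_entry M0 subr0.
have -> : (piv i == i) = false.
  apply/eqP => /(congr1 (@nat_of_ord _)); rewrite pivE /pivn.
  by repeat (case: ifP; cbv iota); lia.
rewrite mulr0n sub0r pivE.
have xb : xentry {poly K} p n (pivn i) i = (-1) ^+ (~~ pivsign i).
  move: (nat_of_ord i) hi h0 h2 => k hk h0 h2.
  rewrite /xentry /pivsign.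
  case: ltnP => h1.
    rewrite (_ : (_ == k) = true); last by rewrite /pivn; repeat (case: ifP; cbv iota); lia.
    by rewrite (_ : (k < p + n)%N) //; lia.
  case: ltnP => h3.
    rewrite (_ : _ && _ = true) //.
    by move: h2; rewrite /pivn /col2n; repeat (case: ifP; cbv iota); lia.
  case: ltnP => h4.
    rewrite (_ : (pivn k == _) = true); last by rewrite /pivn; repeat (case: ifP; cbv iota); lia.
    rewrite (_ : _ && _ = false); last by rewrite /pivn; repeat (case: ifP; cbv iota); lia.
    by rewrite subr0 (_ : _ || _ = false) //; lia.
  case: ltnP => h5.
    move: h2; rewrite /col2n; case: ifP => n0 h2; first lia.
    rewrite (_ : (_ == p) = false); last by rewrite /pivn; repeat (case: ifP; cbv iota); lia.
    rewrite (_ : _ && _ = true); last by rewrite /pivn; repeat (case: ifP; cbv iota); lia.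
    by rewrite sub0r (_ : _ || _ = false) //; lia.
  case: ltnP => h6.
    rewrite (_ : (pivn k == _) = true); last by rewrite /pivn; repeat (case: ifP; cbv iota); lia.
    by rewrite (_ : _ || _ = false) //; lia.
  rewrite (_ : (_ == p) = true); last by rewrite /pivn; repeat (case: ifP; cbv iota); lia.
  by rewrite (_ : _ || _ = true) //; lia.
by rewrite xb; case: (pivsign i); rewrite ?expr0 ?expr1 ?opprK.
Qed.

Lemma xentry_rank (k l : nat) : (k < N)%N -> (l < N)%N ->
   k != 0%N -> k != col2n -> l != 0%N -> l != col2n ->
   xentry {poly K} p n (pivn k) l != 0 -> (k == l) || (pivot_rank l < pivot_rank k)%N.
Proof.
move=> hk hl k0 k2 l0 l2; rewrite /xentry.
case: ltnP => h1.
  rewrite boolR_eq0 negbK; move: k2 l2; rewrite /pivn /pivot_rank /col2n.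
  by repeat (case: ifP; cbv iota); lia.
case: ltnP => h2.
  rewrite boolR_eq0 negbK; move: k2 l2; rewrite /pivn /pivot_rank /col2n.
  by repeat (case: ifP; cbv iota); lia.
case: ltnP => h3.
  move=> h; have {h} : (pivn k == l.+1) || (l.+2 == p + n + p)%N && ((pivn k).+1 == p).
    by apply: contraNT h; rewrite negb_or => /andP[/negPf-> /negPf->]; rewrite subr0 oppr0.
  move: k2 l2; rewrite /pivn /pivot_rank /col2n.
  by repeat (case: ifP; cbv iota); lia.
case: ltnP => h4.
  move=> h; have {h} : ((pivn k).+2 == p) || (0 < n)%N && ((pivn k).+1 == p + n)%N.
    by apply: contraNT h; rewrite negb_or => /andP[/negPf-> /negPf->]; rewrite subr0.
  move: k2 l2; rewrite /pivn /pivot_rank /col2n.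
  by repeat (case: ifP; cbv iota); lia.
case: ltnP => h5.
  rewrite oppr_eq0 boolR_eq0 negbK; move: k2 l2; rewrite /pivn /pivot_rank /col2n.
  by repeat (case: ifP; cbv iota); lia.
rewrite boolR_eq0 negbK; move: k2 l2; rewrite /pivn /pivot_rank /col2n.
by repeat (case: ifP; cbv iota); lia.
Qed.

(** The slice parameters only occur in rows whose pivot comes after all the
    columns in which they occur, so they do not disturb the elimination order
    of [X]. *)
Lemma pencil_rank (i j : 'I_N) : i \notin pred2 col1 col2 -> j \notin pred2 col1 col2 ->
  T (piv i) j != 0 -> (i == j) || (pivot_rank j < pivot_rank i)%N.
Proof.
rewrite !notin_cols => /andP[i0 i2] /andP[j0 j2].
have hi := ltn_ord i; have hj := ltn_ord j.
rewrite pencil_entry => h.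
have [e|[e|e]] : piv i = j \/ xentry {poly K} p n (piv i) j != 0 \/ (M *m bv j) (piv i) 0 != 0.
  case: (eqVneq (piv i) j) h => [->|_]; first by left.
  rewrite mulr0n sub0r; case: (eqVneq (xentry _ _ _ _ _) 0) => [->|]; last by right; left.
  by rewrite oppr0 sub0r oppr_eq0; right; right.
- have := congr1 (@nat_of_ord _) e; rewrite pivE; move: i2 j2.
  by rewrite /pivn /pivot_rank /col2n; repeat (case: ifP; cbv iota); lia.
- by rewrite pivE in e; exact: xentry_rank e.
- case: (boolP (lower_col p n j)) => hjn; first by rewrite slice_dir_lower // mxE eqxx in e.
  case: (boolP (lower_col p n i)) => hin; last first.
    rewrite slice_dir_upper ?eqxx // in e; by rewrite pivE; exact: pivn_upper.
  by have := pivot_rank_lower hi hin; have := pivot_rank_nlower hj j0 j2 hjn; lia.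
Qed.

End Pencil.

End Pivots.

Lemma zero_pencil (A : comNzRingType) (s xn xp ep en xs : A) :
  s * (- 0 * (- (xs * (en * xn) *+ 2) - 0)
       - (xn * (ep * xp) - (0 - xn * 0)) * (- (xp * (en * xn)) - (en * xn * 0 - 0)))
  = s * (ep * en) * (xp * xn * (xp * xn)).
Proof. ring. Qed.

Section PencilDeterminant.
Variables (K : comNzRingType) (p n : nat).
Hypotheses (p_gt1 : (1 < p)%N) (pn : (n < p)%N).
Local Notation N := ((p + n) + (p + n))%N.
Local Notation piv := (piv p_gt1 pn).
Local Notation c1 := (col1 p_gt1 pn).
Local Notation c2 := (col2 p_gt1 pn).
Variable X : 'M[K]_N.
Hypothesis hX : chains X.
Local Notation "v ^P" := (map_mx (@polyC K) v) (at level 2).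
Let hXP := map_chains hX.
Local Notation kerv1 := (@kerv1 {poly K} p n).
Local Notation kerv2 := (@kerv2 {poly K} p n).

Let eps : {poly K} := (-1) ^+ (n == 0%N).

Lemma bv_piv1 : bv (piv c1) = hv {poly K} p n 0.
Proof. by rewrite pivE /pivn /= -bv_h ?addn0. Qed.

Lemma bv_piv2 : bv (piv c2) = eps *: gv {poly K} p n 0.
Proof.
rewrite pivE /eps /= /col2n; case: eqP => n0.
  have -> : gv {poly K} p n 0 = - bv p.-1.
    rewrite /gv (_ : (0 < n)%N = false); last lia.
    by rewrite /Ev; case: p p_gt1.
  rewrite scalerN expr1 scaleN1r opprK; congr bv.
  by rewrite /pivn; repeat (case: ifP; cbv iota); lia.
rewrite expr0 scale1r -bv_g; last lia.
by congr bv; rewrite /pivn; repeat (case: ifP; cbv iota); lia.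
Qed.

Lemma entry_c1 (v : 'cV[{poly K}]_N) : v c1 0 = dot v (hv _ p n 0).
Proof.
rewrite dot_entry -bv_piv1; congr (dot v (bv _)); rewrite pivE /pivn /=.
by case: ifP; lia.
Qed.
Lemma entry_c2 (v : 'cV[{poly K}]_N) : v c2 0 = eps * dot v (gv _ p n 0).
Proof.
rewrite dot_entry -dotZr -bv_piv2; congr (dot v (bv _)); rewrite pivE /pivn /= /col2n.
by repeat (case: ifP; cbv iota); lia.
Qed.

Lemma dot_hv0_lower : forall i : 'I_N, lower_col p n i -> dot (hv {poly K} p n 0) (bv i) = 0.
Proof. by move=> i hi; apply: dot_hv_lower => //; lia. Qed.

(** The product of the pivots and of the sign of their permutation. *)
Definition pencil_sign : K :=
  (-1) ^+ piv * \prod_(i | i \notin pred2 c1 c2) (-1) ^+ pivsign p n i.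

Section Params.
Variables a y z d : nat -> K.
Local Notation aP := (polyC \o a). Local Notation yP := (polyC \o y).
Local Notation zP := (polyC \o z). Local Notation dP := (polyC \o d).
Local Notation M := (slice_dir p n aP yP zP dP).

(** The entries of the two by two matrix left by the elimination: the numbers
    [dot (kerv_a (-t)) ((t - S) kerv_b t)] at [t = 'X]. *)
Definition pencil11 : {poly K} :=
  - \sum_(i < p.-1) dP (p.-1 - i)%N * ('X ^+ i.+1 * (- 'X) ^+ i - 'X ^+ i * (- 'X) ^+ i.+1).
Definition pencil12 : {poly K} :=
  'X ^+ n * (- 'X) ^+ p
  - (\sum_(j < n) yP j.+1 * 'X ^+ j - 'X ^+ n * \sum_(j < n.+1) zP j.+1 * (- 'X) ^+ j).
Definition pencil21 : {poly K} :=
  - ('X ^+ p * (- 'X) ^+ n)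
  - ((- 'X) ^+ n * (\sum_(j < n.+1) zP j.+1 * 'X ^+ j) - \sum_(j < n) yP j.+1 * (- 'X) ^+ j).
Definition pencil22 : {poly K} :=
  - ('X ^+ n.+1 * (- 'X) ^+ n *+ 2)
  - \sum_(i < n) aP (n - i)%N * ('X ^+ i.+1 * (- 'X) ^+ i - 'X ^+ i * (- 'X) ^+ i.+1).

(** The columns used in [det_reduce] are the polynomial vectors and the rows
    are their transposes at [-t].  Since the slice direction vanishes on upper
    rows and lower columns, and [t - X] sends the polynomial vectors to
    combinations of [hv 0] and [gv 0], the new columns vanish on the rows of
    the early pivots and the new rows on the columns of the late ones. *)
Lemma char_poly_pencil : char_poly (X + slice_dir p n a y z d) =
  pencil_sign%:P * (pencil11 * pencil22 - pencil12 * pencil21).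
Proof.
pose T := char_poly_mx (X + slice_dir p n a y z d).
have redl u v : (u^T *m Jmx *m T *m v) 0 0 = dot u (T *m v) by rewrite /dot !mulmxA.
have T_kerv1 : T *m kerv1 'X = (- ('X ^+ p * (- 'X) ^+ n)) *: gv _ p n 0 - M *m kerv1 'X.
  by rewrite pencil_mul (resid_kerv1 hXP).
have T_kerv2 : T *m kerv2 'X = ('X ^+ n * (- 'X) ^+ p) *: hv _ p n 0
    - ('X ^+ n.+1 * (- 'X) ^+ n *+ 2) *: gv _ p n 0 - M *m kerv2 'X.
  by rewrite pencil_mul (resid_kerv2 hXP).
have lT u (j : 'I_N) : lower_col p n j -> (exists c e, resid X^P (- 'X) u = c *: hv _ p n 0 + e *: gv _ p n 0) ->
    (u^T *m Jmx *m T) 0 j = 0.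
  move=> hj [c [e hu]]; rewrite mul_pencil // hu mxE trJ_entry dotDl dotNl dotDl !dotZl.
  rewrite dot_hv0_lower // dot_gv_lower // !mulr0 addr0 add0r opprK.
  by rewrite skew_dot ?slice_dir_lower ?dot0r ?oppr0 //; exact: skewM.
have := @det_reduce {poly K} N T piv c1 c2 (fun i => pivot_rank p n i)
  ((kerv1 (- 'X))^T *m Jmx) ((kerv2 (- 'X))^T *m Jmx) (kerv1 'X) (kerv2 'X)
  (fun i => (-1) ^+ pivsign p n i).
rewrite !trJ_entry !bv_piv1 !bv_piv2 !dotZr !entry_c1 !entry_c2.
rewrite !dot_kerv1h ?dot_kerv2h ?dot_kerv1g ?dot_kerv2g //; try lia.
rewrite !(expr0, mulr0, mul0r, subr0, mulr1, mul1r) mulrAC.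
have -> : eps * eps = 1 by rewrite /eps -expr2 sqrr_sign.
rewrite mul1r => H; rewrite /char_poly -/T H //; clear H.
- have -> : (-1) ^+ piv * \prod_(i | i \notin pred2 c1 c2) (-1) ^+ pivsign p n i = pencil_sign%:P.
    rewrite /pencil_sign rmorphM rmorph_sign rmorph_prod; congr (_ * _).
    by apply: eq_bigr => i _; rewrite rmorph_sign.
  refine (f_equal2 *%R (erefl _) _).
  have D11 : dot (kerv1 (- 'X)) (T *m kerv1 'X) = pencil11.
    by rewrite T_kerv1 dotDr dotNr dotZr dot_kerv1g // mulr0 add0r dotM11.
  have D12 : dot (kerv1 (- 'X)) (T *m kerv2 'X) = pencil12.
    rewrite T_kerv2 dotDr dotDr !dotNr !dotZr dot_kerv1g // dot_kerv1h ?dotM12 //; last lia.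
    by rewrite expr0 mulr1 mulr0 subr0.
  have D21 : dot (kerv2 (- 'X)) (T *m kerv1 'X) = pencil21.
    by rewrite T_kerv1 dotDr dotNr dotZr dot_kerv2g // expr0 mulr1 dotM21.
  have D22 : dot (kerv2 (- 'X)) (T *m kerv2 'X) = pencil22.
    rewrite T_kerv2 dotDr dotDr !dotNr !dotZr dot_kerv2g // dot_kerv2h ?dotM22 //; last lia.
    by rewrite expr0 mulr1 mulr0 sub0r.
  by rewrite !redl D11 D12 D21 D22.
- by apply/eqP => /(congr1 (@nat_of_ord _)) /=; rewrite /col2n; case: ifP; lia.
- by rewrite /pivot_rank /= eqxx; case: ifP.
- by move=> i hi; apply: pencil_piv.
- by move=> i j hi hj; apply: pencil_rank.
- move=> i hi; have hN := ltn_ord i.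
  have rk1 : pivot_rank p n c1 = (n + p)%N by [].
  case: (boolP (lower_col p n i)) => hin; first by rewrite rk1 pivot_rank_lower.
  have ht : upper_row p n (piv i).
    by move: hi; rewrite pivE (notin_cols p_gt1 pn) => /andP[h0 h2]; exact: pivn_upper.
  have EB (u v : 'cV[{poly K}]_N) k : (u - v) k 0 = u k 0 - v k 0 by rewrite !mxE.
  have EZ c (u : 'cV[{poly K}]_N) k : (c *: u) k 0 = c * u k 0 by rewrite !mxE.
  have E1 : (T *m kerv1 'X) (piv i) 0 = 0.
    rewrite T_kerv1; move: (slice_dir_upper p_gt1 pn aP yP zP dP (kerv1 'X) ht) => h.
    by rewrite EB h EZ gv_upper // mulr0 subr0.
  have E2 : (T *m kerv2 'X) (piv i) 0 = 0.
    rewrite T_kerv2; move: (slice_dir_upper p_gt1 pn aP yP zP dP (kerv2 'X) ht) => h.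
    by rewrite EB h EB !EZ gv_upper // hv_upper ?mulr0 ?subr0 //; lia.
  by rewrite E1 E2 eqxx.
- move=> j hj; have hN := ltn_ord j.
  have rk1 : pivot_rank p n c1 = (n + p)%N by [].
  case: (boolP (lower_col p n j)) => hin; last first.
    by move: hj; rewrite (notin_cols p_gt1 pn) => /andP[h0 h2] _; rewrite rk1 pivot_rank_nlower.
  rewrite !lT ?eqxx //.
    rewrite (resid_kerv2 hXP) //.
    by exists ((- 'X) ^+ n * (- - 'X) ^+ p), (- ((- 'X) ^+ n.+1 * (- - 'X) ^+ n *+ 2)); rewrite scaleNr.
  rewrite (resid_kerv1 hXP) //.
  by exists 0, (- ((- 'X) ^+ p * (- - 'X) ^+ n)); rewrite scale0r add0r.
Qed.

End Params.

(** The sign does not involve the parameters, and when they all vanish the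
    determinant is a monomial; it has to be monic. *)
Lemma pencil_signE : pencil_sign = (-1) ^+ (p + n).
Proof.
pose o := fun _ : nat => 0 : K.
have /monicP := char_poly_monic (X + slice_dir p n o o o o).
rewrite lead_coefE size_char_poly char_poly_pencil /pencil11 /pencil12 /pencil21 /pencil22 /=.
have H k (F : 'I_k -> {poly K}) (G : 'I_k -> nat) :
  \sum_(i < k) (o (G i))%:P * F i = 0 by apply: big1 => j _; rewrite mul0r.
rewrite !H.
move: (pencil_sign) => s.
have -> : s%:P * (- 0 * (- ('X^(n.+1) * (- 'X) ^+ n *+ 2) - 0) -
     ('X^n * (- 'X) ^+ p - (0 - 'X^n * 0)) *
     (- ('X^p * (- 'X) ^+ n) - ((- 'X) ^+ n * 0 - 0)))
   = (s * (-1) ^+ (p + n)) *: 'X^N.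
  rewrite -mul_polyC polyCM rmorph_sign (exprNn 'X p) (exprNn 'X n) !exprD.
  exact: zero_pencil.
rewrite coefZ coefXn eqxx mulr1 => h.
by rewrite -[LHS](signrMK (p + n)) [_ * s]mulrC h mulr1.
Qed.

End PencilDeterminant.

(** * Every skew matrix is a slice direction plus a commutator *)

Section Generic.
Variables (K : fieldType) (p n : nat).
Hypotheses (p_gt1 : (1 < p)%N) (pn : (n < p)%N) (two_neq0 : (2%:R : K) != 0).
Local Notation N := ((p + n) + (p + n))%N.
Local Notation Ev := (Ev K p n). Local Notation Fv := (Fv K p n).
Local Notation hv := (hv K p n). Local Notation gv := (gv K p n).
Local Notation bv := (@bv K (p + n)).
Variable X : 'M[K]_N.
Hypothesis hX : chains X.

Section Span.

Definition negmul (v : 'cV[K]_N) := - (X *m v).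
Lemma negmulD u v : negmul (u + v) = negmul u + negmul v.
Proof. by rewrite /negmul mulmxDr opprD. Qed.
Lemma negmulZ c v : negmul (c *: v) = c *: negmul v.
Proof. by rewrite /negmul -scalemxAr scalerN. Qed.
Lemma iter_negmulD k u v : iter k negmul (u + v) = iter k negmul u + iter k negmul v.
Proof. by elim: k => //= k ->; rewrite negmulD. Qed.
Lemma iter_negmulZ k c v : iter k negmul (c *: v) = c *: iter k negmul v.
Proof. by elim: k => //= k ->; rewrite negmulZ. Qed.

(** The chains continued beyond the range in which [hv] and [gv] are explicit. *)
Definition Nh k := iter k negmul (hv 0).
Definition Ng k := iter k negmul (gv 0).

Lemma NhE k : (k < p)%N -> Nh k = hv k.
Proof.
elim: k => // k IH hk; rewrite /Nh iterS -/(Nh k) IH ?(ltnW hk) //.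
by rewrite /negmul (chh hX) // opprK.
Qed.
Lemma NgE k : (k <= n)%N -> Ng k = gv k.
Proof.
elim: k => // k IH hk; rewrite /Ng iterS -/(Ng k) IH ?(ltnW hk) //.
by rewrite /negmul (chg hX) // opprK.
Qed.
Lemma iter_Nh i j : iter i negmul (Nh j) = Nh (i + j).
Proof. by rewrite /Nh -iterD. Qed.
Lemma iter_Ng i j : iter i negmul (Ng j) = Ng (i + j).
Proof. by rewrite /Ng -iterD. Qed.

Lemma iter_E j k : (k <= p)%N -> iter j negmul (Ev k) = (-1) ^+ j *: Ev (k - j).
Proof.
move=> hk; elim: j => [|j IH]; first by rewrite expr0 scale1r subn0.
rewrite iterS IH negmulZ exprSr -scalerA scaleN1r; congr (_ *: _); rewrite /negmul.
case E: (k - j)%N => [|l].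
  by rewrite (_ : (k - j.+1 = 0)%N) ?[Ev 0]/(0) ?mulmx0 //; lia.
rewrite (chE hX); last lia.
by congr (- Ev _); lia.
Qed.
Lemma iter_F j k : (k <= n)%N -> iter j negmul (Fv k) = (-1) ^+ j *: Fv (k - j).
Proof.
move=> hk; elim: j => [|j IH]; first by rewrite expr0 scale1r subn0.
rewrite iterS IH negmulZ exprSr -scalerA scaleN1r; congr (_ *: _); rewrite /negmul.
case E: (k - j)%N => [|l].
  by rewrite (_ : (k - j.+1 = 0)%N) ?[Fv 0]/(0) ?mulmx0 //; lia.
rewrite (chF hX); last lia.
by congr (- Fv _); lia.
Qed.

Lemma Ng_n : Ng n = - Ev p.
Proof. by rewrite NgE // gvn. Qed.

Lemma Ng_top j : Ng (n + j) = - ((-1) ^+ j *: Ev (p - j)).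
Proof. by rewrite (addnC n j) -iter_Ng Ng_n -scaleN1r iter_negmulZ iter_E // scaleN1r. Qed.

Lemma Nh_p : Nh p = Fv n - Ev p.-1 *+ 2.
Proof.
have : Nh p.-1.+1 = negmul (hv p.-1) by rewrite /Nh iterS -/(Nh p.-1) NhE //; lia.
by rewrite (ltn_predK p_gt1) => ->; rewrite /negmul (chhp hX) opprB.
Qed.

Lemma Nh_top j : Nh (p + j) = (-1) ^+ j *: (Fv (n - j) - Ev (p.-1 - j) *+ 2).
Proof.
rewrite (addnC p j) -iter_Nh Nh_p -scaler_nat -scaleNr iter_negmulD iter_negmulZ.
rewrite iter_E ?iter_F //; last lia.
by rewrite scalerBr -scaler_nat scaleNr !scalerA [2%:R * _]mulrC.
Qed.

Lemma Nh_vanish k : (p + p.-1 <= k)%N -> Nh k = 0.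
Proof.
move=> hk; have -> : k = (p + (k - p))%N by lia.
rewrite Nh_top (_ : (n - (k - p) = 0)%N); last lia.
by rewrite (_ : (p.-1 - (k - p) = 0)%N) ?mul0rn ?subr0 ?scaler0 //; lia.
Qed.

(** Beyond their explicit ranges both chains run down the chain [Ev];
    comparing them gives this relation. *)
Lemma Ng_Nh l : Ng (n + n.+1 + l) = - 2%:R^-1 *: Nh (p + (n + l)).
Proof.
rewrite -(addnA n n.+1 l) Ng_top Nh_top (_ : (n - (n + l) = 0)%N); last lia.
rewrite (_ : (p - (n.+1 + l) = p.-1 - (n + l))%N); last lia.
rewrite addSn exprS mulN1r scaleNr opprK [Fv 0]/(0) sub0r -scaler_nat -scaleNr !scalerA.
by congr (_ *: _); rewrite mulrN mulrAC mulNr mulVf // mulN1r opprK.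
Qed.

(** The two chains generate the space: the iterates of [gv 0] eventually run
    through all of [Ev], and [Nh_p] then gives access to [Fv]. *)
Lemma span_ind (Q : 'cV[K]_N -> Prop) :
  Q 0 -> (forall u v, Q u -> Q v -> Q (u + v)) -> (forall c v, Q v -> Q (c *: v)) ->
  (forall k, Q (Nh k)) -> (forall k, Q (Ng k)) -> forall v, Q v.
Proof.
move=> Q0 QD QZ Qh Qg v.
have QN u : Q u -> Q (- u) by move=> h; rewrite -scaleN1r; exact: QZ.
have sK j (u : 'cV[K]_N) : (-1) ^+ j *: ((-1) ^+ j *: u) = u.
  by rewrite scalerA -expr2 sqrr_sign scale1r.
have QE j : (j <= p)%N -> Q (Ev j).
  move=> hj; have := Ng_top (p - j); rewrite (_ : (p - (p - j) = j)%N); last lia.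
  move=> /(congr1 -%R); rewrite opprK => /(congr1 (fun u => (-1) ^+ (p - j) *: u)).
  by rewrite sK => <-; apply/QZ/QN.
have QF j : (j <= n)%N -> Q (Fv j).
  move=> hj; have /(congr1 (fun u => (-1) ^+ (n - j) *: u)) := Nh_top (n - j).
  rewrite sK (_ : (n - (n - j) = j)%N); last lia.
  move=> /(congr1 (fun u => u + Ev (p.-1 - (n - j)) *+ 2)); rewrite subrK => <-.
  apply: QD; first exact: QZ.
  by rewrite -scaler_nat; apply: QZ; apply: QE; lia.
rewrite [v]bv_sum; elim/big_ind: _ => // k _; apply: QZ.
have hk := ltn_ord k.
case: (ltnP k p) => h1; first by apply: (QE k.+1).
case: (ltnP k (p + n)) => h2.
  have -> : nat_of_ord k = (p + (k - p))%N by lia.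
  by apply: (QF (k - p).+1); lia.
case: (ltnP k (p + n + p)) => h3.
  have -> : nat_of_ord k = (p + n + (k - (p + n)))%N by lia.
  case: (ltnP (k - (p + n)).+1 p) => h4.
    by rewrite bv_h // -NhE //; lia.
  have -> : (k - (p + n) = p.-1)%N by lia.
  rewrite bv_hp // -NhE; last lia.
  by apply: QD => //; apply/QN/QE.
have -> : nat_of_ord k = (p + n + p + (k - (p + n + p)))%N by lia.
by rewrite bv_g -?NgE //; lia.
Qed.

End Span.

Section Surjective.

Definition covered (Z : 'M[K]_N) : Prop :=
  exists Y a y z d, skew Y /\ Z = slice_dir p n a y z d + (Y *m X - X *m Y).

Lemma slice_dirD a y z d a' y' z' d' :
  slice_dir p n a y z d + slice_dir p n a' y' z' d' = slice_dir p n (fun k => a k + a' k) (fun k => y k + y' k)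
     (fun k => z k + z' k) (fun k => d k + d' k) :> 'M[K]_N.
Proof.
have H k (c e : 'I_k -> K) (B : 'I_k -> 'M[K]_N) :
   \sum_i (c i + e i) *: B i = \sum_i c i *: B i + \sum_i e i *: B i.
  by rewrite -big_split; apply: eq_bigr => i _; rewrite scalerDl.
rewrite /slice_dir !H.
by rewrite addrACA; congr (_ + _); rewrite addrACA; congr (_ + _); rewrite addrACA.
Qed.

Lemma slice_dirZ c a y z d : c *: (slice_dir p n a y z d : 'M[K]_N) =
  slice_dir p n (fun k => c * a k) (fun k => c * y k) (fun k => c * z k) (fun k => c * d k).
Proof.
have H k (e : 'I_k -> K) (B : 'I_k -> 'M[K]_N) :
   \sum_i (c * e i) *: B i = c *: \sum_i e i *: B i.
  by rewrite scaler_sumr; apply: eq_bigr => i _; rewrite scalerA.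
by rewrite /slice_dir !H !scalerDr.
Qed.

Lemma covered_add Y Z : covered Y -> covered Z -> covered (Y + Z).
Proof.
move=> [Y1 [a [y [z [d [h1 ->]]]]]] [Y2 [a' [y' [z' [d' [h2 ->]]]]]].
exists (Y1 + Y2); do 4 eexists; split; first exact: skewD.
rewrite addrACA slice_dirD; congr (_ + _).
by rewrite mulmxDl mulmxDr opprD addrACA.
Qed.

Lemma covered_scale c Z : covered Z -> covered (c *: Z).
Proof.
move=> [Y1 [a [y [z [d [h1 ->]]]]]].
exists (c *: Y1); do 4 eexists; split; first exact: skewZ.
by rewrite scalerDr slice_dirZ scalerBr -scalemxAl -scalemxAr.
Qed.

Lemma covered_opp Z : covered Z -> covered (- Z).
Proof. by move=> h; rewrite -scaleN1r; exact: covered_scale. Qed.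

Lemma slice_dir0 : slice_dir p n (fun=> 0) (fun=> 0) (fun=> 0) (fun=> 0) = 0 :> 'M[K]_N.
Proof. by rewrite /slice_dir !big1 ?addr0 // => i _; rewrite scale0r. Qed.

Lemma covered0 : covered 0.
Proof.
exists 0, (fun=> 0), (fun=> 0), (fun=> 0), (fun=> 0); split; first exact: skew0.
by rewrite mul0mx mulmx0 subr0 addr0 slice_dir0.
Qed.

Lemma covered_sum I (r : seq I) (P : pred I) (F : I -> 'M[K]_N) :
  (forall i, P i -> covered (F i)) -> covered (\sum_(i <- r | P i) F i).
Proof.
move=> h; elim/big_ind: _ => //; [exact: covered0 | exact: covered_add].
Qed.

Lemma covered_slice_dir a y z d : covered (slice_dir p n a y z d).
Proof.
by exists 0, a, y, z, d; split; [exact: skew0 | rewrite mul0mx mulmx0 subr0 addr0].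
Qed.

Lemma pick_term k (B : nat -> 'M[K]_N) (c : nat -> nat) i : (i < k)%N ->
  (forall j, (j < k)%N -> (c j == c i) = (j == i)) ->
  \sum_(j < k) (c j == c i)%:R *: B j = B i.
Proof.
move=> hi hc; rewrite (bigD1 (Ordinal hi)) //= eqxx scale1r big1 ?addr0 // => j ij.
by rewrite hc // (negPf (ij : j != i :> nat)) scale0r.
Qed.

Lemma zero_term k (B : nat -> 'M[K]_N) : \sum_(j < k) 0 *: B j = 0.
Proof. by rewrite big1 // => j _; rewrite scale0r. Qed.

Lemma covered_hh i : (i < p.-1)%N -> covered (wedge (hv i) (hv i.+1)).
Proof.
move=> hi.
have := covered_slice_dir (fun=> 0) (fun=> 0) (fun=> 0) (fun k => (k == p.-1 - i)%N%:R).
rewrite /slice_dir (pick_term (fun j => wedge (hv j) (hv j.+1)) (c := fun j => p.-1 - j)%N) //.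
  rewrite (zero_term _ (fun j => wedge (gv j) (gv j.+1))) (zero_term _ (fun j => wedge (hv 0) (gv j))).
  by rewrite (zero_term _ (fun j => wedge (gv n) (hv j))) !addr0.
by move=> j hj; lia.
Qed.
Lemma covered_gg i : (i < n)%N -> covered (wedge (gv i) (gv i.+1)).
Proof.
move=> hi.
have := covered_slice_dir (fun k => (k == n - i)%N%:R) (fun=> 0) (fun=> 0) (fun=> 0).
rewrite /slice_dir (pick_term (fun j => wedge (gv j) (gv j.+1)) (c := fun j => n - j)%N) //.
  rewrite (zero_term _ (fun j => wedge (hv j) (hv j.+1))) (zero_term _ (fun j => wedge (hv 0) (gv j))).
  by rewrite (zero_term _ (fun j => wedge (gv n) (hv j))) !addr0 add0r.
by move=> j hj; lia.
Qed.
Lemma covered_hg i : (i < n)%N -> covered (wedge (hv 0) (gv i)).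
Proof.
move=> hi.
have := covered_slice_dir (fun=> 0) (fun k => (k == i.+1)%N%:R) (fun=> 0) (fun=> 0).
rewrite /slice_dir (pick_term (fun j => wedge (hv 0) (gv j)) (c := fun j => j.+1)) //.
rewrite (zero_term _ (fun j => wedge (hv j) (hv j.+1))) (zero_term _ (fun j => wedge (gv j) (gv j.+1))).
by rewrite (zero_term _ (fun j => wedge (gv n) (hv j))) !addr0 !add0r.
Qed.
Lemma covered_gh i : (i <= n)%N -> covered (wedge (gv n) (hv i)).
Proof.
move=> hi.
have := covered_slice_dir (fun=> 0) (fun=> 0) (fun k => (k == i.+1)%N%:R) (fun=> 0).
rewrite /slice_dir (pick_term (fun j => wedge (gv n) (hv j)) (c := fun j => j.+1)) //.
rewrite (zero_term _ (fun j => wedge (hv j) (hv j.+1))) (zero_term _ (fun j => wedge (gv j) (gv j.+1))).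
by rewrite (zero_term _ (fun j => wedge (hv 0) (gv j))) !addr0 !add0r.
Qed.

(** By [comm_wedge] the left hand side is a commutator with [X]. *)
Lemma covered_negmul v w : covered (wedge (negmul v) w + wedge v (negmul w)).
Proof.
rewrite /negmul wedgeNl wedgeNr -opprD -comm_wedge; last exact: ch_skew hX.
exists (wedge v w), (fun=> 0), (fun=> 0), (fun=> 0), (fun=> 0); split; first exact: skew_wedge.
by rewrite opprB slice_dir0 add0r.
Qed.

(** A power of [- X] can be moved across a wedge, at the cost of a sign that
    is irrelevant for being covered. *)
Lemma covered_move i v w :
  covered (wedge (iter i negmul v) w) <-> covered (wedge v (iter i negmul w)).
Proof.
elim: i v w => [|i IH] v w //; rewrite iterSr iterS IH.
have e1 := covered_negmul v (iter i negmul w).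
split=> h.
  by rewrite -[X in covered X](addKr (wedge (negmul v) (iter i negmul w))); apply: covered_add e1; apply: covered_opp.
by rewrite -[X in covered X](addrK (wedge v (negmul (iter i negmul w)))); apply: covered_add e1 _; apply: covered_opp.
Qed.

Lemma covered_swap v w : covered (wedge v w) -> covered (wedge w v).
Proof. by move=> h; rewrite wedgeC; exact: covered_opp. Qed.

Lemma move_hh k l : covered (wedge (Nh k) (Nh l)) <-> covered (wedge (Nh 0) (Nh (k + l))).
Proof. by rewrite -{1}[k]addn0 -(iter_Nh k 0) covered_move (iter_Nh k l). Qed.
Lemma move_hg k l : covered (wedge (Nh k) (Ng l)) <-> covered (wedge (Nh 0) (Ng (k + l))).
Proof. by rewrite -{1}[k]addn0 -(iter_Nh k 0) covered_move (iter_Ng k l). Qed.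
Lemma move_gg k l : covered (wedge (Ng k) (Ng l)) <-> covered (wedge (Ng 0) (Ng (k + l))).
Proof. by rewrite -{1}[k]addn0 -(iter_Ng k 0) covered_move (iter_Ng k l). Qed.

(** An even power is split evenly and gives [v ^ v = 0]; an odd one is split
    into consecutive vectors, whose wedge is a slice direction as long as both
    are explicit, and beyond that [Nh] is zero. *)
Lemma covered_Nhh k : covered (wedge (Nh 0) (Nh k)).
Proof.
have [kE|kO] : (k = k./2 + k./2 \/ k = k./2 + k./2.+1)%N by lia.
  by rewrite kE; apply: (iffLR (move_hh _ _)); rewrite wedge_self; exact: covered0.
case: (ltnP k./2 p.-1) => hk.
  by rewrite kO; apply: (iffLR (move_hh _ _)); rewrite !NhE; try lia; exact: covered_hh.
rewrite (@Nh_vanish k); last lia.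
by rewrite wedge0r; exact: covered0.
Qed.

(** For [k < n] this is a coordinate [y], for [n <= k <= 2 n] a coordinate [z]
    after moving the excess power to the other side, and for larger [k] the
    relation between the chains leads to [covered_Nhh]. *)
Lemma covered_Nhg k : covered (wedge (Nh 0) (Ng k)).
Proof.
case: (ltnP k n) => h1.
  rewrite NgE ?(ltnW h1) // NhE; last lia.
  exact: covered_hg.
case: (leqP k (n + n)) => h2.
  have -> : k = (k - n + n)%N by lia.
  apply: (iffLR (move_hg _ _)); rewrite (@NgE n) // NhE; last lia.
  by apply/covered_swap/covered_gh; lia.
have -> : k = (n + n.+1 + (k - (n + n.+1)))%N by lia.
rewrite Ng_Nh wedgeZr; apply: covered_scale; exact: covered_Nhh.
Qed.

Lemma covered_Ngg k : covered (wedge (Ng 0) (Ng k)).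
Proof.
have [kE|kO] : (k = k./2 + k./2 \/ k = k./2 + k./2.+1)%N by lia.
  by rewrite kE; apply: (iffLR (move_gg _ _)); rewrite wedge_self; exact: covered0.
case: (ltnP k./2 n) => hk.
  by rewrite kO; apply: (iffLR (move_gg _ _)); rewrite !NgE; try lia; exact: covered_gg.
have -> : k = (n + n.+1 + (k - (n + n.+1)))%N by lia.
rewrite Ng_Nh wedgeZr; apply/covered_scale/covered_swap/(iffRL (move_hg _ _)); exact: covered_Nhg.
Qed.

Lemma covered_wedge v w : covered (wedge v w).
Proof.
have comb u (Q : 'cV[K]_N -> Prop := fun x => covered (wedge u x)) :
   (forall k, Q (Nh k)) -> (forall k, Q (Ng k)) -> forall x, Q x.
  move=> hh hg; apply: span_ind => // [|x x' h h'|c x h]; rewrite /Q.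
  - by rewrite wedge0r; exact: covered0.
  - by rewrite wedgeDr; exact: covered_add.
  - by rewrite wedgeZr; exact: covered_scale.
apply: (comb _) => k; apply: covered_swap; apply: (comb _) => l.
- by apply: (iffRL (move_hh _ _)); exact: covered_Nhh.
- by apply: (iffRL (move_hg _ _)); exact: covered_Nhg.
- by apply/covered_swap/(iffRL (move_hg _ _)); exact: covered_Nhg.
- by apply: (iffRL (move_gg _ _)); exact: covered_Ngg.
Qed.

Lemma skew_covered Z : skew Z -> covered Z.
Proof.
move=> /skew_sum_wedge hZ.
have -> : Z = 2%:R^-1 *: (Z *+ 2) by rewrite -scaler_nat scalerA mulVf ?scale1r.
by rewrite hZ; apply/covered_scale/covered_sum => k _; exact: covered_wedge.
Qed.

End Surjective.
End Generic.

(** * No nonzero slice direction is a commutator *)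

Section CoefSum.
Variable K : comNzRingType.

Lemma coef_sumX (c : nat -> K) k j :
  (\sum_(i < k) (c i)%:P * 'X ^+ i)`_j = if (j < k)%N then c j else 0.
Proof.
rewrite coef_sum -sum_pick; apply: eq_bigr => i _.
by rewrite coefCM coefXn eq_sym.
Qed.

Lemma coef_sumXodd (c : nat -> K) k j :
  (\sum_(i < k) (c i)%:P * 'X ^+ (i + i).+1)`_(j + j).+1 = if (j < k)%N then c j else 0.
Proof.
rewrite coef_sum -sum_pick; apply: eq_bigr => i _.
by rewrite coefCM coefXn; congr (_ * _%:R); lia.
Qed.

Lemma alt_term (c : K) i : c%:P * ('X ^+ i.+1 * (- 'X) ^+ i - 'X ^+ i * (- 'X) ^+ i.+1)
  = (2%:R * (-1) ^+ i * c)%:P * 'X ^+ (i + i).+1.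
Proof.
rewrite !polyCM rmorph_sign rmorph_nat !(exprNn 'X) !exprS exprD.
move: ('X ^+ i) ((-1) ^+ i) (c%:P) => x e C; ring.
Qed.

End CoefSum.

Section Commutator.
Variables (A : comNzRingType) (q : nat) (X Y : 'M[A]_(q + q)).
Hypothesis hX : skew X.

(** Substitute [X = t - (t - X)] on the right and, by skewness, on the left:
    the terms in [t] cancel.  A commutator thus only sees the values of [t -
    X] on its arguments. *)
Lemma dot_comm t u v : dot u ((Y *m X - X *m Y) *m v) =
  - (dot u (Y *m resid X t v) + dot (resid X (- t) u) (Y *m v)).
Proof.
rewrite /resid mulmxBl dotDr dotNr -!mulmxA mulmxBr dotDr dotNr dotDl dotNl dotZl.
rewrite -scalemxAr dotZr (skew_dot _ _ hX).
by move: (dot u _) (dot u _) (dot u _) => x y z; ring.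
Qed.
Lemma dot_comb (B : 'M[A]_(q + q)) u1 u2 v1 v2 c e :
  dot (u1 *+ 2 - c *: u2) (B *m (v1 *+ 2 - e *: v2)) =
  dot u1 (B *m v1) *+ 4 - c * dot u2 (B *m v1) *+ 2
  - e * dot u1 (B *m v2) *+ 2 + c * e * dot u2 (B *m v2).
Proof.
rewrite mulmxBr -!scaler_nat -!scalemxAr.
rewrite dotDl dotNl !dotZl !dotDr !dotNr !dotZr; ring.
Qed.
End Commutator.

Section Injective.
Variables (K : fieldType) (p n : nat).
Hypotheses (p_gt1 : (1 < p)%N) (pn : (n < p)%N) (two_neq0 : (2%:R : K) != 0).
Local Notation N := ((p + n) + (p + n))%N.
Local Notation "v ^P" := (map_mx (@polyC K) v) (at level 2).
Local Notation kerv1 := (@kerv1 {poly K} p n).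
Local Notation kerv2 := (@kerv2 {poly K} p n).
Variables (X Y : 'M[K]_N) (a y z d : nat -> K).
Hypothesis hX : chains X.
Hypothesis hM : slice_dir p n a y z d = Y *m X - X *m Y.
Local Notation aP := (polyC \o a). Local Notation yP := (polyC \o y).
Local Notation zP := (polyC \o z). Local Notation dP := (polyC \o d).
Let hXP := map_chains hX.

Lemma dot_slice_dir u v : dot u (slice_dir p n aP yP zP dP *m v) =
  - (dot u (Y^P *m resid X^P 'X v) + dot (resid X^P (- 'X) u) (Y^P *m v)).
Proof.
rewrite -map_slice_dir hM map_mxB !map_mxM; apply: dot_comm; exact: ch_skew hXP.
Qed.

(** The inequality [n < p] makes the residuals of both polynomial vectors
    divisible by [t ^ (2 n + 1)]. *)
Lemma resid_kerv1_low t : exists r, resid X^P t (kerv1 t) = t ^+ (n + n).+1 *: r.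
Proof.
rewrite (resid_kerv1 hXP) //; exists (- (t ^+ (p - n.+1) * (-1) ^+ n) *: gv _ p n 0).
rewrite scalerA; congr (_ *: _); rewrite (exprNn t n).
have -> : t ^+ p = t ^+ n.+1 * t ^+ (p - n.+1) by rewrite -exprD subnKC.
by rewrite exprS exprS exprD; ring.
Qed.

Lemma resid_kerv2_low t : exists r, resid X^P t (kerv2 t) = t ^+ (n + n).+1 *: r.
Proof.
rewrite (resid_kerv2 hXP) //.
exists ((t ^+ (p - n.+1) * (-1) ^+ p) *: hv _ p n 0 - ((-1) ^+ n *+ 2) *: gv _ p n 0).
rewrite scalerBr !scalerA (exprNn t n) (exprNn t p).
have -> : t ^+ p = t ^+ n.+1 * t ^+ (p - n.+1) by rewrite -exprD subnKC.
rewrite [t ^+ (n + n).+1]exprS !exprS exprD; congr (_ *: _ - _ *: _); ring.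
Qed.

Lemma low_zero (f r1 r2 : {poly K}) k l :
  f = - ('X ^+ k * r1 + (- 'X) ^+ k * r2) -> (l < k)%N -> f`_l = 0.
Proof.
move=> -> lk; rewrite (exprNn 'X) -mulrA [(-1) ^+ k * _]mulrCA -mulrDr.
by rewrite coefN coefXnM lk oppr0.
Qed.

Lemma dot_slice_dir_low u v (r s : 'cV[{poly K}]_N) k l :
  resid X^P 'X v = 'X ^+ k *: r -> resid X^P (- 'X) u = (- 'X) ^+ k *: s -> (l < k)%N ->
  (dot u (slice_dir p n aP yP zP dP *m v))`_l = 0.
Proof.
move=> hr hs lk; rewrite dot_slice_dir hr hs -scalemxAr dotZr dotZl.
exact: low_zero (erefl _) lk.
Qed.

(** The value of [dotM12] has degree at most [2 n] and is divisible by [t ^ (2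
    n + 1)]; its coefficients are the coordinates [y] and, up to sign, [z]. *)
Lemma yz_zero : (forall j, (j < n)%N -> y j.+1 = 0) /\ (forall j, (j <= n)%N -> z j.+1 = 0).
Proof.
have [r hr] := resid_kerv2_low 'X; have [s hs] := resid_kerv1_low (- 'X).
have low l := @dot_slice_dir_low _ _ _ _ _ l hr hs.
have E l : (dot (kerv1 (- 'X)) (slice_dir p n aP yP zP dP *m kerv2 'X))`_l =
   (if (l < n)%N then y l.+1 else 0)
   - (if (n <= l <= n + n)%N then (-1) ^+ (l - n) * z (l - n).+1 else 0).
  rewrite dotM12 //= coefB (coef_sumX (fun j => y j.+1)); congr (_ - _).
  have -> : \sum_(j < n.+1) (z j.+1)%:P * (- 'X) ^+ j
          = \sum_(j < n.+1) ((-1) ^+ j * z j.+1)%:P * 'X ^+ j.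
    apply: eq_bigr => j _; rewrite polyCM rmorph_sign (exprNn 'X) /=.
    by rewrite mulrCA mulrA.
  rewrite coefXnM (coef_sumX (fun j => (-1) ^+ j * z j.+1)); case: (ltnP l n) => h1 //=.
  by rewrite ltnS leq_subLR.
split=> j hj.
  have := E j; rewrite low; last lia.
  rewrite hj (_ : (n <= j)%N = false) ?subr0 //; lia.
have := E (n + j)%N; rewrite low; last lia.
rewrite (_ : (n + j < n)%N = false); last lia.
rewrite (_ : (n <= n + j <= n + n)%N); last lia.
rewrite sub0r addKn => /esym/eqP; rewrite oppr_eq0 mulf_eq0 signr_eq0 /=.
by move/eqP.
Qed.

(** Same argument with [dotM22], which is odd of degree at most [2 n - 1]. *)
Lemma a_zero i : (i < n)%N -> a (n - i)%N = 0.
Proof.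
move=> hi.
have [r hr] := resid_kerv2_low 'X; have [s hs] := resid_kerv2_low (- 'X).
have low l := @dot_slice_dir_low _ _ _ _ _ l hr hs.
have := low (i + i).+1; rewrite dotM22 //.
have -> : \sum_(i < n) aP (n - i)%N * ('X ^+ i.+1 * (- 'X) ^+ i - 'X ^+ i * (- 'X) ^+ i.+1)
  = \sum_(i < n) ((2%:R * (-1) ^+ i * a (n - i)%N))%:P * 'X ^+ (i + i).+1.
  by apply: eq_bigr => j _; rewrite alt_term.
rewrite (coef_sumXodd (fun i => 2%:R * (-1) ^+ i * a (n - i)%N)) hi => h.
have /eqP := h ltac:(lia).
by rewrite !mulf_eq0 (negPf two_neq0) signr_eq0 /= => /eqP.
Qed.

Let kervl (t : {poly K}) := kerv1 t *+ 2 - t ^+ (p.-1 - n) *: kerv2 t.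

Lemma resid_kervl t : resid X^P t (kervl t) = t ^+ (p + p.-1) *: (- (-1) ^+ p *: hv _ p n 0).
Proof.
rewrite /kervl residB -scaler_nat !residZ (resid_kerv1 hXP) // (resid_kerv2 hXP) //.
have h : t ^+ p = t ^+ (p.-1 - n) * t ^+ n.+1 by rewrite -exprD; congr (_ ^+ _); lia.
have h' : t ^+ p.-1 = t ^+ (p.-1 - n) * t ^+ n by rewrite -exprD; congr (_ ^+ _); lia.
rewrite exprD (exprNn t p) h'; move: (t ^+ p) h => tp ->.
rewrite (exprNn t n) !scalerA.
move: (t ^+ (p.-1 - n)) (t ^+ n) (t ^+ n.+1) ((-1) ^+ n) ((-1) ^+ p) => x1 x2 x3 e1 e2.
apply/colP => i; rewrite !mxE; ring.
Qed.

(** Here [dotM11] has degree at most [2 p - 3], too large for the bound on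
    [kerv1]; the combination [kervl] has a residual divisible by [t ^ (2 p -
    1)], and replacing [kerv1] by it only multiplies the value by 4 once [y],
    [z] and [a] vanish. *)
Lemma d_zero i : (i < p.-1)%N -> d (p.-1 - i)%N = 0.
Proof.
move=> hi; have [hy hz] := yz_zero.
have low l := @dot_slice_dir_low _ _ _ _ _ l (resid_kervl 'X) (resid_kervl (- 'X)).
have D12 s t : dot (kerv1 s) (slice_dir p n aP yP zP dP *m kerv2 t) = 0.
  rewrite dotM12 // !big1 ?mulr0 ?subr0 // => j _.
    by rewrite /= hz ?mul0r //; have := ltn_ord j; lia.
  by rewrite /= hy ?mul0r.
have D21 s t : dot (kerv2 s) (slice_dir p n aP yP zP dP *m kerv1 t) = 0.
  rewrite dotM21 // !big1 ?mulr0 ?subr0 // => j _.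
    by rewrite /= hy ?mul0r.
  by rewrite /= hz ?mul0r //; have := ltn_ord j; lia.
have D22 s t : dot (kerv2 s) (slice_dir p n aP yP zP dP *m kerv2 t) = 0.
  rewrite dotM22 // big1 // => j _.
  by rewrite /= a_zero ?mul0r.
have := low (i + i).+1.
rewrite /kervl dot_comb D12 D21 D22 !mulr0 !mul0rn !subr0 addr0 dotM11 //.
have -> : \sum_(i < p.-1) dP (p.-1 - i)%N * ('X ^+ i.+1 * (- 'X) ^+ i - 'X ^+ i * (- 'X) ^+ i.+1)
  = \sum_(i < p.-1) ((2%:R * (-1) ^+ i * d (p.-1 - i)%N))%:P * 'X ^+ (i + i).+1.
  by apply: eq_bigr => j _; rewrite alt_term.
rewrite coefMn (coef_sumXodd (fun i => 2%:R * (-1) ^+ i * d (p.-1 - i)%N)) hi => h.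
have := h ltac:(lia).
have -> c : c *+ 4 = 2%:R * (2%:R * c) :> K by ring.
by move/eqP; rewrite !mulf_eq0 (negPf two_neq0) signr_eq0 /= => /eqP.
Qed.

Lemma slice_dir_comm0 : slice_dir p n a y z d = 0 :> 'M[K]_N.
Proof.
have [hy hz] := yz_zero.
rewrite /slice_dir !big1 ?addr0 // => i _; have hi := ltn_ord i.
- by rewrite hz ?scale0r.
- by rewrite hy ?scale0r.
- by rewrite a_zero ?scale0r.
- by rewrite d_zero ?scale0r.
Qed.

End Injective.

(** * The torus action on wedges *)

Section Weights.
Variables (K : fieldType) (p n : nat).
Local Notation N := (p + n + (p + n))%N.
Hypotheses (p_gt1 : (1 < p)%N) (pn : (n < p)%N).
Local Notation hv := (hv K p n). Local Notation gv := (gv K p n).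
Local Notation bvK := (@bv K (p + n)).
Variable X : 'M[K]_N.
Hypothesis hX : chains X.

(** Half the diagonal entries of [semisimpleH]. *)
Definition weight (k : nat) : int :=
  if (k < p)%N then (p - k.+1)%N%:Z
  else if (k < p + n)%N then (n - (k - p))%N%:Z
  else if (k < p + n + p)%N then - (p - (k - (p + n)).+1)%N%:Z
  else - (n - (k - (p + n + p)))%N%:Z.

Variables (expw : int -> K) (r : K).
Hypothesis expwD : forall a b, expw (a + b) = expw a * expw b.
Hypothesis expw_nat : forall k : nat, expw k%:Z = r ^+ k.

Lemma expw0 : expw 0 = 1.
Proof. exact: (expw_nat 0). Qed.

Lemma row_expwN : \row_i expw (-1 * weight i) = \row_i expw (- weight i) :> 'rV_N.
Proof. by apply/rowP => i; rewrite !mxE mulN1r. Qed.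
Lemma row_expw1 : \row_i expw (1 * weight i) = \row_i expw (weight i) :> 'rV_N.
Proof. by apply/rowP => i; rewrite !mxE mul1r. Qed.

(** The two exponential factors of the torus action, for an arbitrary
    exponential map [expw] on the weights. *)
Definition Dm : 'M[K]_N := diag_mx (\row_i expw (- weight i)).
Definition Dp : 'M[K]_N := diag_mx (\row_i expw (weight i)).

Lemma Dm_bv k : (k < N)%N -> Dm *m bvK k = expw (- weight k) *: bvK k.
Proof.
move=> hk; apply/colP => i; rewrite mul_diag_mx !mxE.
by case: eqP => [->|_]; rewrite ?mulr0.
Qed.
Lemma Dp_bv k : (k < N)%N -> Dp *m bvK k = expw (weight k) *: bvK k.
Proof.
move=> hk; apply/colP => i; rewrite mul_diag_mx !mxE.
by case: eqP => [->|_]; rewrite ?mulr0.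
Qed.

Lemma mx_bv_ext m (B C : 'M[K]_(m, N)) : (forall j : 'I_N, B *m bvK j = C *m bvK j) -> B = C.
Proof.
move=> h; apply/matrixP => i j; have := congr1 (fun v : 'cV_m => v i 0) (h j).
by rewrite !mul_bv !mxE.
Qed.

Lemma weight_dual k : (k < N)%N ->
  weight (if (k < p + n)%N then k + (p + n) else k - (p + n))%N = - weight k.
Proof.
move=> hk; rewrite /weight.
by repeat (case: ifP; cbv iota); lia.
Qed.

Lemma J_Dp : Jmx *m Dp = Dm *m Jmx.
Proof.
apply: mx_bv_ext => j; have hj := ltn_ord j.
rewrite -!mulmxA Dp_bv // -scalemxAr Jmx_bv // Dm_bv; last by case: ifP; lia.
by rewrite weight_dual // opprK.
Qed.

(** Dual basis vectors have opposite weights, so [Dp] is the inverse transpose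
    of [Dm] for the form [dot]. *)
Lemma lambda_wedge u v : Dm *m wedge u v *m Dp = wedge (Dm *m u) (Dm *m v).
Proof.
have h x : x^T *m Jmx *m Dp = (Dm *m x)^T *m Jmx :> 'rV_N.
  by rewrite -mulmxA J_Dp trmx_mul tr_diag_mx mulmxA.
by rewrite /wedge mulmxBr mulmxBl -!h !mulmxA.
Qed.

Lemma Dm_hv i : (i < p)%N -> Dm *m hv i = r ^+ (p.-1 - i) *: hv i.
Proof.
move=> hi; rewrite /hv mulmxDr scalerDr Dm_bv; last lia.
have -> : - weight (p + n + i) = (p.-1 - i)%N%:Z.
  by rewrite /weight; repeat (case: ifP; cbv iota); lia.
rewrite expw_nat; congr (_ + _).
case: eqP => e; last by rewrite mulmx0 scaler0.
have -> : (p.-1 - i = 0)%N by lia.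
rewrite (Ev_p _ _ p_gt1) Dm_bv; last lia.
have -> : - weight p.-1 = 0 by rewrite /weight; repeat (case: ifP; cbv iota); lia.
by rewrite expw0 expr0.
Qed.

Lemma Dm_gv i : (i <= n)%N -> Dm *m gv i = r ^+ (n - i) *: gv i.
Proof.
move=> hi; rewrite /gv; case: ltnP => h.
  rewrite Dm_bv; last lia.
  have -> : - weight (p + n + p + i) = (n - i)%N%:Z.
    by rewrite /weight; repeat (case: ifP; cbv iota); lia.
  by rewrite expw_nat.
rewrite (_ : (n - i = 0)%N); last lia.
rewrite mulmxN (Ev_p _ _ p_gt1) Dm_bv; last lia.
have -> : - weight p.-1 = 0 by rewrite /weight; repeat (case: ifP; cbv iota); lia.
by rewrite expw0 expr0 !scale1r.
Qed.

Lemma xentry_weight (i j : nat) : (i < N)%N -> (j < N)%N ->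
  xentry K p n i j != 0 -> weight i = weight j + 1.
Proof.
move=> hi hj; rewrite /xentry.
case: ltnP => h1.
  by rewrite boolR_eq0 negbK /weight; repeat (case: ifP; cbv iota); lia.
case: ltnP => h2.
  by rewrite boolR_eq0 negbK /weight; repeat (case: ifP; cbv iota); lia.
case: ltnP => h3.
  move=> h; have {h} : (i == j.+1) || (j.+2 == p + n + p)%N && (i.+1 == p).
    by apply: contraNT h; rewrite negb_or => /andP[/negPf-> /negPf->]; rewrite subr0 oppr0.
  by rewrite /weight; repeat (case: ifP; cbv iota); lia.
case: ltnP => h4.
  move=> h; have {h} : (i.+2 == p) || (0 < n)%N && (i.+1 == p + n)%N.
    by apply: contraNT h; rewrite negb_or => /andP[/negPf-> /negPf->]; rewrite subr0.
  by rewrite /weight; repeat (case: ifP; cbv iota); lia.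
case: ltnP => h5.
  by rewrite oppr_eq0 boolR_eq0 negbK /weight; repeat (case: ifP; cbv iota); lia.
by rewrite boolR_eq0 negbK /weight; repeat (case: ifP; cbv iota); lia.
Qed.

(** The nonzero entries of [X] lie between weights differing by 1, which the
    factor [r] compensates. *)
Lemma lambda_nilX : r *: (Dm *m X *m Dp) = X.
Proof.
rewrite /Dm /Dp mul_diag_mx mul_mx_diag; apply/matrixP => i j; rewrite !mxE.
case: (eqVneq (X i j) 0) => [->|h]; first by rewrite mulr0 mul0r mulr0.
have hwt : weight i = weight j + 1.
  by apply: xentry_weight => //; rewrite -(chain_entry p_gt1 pn hX).
rewrite hwt opprD expwD.
have h1 : expw (- weight j) * expw (weight j) = 1 by rewrite -expwD addNr expw0.
have h2 : r * expw (-1) = 1 by rewrite -[r]expr1 -(expw_nat 1) -expwD subrr expw0.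
transitivity ((expw (- weight j) * expw (weight j)) * (r * expw (-1)) * X i j); first by ring.
by rewrite h1 h2 !mul1r.
Qed.

Lemma lambda_slice_dir a y z d :
  r *: (Dm *m (X + slice_dir p n a y z d) *m Dp) =
  X + slice_dir p n (fun k => r * r ^+ k * r ^+ k.-1 * a k)
    (fun k => r * r ^+ p.-1 * r ^+ (n.+1 - k) * y k)
    (fun k => r * r ^+ (p - k) * z k)
    (fun k => r * r ^+ k * r ^+ k.-1 * d k).
Proof.
rewrite mulmxDr mulmxDl scalerDr lambda_nilX; congr (_ + _).
have L k (c e : 'I_k -> K) (u v : 'I_k -> 'cV[K]_N) (f g : 'I_k -> K) :
   (forall i, Dm *m u i = f i *: u i) -> (forall i, Dm *m v i = g i *: v i) ->
   (forall i, e i = r * f i * g i * c i) ->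
   r *: (Dm *m (\sum_i c i *: wedge (u i) (v i)) *m Dp) = \sum_i e i *: wedge (u i) (v i).
  move=> hu hv' he; rewrite mulmx_sumr mulmx_suml scaler_sumr; apply: eq_bigr => i _.
  rewrite -scalemxAr -scalemxAl lambda_wedge hu hv' wedgeZl wedgeZr !scalerA he.
  by congr (_ *: _); ring.
rewrite /slice_dir !mulmxDr !mulmxDl !scalerDr.
refine (f_equal2 +%R (f_equal2 +%R (f_equal2 +%R _ _) _) _).
- apply: (L _ _ _ _ _ (fun i => r ^+ (p.-1 - i)) (fun i => r ^+ (p.-1 - i.+1))) => i.
  + by apply: Dm_hv; have := ltn_ord i; lia.
  + by apply: Dm_hv; have := ltn_ord i; lia.
  + by congr (_ * r ^+ _ * _); lia.
- apply: (L _ _ _ _ _ (fun i => r ^+ (n - i)) (fun i => r ^+ (n - i.+1))) => i.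
  + by apply: Dm_gv; have := ltn_ord i; lia.
  + by apply: Dm_gv; have := ltn_ord i; lia.
  + by congr (_ * r ^+ _ * _); lia.
- apply: (L _ _ _ _ _ (fun i => r ^+ (p.-1 - 0)) (fun i => r ^+ (n - i))) => i.
  + by apply: Dm_hv; lia.
  + by apply: Dm_gv; have := ltn_ord i; lia.
  + by rewrite subn0 subSS.
- apply: (L _ _ _ _ _ (fun i => r ^+ (n - n)) (fun i => r ^+ (p.-1 - i))) => i.
  + by apply: Dm_gv.
  + by apply: Dm_hv; have := ltn_ord i; lia.
  + rewrite subnn expr0 mulr1; congr (_ * r ^+ _ * _); lia.
Qed.

End Weights.

Import numFieldNormedType.Exports.
Local Open Scope classical_set_scope.
Local Open Scope complex_scope.

(** * The complex exponential *)

Section Exponential.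
Variable K : numFieldType.
Implicit Types (u v : nat -> K) (x y w : K).

Definition cvgK u (l : K) : Prop := u @ \oo --> l.

Lemma cvgKP u l : cvgK u l <->
  forall e, 0 < e -> exists N, forall n, (N <= n)%N -> `|l - u n| < e.
Proof.
split=> [/cvgrPdist_lt h e /h [N _ hN]|h].
  by exists N => n hn; exact: hN.
by apply/cvgrPdist_lt => e /h [N hN]; exists N => // n; exact: hN.
Qed.

Lemma cvgK_lim u l : cvgK u l -> limn u = l.
Proof. by move=> h; apply: cvg_lim h; exact: norm_hausdorff. Qed.

Lemma cvgKB u v a b : cvgK u a -> cvgK v b -> cvgK (fun n => u n - v n) (a - b).
Proof. exact: cvgB. Qed.
Lemma cvgKM u v a b : cvgK u a -> cvgK v b -> cvgK (fun n => u n * v n) (a * b).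
Proof. exact: cvgM. Qed.

Definition expS w (N : nat) : K := \sum_(k < N) w ^+ k / k`!%:R.

Lemma expCE w l : cvgK (expS w) l -> expC w = l.
Proof.
move=> h; rewrite /expC.
have -> : series (fun k => w ^+ k / k`!%:R) = expS w.
  by apply/funext => N; rewrite /series /= big_mkord.
exact: cvgK_lim.
Qed.

Lemma expS0_cvg : cvgK (expS 0) 1.
Proof.
apply/cvgKP => e e0; exists 1%N => [[//|n] _].
rewrite /expS big_ord_recl expr0 fact0 divr1 big1 ?addr0 ?subrr ?normr0 // => i _.
by rewrite /= expr0n mul0r.
Qed.

Definition expS_prod x y i j : K := (x ^+ i / i`!%:R) * (y ^+ j / j`!%:R).

(** The binomial theorem: partial sums of the exponential of [x + y] collect
    the products with total degree less than [N], among those of degrees less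
    than [N] in each factor. *)
Lemma expS_add x y N :
  expS (x + y) N = \sum_(i < N) \sum_(j < N | (i + j < N)%N) expS_prod x y i j.
Proof.
have tri M : \sum_(i < M) \sum_(j < M | (i + j < M)%N) expS_prod x y i j
    = \sum_(i < M) \sum_(j < M - i) expS_prod x y i j.
  apply: eq_bigr => i _; have hi := ltn_ord i.
  rewrite (big_ord_widen M (fun j => expS_prod x y i j)); last by rewrite leq_subr.
  by apply: eq_bigl => j; rewrite ltn_subRL.
rewrite tri; elim: N => [|N IH]; first by rewrite /expS !big_ord0.
rewrite /expS big_ord_recr /= -/(expS _ N) IH.
have -> : \sum_(i < N.+1) \sum_(j < N.+1 - i) expS_prod x y i j
   = \sum_(i < N.+1) (\sum_(j < N - i) expS_prod x y i j + expS_prod x y i (N - i)).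
  apply: eq_bigr => i _; have hi := ltn_ord i.
  by rewrite subSn // big_ord_recr.
rewrite big_split /= big_ord_recr /= subnn big_ord0 addr0; congr (_ + _).
rewrite addrC exprDn mulr_suml; apply: eq_bigr => i _; have hi := ltn_ord i.
rewrite /expS_prod -mulr_natr.
have hf : ('C(N, i) * (i`! * (N - i)`!) = N`!)%N by rewrite bin_fact.
have nz k : k`!%:R != 0 :> K by rewrite pnatr_eq0 -lt0n fact_gt0.
rewrite -hf !natrM; have nC : 'C(N, i)%:R != 0 :> K.
  by rewrite pnatr_eq0 -lt0n bin_gt0.
by field; rewrite !nz nC.
Qed.

Lemma expS_mul x y N : expS x N * expS y N =
  expS (x + y) N + \sum_(i < N) \sum_(j < N | ~~ (i + j < N)%N) expS_prod x y i j.
Proof.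
rewrite expS_add -big_split /= {1}/expS mulr_suml; apply: eq_bigr => i _.
rewrite /expS mulr_sumr (bigID (fun j : 'I_N => (i + j < N)%N)) /=.
by congr (_ + _); apply: eq_bigr.
Qed.

(** The difference is a polynomial in [x] and [y] with nonnegative
    coefficients, so that its norm is at most its value at the norms of [x]
    and [y]. *)
Lemma expS_defect x y N :
  `|expS x N * expS y N - expS (x + y) N|
  <= expS `|x| N * expS `|y| N - expS (`|x| + `|y|) N.
Proof.
have E x' y' : expS x' N * expS y' N - expS (x' + y') N =
    \sum_(i < N) \sum_(j < N | ~~ (i + j < N)%N) expS_prod x' y' i j.
  by rewrite expS_mul addrAC subrr add0r.
rewrite !E.
apply: (le_trans (ler_norm_sum _ _ _)); apply: ler_sum => i _.
apply: (le_trans (ler_norm_sum _ _ _)); apply: ler_sum => j _.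
by rewrite /expS_prod !normrM !normfV !normrX !normr_nat.
Qed.

(** The bound of [expS_defect] tends to 0 as soon as the functional equation
    is known for [`|x|] and [`|y|], where it is that of a real exponential. *)
Lemma expS_addition x y a b lx ly :
  cvgK (expS `|x|) a -> cvgK (expS `|y|) b -> cvgK (expS (`|x| + `|y|)) (a * b) ->
  cvgK (expS x) lx -> cvgK (expS y) ly -> cvgK (expS (x + y)) (lx * ly).
Proof.
move=> ha hb hab hx hy.
have h0 := cvgKB (cvgKM ha hb) hab; rewrite subrr in h0.
have h1 : cvgK (fun N => expS x N * expS y N - expS (x + y) N) 0.
  apply/cvgKP => e e0; have /cvgKP/(_ e e0) [N hN] := h0.
  exists N => n /hN; rewrite !sub0r !normrN; apply: le_lt_trans.
  have hd := expS_defect x y n.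
  by rewrite (ger0_norm (le_trans (normr_ge0 _) hd)).
have := cvgKB (cvgKM hx hy) h1; rewrite subr0.
by apply: cvg_trans; apply: near_eq_cvg; near=> n; rewrite opprB addrCA subrr addr0.
Unshelve. all: by end_near. Qed.

(** Neighbourhoods of a matrix are products of neighbourhoods of its entries,
    so the series converges entrywise. *)
Lemma expmx_diag N (d e : 'rV[K]_N) :
  (forall i, cvgK (expS (d 0 i)) (e 0 i)) -> expmx (diag_mx d) = diag_mx e.
Proof.
move=> h; rewrite /expmx.
have pw k : diag_mx d ^+ k = diag_mx (\row_i d 0 i ^+ k).
  elim: k => [|k IH].
    rewrite expr0; apply/matrixP => i j; rewrite !mxE.
    by case: (i == j); rewrite ?mulr1n ?mulr0n.
  rewrite exprS IH -[_ * _]/(_ *m _) mulmx_diag; congr diag_mx.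
  by apply/rowP => i; rewrite !mxE exprS.
have -> : series (fun k => k`!%:R^-1 *: diag_mx d ^+ k)
   = (fun M => diag_mx (\row_i expS (d 0 i) M)).
  apply/funext => M; rewrite /series /= big_mkord.
  apply/matrixP => i j; rewrite summxE !mxE /expS -sumrMnl; apply: eq_bigr => k _.
  by rewrite pw !mxE mulrnAr mulrC.
apply: cvg_lim; first exact: norm_hausdorff.
move=> A [P hP sA].
have : \forall M \near \oo, forall ij : 'I_N * 'I_N,
    P ij.1 ij.2 (diag_mx (\row_i expS (d 0 i) M) ij.1 ij.2).
  apply: filter_forall => -[i j] /=.
  case: (eqVneq i j) => [<-|ij].
    have := hP i i; rewrite mxE eqxx mulr1n => hi.
    have H : \forall M \near \oo, P i i (expS (d 0 i) M) := h i _ hi.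
    apply: filterS H => M.
    by rewrite !mxE eqxx mulr1n.
  have := hP i j; rewrite mxE (negPf ij) mulr0n => /nbhs_singleton hi.
  by apply: nearW => M; rewrite mxE (negPf ij) mulr0n.
by apply: filterS => M /= hM; apply: sA => i j; exact: (hM (i, j)).
Qed.

End Exponential.

Section ComplexExponential.
Variable R : realType.
Local Notation C := R[i].

Lemma ltc_pos (e : C) : 0 < e -> exists2 r : R, 0 < r & e = r%:C.
Proof.
case: e => a b; rewrite ltcE /= => /andP[/eqP-> a0].
by exists a.
Qed.

Lemma normc_real (x : R) : `|x%:C| = (`|x|)%:C :> C.
Proof. by rewrite normc_def /= expr0n addr0 sqrtr_sqr. Qed.

Lemma cvgK_real (u : nat -> R) (l : R) : u @ \oo --> l ->
  @cvgK C (fun n => (u n)%:C) l%:C.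
Proof.
move=> /cvgrPdist_lt h; apply/cvgKP => e /ltc_pos[r r0 ->].
have [N _ hN] := h _ r0; exists N => n hn.
have := hN n hn => /=.
by rewrite -rmorphB normc_real ltcR.
Qed.

Lemma norm_le_ReIm (z : C) : `|z| <= (`|complex.Re z| + `|complex.Im z|)%:C.
Proof.
have i1 : `|'i%C : C| = 1 by rewrite normc_def /= expr0n add0r expr1n sqrtr1.
have hz : `|z| <= `|(complex.Re z)%:C| + `|'i%C * (complex.Im z)%:C|.
  by rewrite {1}(complexE z) ler_normD.
by apply: (le_trans hz); rewrite normrM i1 mul1r !normc_real rmorphD.
Qed.

Lemma normc_ge_Im (z : C) : `|complex.Im z|%:C <= `|z|.
Proof.
by rewrite normc_def lecR -sqrtr_sqr ler_wsqrtr // lerDr sqr_ge0.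
Qed.

Lemma cvgK_ReIm (u : nat -> C) (a b : R) :
  (fun n => complex.Re (u n)) @ \oo --> a -> (fun n => complex.Im (u n)) @ \oo --> b ->
  @cvgK C u (a +i* b).
Proof.
move=> /cvgrPdist_lt ha /cvgrPdist_lt hb; apply/cvgKP => e /ltc_pos[r r0 ->].
have r2 : 0 < r / 2 by rewrite divr_gt0.
have [N _ hN] := ha _ r2; have [M _ hM] := hb _ r2.
exists (maxn N M) => n; rewrite geq_max => /andP[/hN h1 /hM h2].
apply: (le_lt_trans (norm_le_ReIm _)); rewrite ltcR.
rewrite [r]splitr; apply: ltrD; rewrite /=.
  by move: h1 => /=; case: (u n).
by move: h2 => /=; case: (u n).
Qed.

Lemma expS_real (a : R) N : expS (a%:C : C) N = (series (exp_coeff a) N)%:C.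
Proof.
rewrite /expS /series /= big_mkord rmorph_sum; apply: eq_bigr => k _ /=.
by rewrite /exp_coeff /= rmorphM rmorphXn fmorphV rmorph_nat.
Qed.

Lemma expS_real_cvg (a : R) : @cvgK C (expS a%:C) (expR a)%:C.
Proof.
have -> : expS (a%:C : C) = fun N => (series (exp_coeff a) N)%:C.
  by apply/funext => N; rewrite expS_real.
by apply: cvgK_real; exact: is_cvg_series_exp_coeff.
Qed.

Lemma cvg_series_dominated (u v : nat -> R) :
  (forall k, `|u k| <= v k) -> cvgn (series v) -> cvgn (series u).
Proof.
move=> uv cv; apply: normed_cvg; apply: series_le_cvg cv => //= k.
exact: le_trans (uv k).
Qed.

(** The real and the imaginary part of the series converge absolutely, being
    dominated by the real exponential series at the norm of [z]. *)
Lemma expS_cvg (z : C) : exists l, @cvgK C (expS z) l.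
Proof.
pose u k := z ^+ k / k`!%:R : C.
have [a ha] : exists a : R, `|z| = a%:C.
  by rewrite normc_def; eexists.
have un k : `|u k| = (exp_coeff a k)%:C.
  rewrite /u normrM normfV normrX normr_nat ha.
  by rewrite /exp_coeff /= rmorphM rmorphXn fmorphV rmorph_nat.
have cR : cvgn (series (fun k => complex.Re (u k))).
  apply: (cvg_series_dominated (v := exp_coeff a)); last exact: is_cvg_series_exp_coeff.
  by move=> k; rewrite -lecR -un; exact: normc_ge_Re.
have cI : cvgn (series (fun k => complex.Im (u k))).
  apply: (cvg_series_dominated (v := exp_coeff a)); last exact: is_cvg_series_exp_coeff.
  by move=> k; rewrite -lecR -un; exact: normc_ge_Im.
exists (limn (series (fun k => complex.Re (u k))) +i* limn (series (fun k => complex.Im (u k)))).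
apply: cvgK_ReIm.
  move: cR; rewrite /series /=.
  have -> : (fun n => \sum_(0 <= k < n) complex.Re (u k)) = (fun n => complex.Re (expS z n)).
    by apply/funext => n; rewrite /expS raddf_sum big_mkord.
  by [].
move: cI; rewrite /series /=.
have -> : (fun n => \sum_(0 <= k < n) complex.Im (u k)) = (fun n => complex.Im (expS z n)).
  by apply/funext => n; rewrite /expS raddf_sum big_mkord.
by [].
Qed.

Lemma expC_cvg (z : C) : @cvgK C (expS z) (expC (z : C)).
Proof. by have [l hl] := expS_cvg z; rewrite (expCE hl). Qed.

Lemma expC0 : expC (0 : C) = 1.
Proof. by apply: (@expCE C); exact: expS0_cvg. Qed.

Lemma expCD (x y : C) : expC (x + y) = expC x * expC y.
Proof.
apply: expCE.
have [a ha] : exists a : R, `|x| = a%:C by rewrite normc_def; eexists.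
have [b hb] : exists b : R, `|y| = b%:C by rewrite normc_def; eexists.
apply: (@expS_addition C x y (expR a)%:C (expR b)%:C); rewrite ?ha ?hb.
- exact: expS_real_cvg.
- exact: expS_real_cvg.
- by rewrite -rmorphD -rmorphM -expRD; exact: expS_real_cvg.
- exact: expC_cvg.
- exact: expC_cvg.
Qed.

Lemma expC_natmul (w : C) k : expC (w *+ k) = expC w ^+ k.
Proof.
by elim: k => [|k IH]; rewrite ?mulr0n ?expC0 // mulrS expCD IH exprS.
Qed.

End ComplexExponential.

(** * The nilpotent matrix and the slice in terms of wedges *)

Section Blocks.
Variables (A : comNzRingType) (p n : nat).

Local Notation dv := (@dv A).
Local Notation bv := (@bv A (p + n)).

Lemma bv_e k : (k < p)%N -> bv k = col_mx (col_mx (dv p k) 0) 0.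
Proof.
move=> hk; apply/colP => r; rewrite !mxE.
case: splitP => r1 ->; rewrite !mxE; last by rewrite (_ : _ == _ = false) //; lia.
case: splitP => r2 ->; rewrite !mxE //; by rewrite (_ : _ == _ = false) //; lia.
Qed.
Lemma bv_f k : (k < n)%N -> bv (p + k) = col_mx (col_mx 0 (dv n k)) 0.
Proof.
move=> hk; apply/colP => r; rewrite !mxE.
case: splitP => r1 ->; rewrite !mxE; last by rewrite (_ : _ == _ = false) //; lia.
case: splitP => r2 ->; rewrite !mxE; last by congr (_%:R); lia.
by rewrite (_ : _ == _ = false) //; have := ltn_ord r2; lia.
Qed.
Lemma bv_e' k : (k < p)%N -> bv (p + n + k) = col_mx 0 (col_mx (dv p k) 0).
Proof.
move=> hk; apply/colP => r; rewrite !mxE.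
case: splitP => r1 ->; rewrite !mxE.
  by rewrite (_ : _ == _ = false) //; have := ltn_ord r1; lia.
case: splitP => r2 ->; rewrite !mxE; first by congr (_%:R); lia.
by rewrite (_ : _ == _ = false) //; lia.
Qed.
Lemma bv_f' k : (k < n)%N -> bv (p + n + p + k) = col_mx 0 (col_mx 0 (dv n k)).
Proof.
move=> hk; apply/colP => r; rewrite !mxE.
case: splitP => r1 ->; rewrite !mxE.
  by rewrite (_ : _ == _ = false) //; have := ltn_ord r1; lia.
case: splitP => r2 ->; rewrite !mxE; last by congr (_%:R); lia.
by rewrite (_ : _ == _ = false) //; have := ltn_ord r2; lia.
Qed.

Lemma wedge_dd (a b : 'cV[A]_(p + n)) :
  wedge (col_mx 0 a) (col_mx 0 b) = block_mx 0 0 (a *m b^T - b *m a^T) 0.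
Proof.
rewrite /wedge /Jmx !tr_col_mx !mul_row_block !trmx0 !mul0mx !mulmx0 !mulmx1 !add0r.
by rewrite !mul_col_row !mul0mx !mulmx0 opp_block_mx add_block_mx !oppr0 !addr0.
Qed.
Lemma wedge_ud (a b : 'cV[A]_(p + n)) :
  wedge (col_mx a 0) (col_mx 0 b) = block_mx (a *m b^T) 0 0 (- (b *m a^T)).
Proof.
rewrite /wedge /Jmx !tr_col_mx !mul_row_block !trmx0 !mul0mx !mulmx0 !mulmx1 !add0r.
by rewrite !addr0 !mul_col_row !mul0mx !mulmx0 opp_block_mx add_block_mx !oppr0 !add0r !addr0.
Qed.

Definition lowL (q : nat) (B : 'M[A]_q) : 'M[A]_(q + q) := block_mx 0 0 B 0.
Lemma lowL_sum q k (c : 'I_k -> A) (B : 'I_k -> 'M[A]_q) :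
  \sum_i c i *: lowL (B i) = lowL (\sum_i c i *: B i).
Proof.
elim/big_ind2: _ => [|X X' Y Y' -> ->|i _]; rewrite /lowL.
- by rewrite -[in RHS]/(0) block_mx0.
- by rewrite add_block_mx !addr0.
- by rewrite scale_block_mx !scaler0.
Qed.

(** Block arithmetic of [sliceSE], for arbitrary blocks. *)
Lemma assemble (c e : A) (MD D1 Z : 'M[A]_p) (MA : 'M[A]_n) (MY E : 'M[A]_(p, n)) :
  lowL (block_mx MD 0 0 0)
    - c *: block_mx (block_mx D1 0 0 0) 0 0 (- block_mx D1^T 0 0 0)
  + (lowL (block_mx 0 0 0 MA)
    + e *: block_mx (block_mx 0 E 0 0) 0 0 (- block_mx 0 0 E^T 0))
  + lowL (block_mx 0 MY (- MY^T) 0)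
  + - block_mx (block_mx Z 0 0 0) 0 0 (- block_mx Z^T 0 0 0)
  = block_mx (block_mx (- (Z + c *: D1)) (e *: E) 0 0) 0
             (block_mx MD MY (- MY^T) MA)
             (block_mx (Z + c *: D1)^T 0 (- (e *: E^T)) 0).
Proof.
rewrite /lowL !(scale_block_mx, opp_block_mx, scaler0, oppr0).
rewrite !(add_block_mx, addr0, add0r) opprD.
have -> : (Z + c *: D1)^T = Z^T + c *: D1^T by rewrite linearD linearZ.
rewrite !scalerN !opprK.
by rewrite [- (c *: D1) - Z]addrC [c *: D1^T + _]addrC.
Qed.

End Blocks.

Section Model.
Variables (R : realType) (p n : nat).
Local Notation K := R[i].
Hypotheses (p_gt1 : (1 < p)%N) (pn : (n < p)%N).
Local Notation dv := (@dv K).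
Local Notation X := (nilX R p n).

Lemma jordanS l k : (k.+1 < l)%N -> jordan_nil R l *m dv l k.+1 = dv l k.
Proof.
move=> h; rewrite (mul_dv _ (Ordinal h)); apply/colP => i; rewrite !mxE /=.
by congr (_%:R); lia.
Qed.
Lemma jordan0 l : jordan_nil R l *m dv l 0 = 0.
Proof.
case: l => [|l]; first by apply/colP; case.
by rewrite (mul_dv _ ord0); apply/colP => i; rewrite !mxE.
Qed.
Lemma jordanT l k : (k < l)%N -> (jordan_nil R l)^T *m dv l k = dv l k.+1.
Proof.
by move=> h; rewrite (mul_dv _ (Ordinal h)); apply/colP => i; rewrite !mxE.
Qed.
Lemma Emx_dv j k s : (s < k)%N ->
  Emx R j k *m dv k s = if s.+1 == k then dv j j.-1 else 0.
Proof.
move=> h; rewrite (mul_dv _ (Ordinal h)); apply/colP => i; rewrite !mxE /=.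
case: (s.+1 =P k) => _; rewrite ?andbF ?andbT !mxE //; congr (_%:R).
by have := ltn_ord i; lia.
Qed.
Lemma Fmx_dv l s : (1 < l)%N -> (s < l)%N -> Fmx R l *m dv l s =
  if s.+1 == l then dv l l.-2 else if s.+2 == l then - dv l l.-1 else 0.
Proof.
move=> l1 h; rewrite (mul_dv _ (Ordinal h)); apply/colP => i; rewrite !mxE /=.
have hi := ltn_ord i.
have -> : (i.+2 == l) = (i == l.-2 :> nat) by lia.
have -> : (i.+1 == l) = (i == l.-1 :> nat) by lia.
case: (s.+1 =P l) => e1; case: (s.+2 =P l) => e2; rewrite ?andbF ?andbT !mxE; try lia.
- by case: (_ == _).
- by case: (_ == _); rewrite ?oppr0.
- by [].
Qed.

Lemma nilX_col (a c : 'cV[K]_p) (b d : 'cV[K]_n) :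
  X *m col_mx (col_mx a b) (col_mx c d) =
  col_mx (col_mx (jordan_nil R p *m a + Fmx R p *m c + Emx R p n *m d)
                 (jordan_nil R n *m b - Emx R n p *m c))
         (col_mx (- ((jordan_nil R p)^T *m c)) (- ((jordan_nil R n)^T *m d))).
Proof.
rewrite /nilX mul_block_col !mul_block_col !mul0mx !addr0 !add0r !mulNmx.
by rewrite !add_col_mx addrA.
Qed.

Lemma nilX_e k : (k < p)%N -> X *m bv k = Ev K p n k.
Proof.
move=> h; rewrite bv_e // -[in col_mx _ 0](@col_mx0 K p n) nilX_col !mulmx0 !oppr0 !addr0.
case: k h => [|k] h; first by rewrite jordan0 !col_mx0.
by rewrite jordanS // !col_mx0 /Ev bv_e //; lia.
Qed.

Lemma nilX_f k : (k < n)%N -> X *m bv (p + k) = Fv K p n k.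
Proof.
move=> h; rewrite bv_f // -[in col_mx _ 0](@col_mx0 K p n) nilX_col !mulmx0 !oppr0 !addr0.
case: k h => [|k] h; first by rewrite jordan0 !col_mx0.
by rewrite jordanS // !col_mx0 /Fv bv_f //; lia.
Qed.

Lemma nilX_e' k : (k.+1 < p)%N ->
  X *m bv (p + n + k) = - bv (p + n + k.+1) - (if k.+2 == p then Ev K p n p else 0).
Proof.
move=> h; rewrite bv_e' ?(ltnW h) // -[in col_mx 0 _](@col_mx0 K p n) nilX_col.
rewrite !mulmx0 jordanT ?(ltnW h) // Fmx_dv ?(ltnW h) // Emx_dv ?(ltnW h) //.
rewrite (_ : (k.+1 == p) = false); last lia.
rewrite bv_e' // opp_col_mx opp_col_mx !oppr0 !addr0 add0r.
case: (k.+2 =P p) => e; last by rewrite !col_mx0 subr0.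
rewrite /Ev; case: p p_gt1 e => // p' _ e.
rewrite bv_e // opp_col_mx opp_col_mx !oppr0 add_col_mx add0r addr0.
by [].
Qed.

Lemma nilX_e'p : X *m bv (p + n + p.-1) = Ev K p n p.-1 - Fv K p n n.
Proof.
have h : (p.-1 < p)%N by lia.
rewrite bv_e' // -[in col_mx 0 _](@col_mx0 K p n) nilX_col.
rewrite !mulmx0 jordanT // Fmx_dv // Emx_dv //.
rewrite (ltn_predK p_gt1) eqxx (@dv_out K p p (leqnn p)) !oppr0 !addr0 !add0r !col_mx0.
have -> : Ev K p n p.-1 = col_mx (col_mx (dv p p.-2) 0) 0.
  rewrite /Ev; case E: (p.-1) h => [|k] h; first lia.
  by rewrite bv_e //; lia.
have -> : Fv K p n n = col_mx (col_mx 0 (dv n n.-1)) 0.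
  rewrite /Fv; case: n => [|n']; last by rewrite bv_f.
  by rewrite (_ : dv 0 _ = 0) ?col_mx0 //; apply/colP; case.
by rewrite !opp_col_mx !add_col_mx !oppr0 !addr0 !add0r.
Qed.

Lemma nilX_f' k : (k < n)%N -> X *m bv (p + n + p + k) =
  if k.+1 == n then Ev K p n p else - bv (p + n + p + k.+1).
Proof.
move=> h; rewrite bv_f' // -[in col_mx 0 _](@col_mx0 K p n) nilX_col.
rewrite !mulmx0 jordanT // Emx_dv // !oppr0 !add0r.
case: (k.+1 =P n) => e.
  rewrite e (@dv_out K n n (leqnn n)) oppr0 !col_mx0 /Ev; case: p p_gt1 => // p' _.
  by rewrite bv_e.
rewrite bv_f'; last lia.
by rewrite !opp_col_mx !oppr0 !col_mx0.
Qed.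

Lemma FmxT l : (Fmx R l)^T = - Fmx R l.
Proof.
apply/matrixP => i j; rewrite !mxE.
case: (boolP ((j.+2 == l) && (i.+1 == l))) => h1; case: (boolP ((i.+2 == l) && (j.+1 == l))) => h2.
- lia.
- by rewrite andbC h1 opprK.
- by rewrite andbC h2.
- by rewrite andbC (negPf h2) andbC (negPf h1) oppr0.
Qed.

Lemma EmxT j k : (Emx R j k)^T = Emx R k j.
Proof. by apply/matrixP => i s; rewrite !mxE andbC. Qed.

Lemma skew_nilX : skew X.
Proof.
rewrite /skew /nilX /Jmx tr_block_mx !mulmx_block !mulmx0 !mulmx1 !mul1mx !mul0mx.
rewrite !addr0 !add0r !trmx0 opp_block_mx oppr0.
rewrite !tr_block_mx !linearN /= !trmxK !trmx0 FmxT !EmxT.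
by rewrite !opp_block_mx !opprK !oppr0.
Qed.

Lemma nilX_chains : chains X.
Proof.
split; last exact: skew_nilX.
- by move=> j h; rewrite /= nilX_e.
- by move=> j h; rewrite /= nilX_f.
- move=> i h; rewrite /hv mulmxDr nilX_e' //.
  rewrite (_ : (i.+1 == p) = false) ?mulmx0 ?addr0 ?opprD //; lia.
- rewrite /hv mulmxDr nilX_e'p (ltn_predK p_gt1) eqxx.
  have -> : X *m Ev K p n p = Ev K p n p.-1.
    by rewrite (Ev_p _ _ p_gt1) nilX_e //; lia.
  by rewrite addrAC mulr2n.
- move=> i h; rewrite /gv h nilX_f' //.
  case: (i.+1 =P n) => e; first by rewrite e ltnn opprK.
  by case: ltnP => // h'; lia.
Qed.

Local Notation bvK := (@bv K (p + n)).

Lemma tridiag_sum l (u : nat -> K) : antisym_tridiag l u =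
  \sum_(i < l.-1) u i.+1 *:
     (dv l i *m (dv l i.+1)^T - dv l i.+1 *m (dv l i)^T).
Proof.
apply/matrixP => i j; rewrite summxE !mxE; have hi := ltn_ord i; have hj := ltn_ord j.
transitivity (\sum_(k < l.-1) (u k.+1 * (j == i.+1 :> nat)%:R) * (k == i :> nat)%:R
   - \sum_(k < l.-1) (u k.+1 * (i == j.+1 :> nat)%:R) * (k == j :> nat)%:R).
  rewrite (sum_pick _ (fun k => u k.+1 * (j == i.+1 :> nat)%:R)).
  rewrite (sum_pick _ (fun k => u k.+1 * (i == j.+1 :> nat)%:R)).
  case: (j =P i.+1 :> nat) => e1.
    rewrite (_ : (i < l.-1)%N); last lia.
    rewrite (_ : (i == j.+1 :> nat) = false); last lia.
    by rewrite mulr1 mulr0; case: ifP; rewrite subr0.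
  rewrite mulr0; case: (i =P j.+1 :> nat) => e2; last by rewrite mulr0; do 2 case: ifP; rewrite subrr.
  rewrite (_ : (j < l.-1)%N); last lia.
  by rewrite mulr1; case: ifP; rewrite sub0r.
rewrite -sumrB; apply: eq_bigr => k _; rewrite !mxE !big_ord1 !mxE.
rewrite -!mulrA -mulrBr -!natrM !mulnb; congr (_ * (_%:R - _%:R)); lia.
Qed.

Lemma wedge_e'e' i j : (i < p)%N -> (j < p)%N ->
  wedge (bvK (p + n + i)) (bvK (p + n + j)) =
  lowL (block_mx (dv p i *m (dv p j)^T - dv p j *m (dv p i)^T) 0 0 0).
Proof.
move=> hi hj; rewrite !bv_e' // wedge_dd /lowL !tr_col_mx !trmx0 !mul_col_row.
by rewrite !mulmx0 !mul0mx opp_block_mx add_block_mx !oppr0 !addr0.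
Qed.

Lemma wedge_f'f' i j : (i < n)%N -> (j < n)%N ->
  wedge (bvK (p + n + p + i)) (bvK (p + n + p + j)) =
  lowL (block_mx 0 0 0 (dv n i *m (dv n j)^T - dv n j *m (dv n i)^T)).
Proof.
move=> hi hj; rewrite !bv_f' // wedge_dd /lowL !tr_col_mx !trmx0 !mul_col_row.
by rewrite !mulmx0 !mul0mx opp_block_mx add_block_mx !oppr0 !addr0.
Qed.

Lemma wedge_ee' i v : (i < p)%N ->
  wedge (bvK i) (col_mx 0 (col_mx v 0)) =
  block_mx (block_mx (dv p i *m v^T) 0 0 0) 0 0 (- block_mx (v *m (dv p i)^T) 0 0 0).
Proof.
move=> hi; rewrite !bv_e // wedge_ud !tr_col_mx !trmx0 !mul_col_row.
by rewrite !mulmx0 !mul0mx.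
Qed.

Lemma wedge_ef' i v : (i < p)%N ->
  wedge (bvK i) (col_mx 0 (col_mx 0 v)) =
  block_mx (block_mx 0 (dv p i *m v^T) 0 0) 0 0 (- block_mx 0 0 (v *m (dv p i)^T) 0).
Proof.
move=> hi; rewrite !bv_e // wedge_ud !tr_col_mx !trmx0 !mul_col_row.
by rewrite !mulmx0 !mul0mx.
Qed.

(** The last term is due to [hv p.-1], the only vector of its chain with a
    component in the first block; it produces the entries [d 1] outside [Md]. *)
Lemma slice_dir_d (d : nat -> K) :
  \sum_(i < p.-1) d (p.-1 - i)%N *: wedge (hv K p n i) (hv K p n i.+1) =
  lowL (block_mx (Md p d) 0 0 0) - d 1%N *:
   block_mx (block_mx (dv p p.-1 *m (dv p p.-2)^T) 0 0 0) 0 0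
            (- block_mx (dv p p.-2 *m (dv p p.-1)^T) 0 0 0).
Proof.
transitivity (\sum_(i < p.-1) d (p.-1 - i)%N *: wedge (bvK (p + n + i)) (bvK (p + n + i.+1))
  + \sum_(i < p.-1) (d (p.-1 - i)%N *: wedge (bvK (p + n + i)) (bvK p.-1)) *+ (i == p.-2 :> nat)).
  rewrite -big_split /=; apply: eq_bigr => i _; have hi := ltn_ord i.
  rewrite {1}/hv (_ : (i.+1 == p) = false); last lia.
  rewrite addr0 /hv wedgeDr scalerDr; congr (_ + _).
  rewrite (_ : (i == p.-2 :> nat) = (i.+2 == p)); last lia.
  case: ifP => _; first by rewrite (Ev_p _ _ p_gt1).
  by rewrite wedge0r scaler0.
refine (f_equal2 +%R _ _).
  under eq_bigr => i _.
    have hi := ltn_ord i; rewrite wedge_e'e'; [|lia|lia]; over.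
  rewrite (lowL_sum (fun i : 'I_(p.-1) => d (p.-1 - i)%N)); congr lowL.
  rewrite /Md tridiag_sum.
  elim/big_ind2: _ => [|X1 X' Y Y' -> ->|i _].
  - by rewrite -[in RHS]/(0) block_mx0.
  - by rewrite add_block_mx !addr0.
  - have -> : (p - i.+1 = p.-1 - i)%N by lia.
    by rewrite scale_block_mx !scaler0.
have hp : (p.-2 < p.-1)%N by lia.
rewrite (bigD1 (Ordinal hp)) //= eqxx big1 ?addr0 => [|i hi]; last first.
  by rewrite (negPf (hi : i != p.-2 :> nat)).
rewrite (_ : (p.-1 - p.-2 = 1)%N); last lia.
rewrite mulr1n wedgeC bv_e'; last lia.
by rewrite wedge_ee' ?scalerN //; lia.
Qed.

Lemma Emx_outer : Emx R p n = dv p p.-1 *m (dv n n.-1)^T.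
Proof.
apply/matrixP => i j; rewrite !mxE big_ord1 !mxE -natrM mulnb; congr (_%:R).
by have := ltn_ord i; have := ltn_ord j; lia.
Qed.

(** The last term is due to [gv n], which lies in the first block; it produces
    the entries [a 1] outside [Ma]. *)
Lemma slice_dir_a (a : nat -> K) :
  \sum_(i < n) a (n - i)%N *: wedge (gv K p n i) (gv K p n i.+1) =
  lowL (block_mx 0 0 0 (Ma n a)) + a 1%N *:
   block_mx (block_mx 0 (Emx R p n) 0 0) 0 0
            (- block_mx 0 0 (Emx R p n)^T 0).
Proof.
case: (posnP n) => [n0|n_gt0].
  rewrite Emx_outer trmx_mul trmxK.
  have H m (B : 'M[K]_(m, n)) : B = 0.
    apply/matrixP => i j; exfalso; have := ltn_ord j; lia.
  rewrite [Ma n a](H n) [_ *m (dv n _)^T](H p).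
  have -> : dv n n.-1 *m (dv p p.-1)^T = 0.
    by apply: (can_inj (@trmxK _ _ _)); rewrite [LHS](H p) [RHS](H p).
  rewrite /lowL -[block_mx 0 0 0 0]/(block_mx 0 0 0 0) !block_mx0 oppr0 !block_mx0 scaler0 addr0.
  by apply: big1 => i; exfalso; have := ltn_ord i; lia.
transitivity (\sum_(i < n.-1) a (n - i)%N *: wedge (bvK (p + n + p + i)) (bvK (p + n + p + i.+1))
  - a 1%N *: wedge (bvK (p + n + p + n.-1)) (bvK p.-1)).
  rewrite (sum_ord_pred (fun i => a (n - i)%N *: wedge (gv K p n i) (gv K p n i.+1)) n_gt0).
  refine (f_equal2 +%R _ _).
    apply: eq_bigr => i _; have hi := ltn_ord i; rewrite /gv.
    rewrite (_ : (i < n)%N); last lia.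
    by rewrite (_ : (i.+1 < n)%N) //; lia.
  rewrite (ltn_predK n_gt0) /gv ltnn (_ : (n.-1 < n)%N); last lia.
  by rewrite wedgeNr scalerN (Ev_p _ _ p_gt1) (_ : (n - n.-1 = 1)%N) //; lia.
refine (f_equal2 +%R _ _).
  under eq_bigr => i _.
    have hi := ltn_ord i; rewrite wedge_f'f'; [|lia|lia]; over.
  rewrite (lowL_sum (fun i : 'I_(n.-1) => a (n - i)%N)); congr lowL.
  rewrite /Ma tridiag_sum.
  elim/big_ind2: _ => [|X1 X' Y Y' -> ->|i _].
  - by rewrite -[in RHS]/(0) block_mx0.
  - by rewrite add_block_mx !addr0.
  - have -> : (n.+1 - i.+1 = n - i)%N by lia.
    by rewrite scale_block_mx !scaler0.
rewrite wedgeC bv_f'; last lia.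
rewrite wedge_ef'; last lia.
by rewrite scalerN opprK Emx_outer trmx_mul trmxK.
Qed.

Lemma slice_dir_y (y : nat -> K) :
  \sum_(j < n) y j.+1 *: wedge (hv K p n 0) (gv K p n j) =
  lowL (block_mx 0 (My p n y) (- (My p n y)^T) 0).
Proof.
pose ys : 'cV[K]_n := \col_j y j.+1.
have -> : My p n y = dv p 0 *m ys^T.
  apply/matrixP => i j; rewrite !mxE big_ord1 !mxE.
  by case: eqP; rewrite ?mul1r ?mul0r.
transitivity (wedge (hv K p n 0) (col_mx 0 (col_mx 0 ys))).
  have -> : col_mx 0 (col_mx 0 ys) = \sum_(j < n) y j.+1 *: gv K p n j.
    rewrite [in LHS](dv_sum ys).
    transitivity (\sum_(j < n) y j.+1 *: col_mx 0 (col_mx 0 (dv n j)) : 'cV[K]_(p + n + (p + n))).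
      elim/big_ind2: _ => [|X1 X' Y Y' <- <-|i _].
      - by rewrite !col_mx0.
      - by rewrite !add_col_mx !addr0.
      - by rewrite !scale_col_mx !scaler0 mxE.
    apply: eq_bigr => i _; have hi := ltn_ord i; rewrite /gv hi bv_f' //.
  rewrite wedge_sumr; apply: eq_bigr => i _; exact/esym/wedgeZr.
rewrite /hv (_ : (1%N == p) = false); last lia.
rewrite addr0 bv_e'; last lia.
rewrite wedge_dd /lowL !tr_col_mx !trmx0 !mul_col_row !mulmx0 !mul0mx.
by rewrite opp_block_mx add_block_mx trmx_mul trmxK !oppr0 !addr0 !add0r.
Qed.

Definition zcol (z : nat -> K) : 'cV[K]_p :=
  \col_(j < p) (if (j < n.+1)%N then z j.+1 else 0).

Lemma slice_dir_z (z : nat -> K) :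
  \sum_(j < n.+1) z j.+1 *: wedge (gv K p n n) (hv K p n j) =
  - block_mx (block_mx (dv p p.-1 *m (zcol z)^T) 0 0 0) 0 0
             (- block_mx (zcol z *m (dv p p.-1)^T) 0 0 0).
Proof.
rewrite -wedge_ee'; last lia.
have -> : col_mx 0 (col_mx (zcol z) 0) =
   \sum_(j < n.+1) z j.+1 *: bvK (p + n + j).
  transitivity (\sum_(j < p) zcol z j 0 *: bvK (p + n + j)).
    rewrite [in LHS](dv_sum (zcol z)).
    transitivity (\sum_(j < p) zcol z j 0 *: col_mx 0 (col_mx (dv p j) 0) : 'cV[K]_(p + n + (p + n))).
      elim/big_ind2: _ => [|X1 X' Y Y' <- <-|i _].
      - by rewrite !col_mx0.
      - by rewrite !add_col_mx !addr0.
      - by rewrite !scale_col_mx !scaler0.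
    by apply: eq_bigr => i _; rewrite bv_e'.
  rewrite (big_ord_widen p (fun j => z j.+1 *: bvK (p + n + j))) //.
  rewrite [RHS]big_mkcond /=; apply: eq_bigr => i _; rewrite mxE.
  by case: ifP; rewrite ?scale0r.
rewrite wedge_sumr -sumrN; apply: eq_bigr => j _; have hj := ltn_ord j.
have -> : wedge (gv K p n n) (hv K p n j) = - wedge (bvK p.-1) (bvK (p + n + j)).
  rewrite /gv ltnn wedgeNl /hv wedgeDr (Ev_p _ _ p_gt1).
  by case: ifP => _; rewrite ?wedge_self ?wedge0r addr0.
by rewrite wedgeZr scalerN.
Qed.

Lemma Mzd_outer (z d : nat -> K) :
  Mzd p n z d = dv p p.-1 *m (zcol z)^T + d 1%N *: (dv p p.-1 *m (dv p p.-2)^T).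
Proof.
apply/matrixP => i j; rewrite !mxE !big_ord1 !mxE.
have hi := ltn_ord i; have hj := ltn_ord j.
have -> : (i.+1 == p) = (i == p.-1 :> nat) by lia.
have -> : (j.+2 == p) = (j == p.-2 :> nat) by lia.
case: eqP => _ /=; last by rewrite !mul0r mulr0.
by case: (_ < _)%N; case: eqP => _ /=; rewrite !mul1r ?mulr1 ?mulr0.
Qed.

Lemma sliceSE (a y z d : nat -> K) :
  sliceS p n a y z d = X + slice_dir p n a y z d.
Proof.
rewrite /sliceS; refine (f_equal2 +%R (erefl _) _); rewrite /slice_dir.
refine (esym (etrans (f_equal2 +%R (f_equal2 +%R (f_equal2 +%R
  (slice_dir_d d) (slice_dir_a a)) (slice_dir_y y)) (slice_dir_z z)) _)).
have := assemble (d 1%N) (a 1%N) (Md p d) (dv p p.-1 *m (dv p p.-2)^T)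
  (dv p p.-1 *m (zcol z)^T) (Ma n a) (My p n y) (Emx R p n).
rewrite -Mzd_outer EmxT.
have -> : (dv p p.-1 *m (dv p p.-2)^T)^T = dv p p.-2 *m (dv p p.-1)^T.
  by rewrite trmx_mul trmxK.
have -> : (dv p p.-1 *m (zcol z)^T)^T = zcol z *m (dv p p.-1)^T.
  by rewrite trmx_mul trmxK.
by move=> H; exact: H.
Qed.

Lemma so_skew (Y : 'M[K]_(p + n + (p + n))) : so R (p + n) Y <-> skew Y.
Proof.
split=> [[P [Q [B [hQ hB ->]]]]|].
  rewrite /skew /Jmx tr_block_mx !mulmx_block !mulmx0 !mulmx1 !mul1mx !mul0mx.
  by rewrite !addr0 !add0r opp_block_mx linearN /= trmxK opprK hQ hB.
rewrite -(submxK Y) /skew /Jmx tr_block_mx !mulmx_block !mulmx0 !mulmx1 !mul1mx !mul0mx.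
rewrite !addr0 !add0r opp_block_mx => /eq_block_mx[hB hP' hP hQ].
exists (ulsubmx Y), (ursubmx Y), (dlsubmx Y); split => //.
by rewrite hP' opprK.
Qed.

End Model.

(** * The three claims *)

Section Final.
Variables (R : realType) (m n : nat).
Hypotheses (hm : (2 <= m)%N) (hn : (2 * n + 1 <= m)%N).
Local Notation K := R[i].
Local Notation p := (m - n)%N.
Variables a y z d : nat -> K.

Let p_gt1 : (1 < p)%N. Proof. lia. Qed.
Let pn : (n < p)%N. Proof. lia. Qed.

Lemma sum1E (V : nmodType) (F : nat -> V) k :
  \sum_(1 <= i < k.+1) F i = \sum_(i < k) F i.+1.
Proof. by rewrite big_add1 big_mkord. Qed.

Lemma polBE : polB m n y z =
  \sum_(j < n) (y j.+1)%:P * 'X ^+ j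
  - 'X ^+ n * (\sum_(j < n.+1) (z j.+1)%:P * (- 'X) ^+ j + (- 'X) ^+ p).
Proof.
rewrite /polB !sum1E [(- 'X) ^+ p]exprNn.
congr (_ - _ * (_ + _)).
- by apply: eq_bigr => i _; rewrite -mul_polyC.
- apply: eq_bigr => i _ /=.
  by rewrite -mul_polyC polyCM rmorph_sign (exprNn 'X) mulrCA mulrA.
- by rewrite -mul_polyC rmorph_sign.
Qed.

Lemma pencil12E : pencil12 p n y z = - polB m n y z.
Proof.
rewrite polBE /pencil12 /=; move: (\sum_(_ < n) _) (\sum_(_ < n.+1) _) => s1 s2; ring.
Qed.

Lemma pencil21E : pencil21 p n y z = polB m n y z \Po (- 'X).
Proof.
rewrite polBE /pencil21 rmorphB rmorphM rmorphD !rmorphXn !rmorph_sum /=.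
rewrite rmorphN /= comp_polyX opprK.
under [in RHS]eq_bigr => i _ do rewrite rmorphM rmorphXn /= comp_polyC comp_polyX.
under [X in _ = _ - _ * (X + _)]eq_bigr => i _ do
  rewrite rmorphM rmorphXn rmorphN /= comp_polyC comp_polyX opprK.
move: (\sum_(_ < n) _) (\sum_(_ < n.+1) _) => s1 s2; ring.
Qed.

Lemma pencil22E : pencil22 n a = (- ((-1) ^+ n * 'X * polA n a)) *+ 2.
Proof.
rewrite /pencil22 /polA sum1E.
have -> : \sum_(i < n) ((-1) ^+ i.+1 * a i.+1) *: 'X^(2 * (n - i.+1))
   = \sum_(i < n) (-1) ^+ (n - i) * (a (n - i)%N)%:P * 'X^(2 * i).
  rewrite (reindex_inj rev_ord_inj) /=; apply: eq_bigr => i _; have hi := ltn_ord i.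
  have -> : (n - i.+1).+1 = (n - i)%N by lia.
  have -> : (n - (n - i))%N = i by lia.
  by rewrite -mul_polyC polyCM rmorph_sign.
have D (e x P s : {poly K}) :
  (- (e * x * (P + s))) *+ 2 = - (x * P * e *+ 2) - (e * x * s) *+ 2 by ring.
rewrite D; congr (- (_ *+ 2) - _).
  by rewrite mul2n -addnn exprD exprS (exprNn 'X) mulrCA [in RHS]mulrC !mulrA.
rewrite mulr_sumr -sumrMnl; apply: eq_bigr => i _ /=.
have hi := ltn_ord i.
have -> : (-1) ^+ n = (-1) ^+ (n - i) * (-1) ^+ i :> {poly K}.
  by rewrite -exprD; congr (_ ^+ _); lia.
have E := sqrr_sign {poly K} (n - i).
rewrite !(exprNn 'X) !exprSr mul2n -addnn exprD.
move: ((-1) ^+ (n - i)) E ((-1) ^+ i) ('X ^+ i) ((a _)%:P) => e E f x c.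
transitivity (c * (e ^+ 2 * f * x * x * 'X) *+ 2).
  rewrite E; ring.
ring.
Qed.

Lemma pencil11E : pencil11 p d *+ 2 = - ((-1) ^+ p * 'X * polD m n d).
Proof.
rewrite /pencil11 /polD.
have -> : \sum_(1 <= k < p) ((-1) ^+ k.+1 * 4%:R * d k) *: 'X^(2 * (p - k.+1))
   = \sum_(i < p.-1) (-1) ^+ (p - i) * 4%:R * (d (p.-1 - i)%N)%:P * 'X^(2 * i).
  rewrite -[in LHS](ltn_predK p_gt1) sum1E.
  rewrite (reindex_inj rev_ord_inj) /=; apply: eq_bigr => i _; have hi := ltn_ord i.
  have -> : (p.-1 - i.+1).+1 = (p.-1 - i)%N by lia.
  have -> : (p.-1.+1 - (p.-1 - i).+1)%N = i by lia.
  have -> : ((p.-1 - i).+1 = p - i)%N by lia.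
  by rewrite -mul_polyC !polyCM rmorph_sign rmorph_nat.
rewrite mulr_sumr -!sumrN -sumrMnl; apply: eq_bigr => i _ /=.
have hi := ltn_ord i.
have -> : (-1) ^+ p = (-1) ^+ (p - i) * (-1) ^+ i :> {poly K}.
  by rewrite -exprD; congr (_ ^+ _); lia.
have E := sqrr_sign {poly K} (p - i).
rewrite !(exprNn 'X) !exprSr mul2n -addnn exprD.
move: ((-1) ^+ (p - i)) E ((-1) ^+ i) ('X ^+ i) ((d _)%:P) => e E f x c.
transitivity (- (e ^+ 2 * (c * (f * x * x * 'X) * 4%:R))).
  rewrite E; ring.
ring.
Qed.

Lemma char_poly_slice : char_poly (sliceS p n a y z d) =
  'X^2 * polA n a * polD m n d + (-1) ^+ m * polB m n y z * (polB m n y z \Po (- 'X)).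
Proof.
rewrite (sliceSE p_gt1 pn) (char_poly_pencil p_gt1 pn (nilX_chains R p_gt1 pn)).
rewrite (pencil_signE p_gt1 pn (nilX_chains R p_gt1 pn)) pencil12E pencil21E pencil22E.
rewrite mulrnAr -mulrnAl pencil11E subnK; last lia.
rewrite rmorph_sign.
have -> : (-1) ^+ p * 'X * polD m n d = (-1) ^+ m * (-1) ^+ n * 'X * polD m n d.
  by rewrite -exprD -signr_odd -[in RHS]signr_odd; congr ((-1) ^+ nat_of_bool _ * _ * _); lia.
have Em := sqrr_sign {poly K} m; have En := sqrr_sign {poly K} n.
move: ((-1) ^+ m) ((-1) ^+ n) Em En (polA n a) (polD m n d) (polB m n y z) => e f Ee Ef A D B.
transitivity (e ^+ 2 * f ^+ 2 * 'X ^+ 2 * A * D + e * B * (B \Po - 'X)); first ring.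
by rewrite Ee Ef !mul1r.
Qed.

End Final.

Section Transverse.
Variables (R : realType) (p n : nat).
Local Notation K := R[i].
Hypotheses (p_gt1 : (1 < p)%N) (pn : (n < p)%N).
Local Notation X := (nilX R p n).
Let hX := nilX_chains R p_gt1 pn.

Lemma tangent_slice (M : 'M[K]_(p + n + (p + n))) :
  tangent_space (slice R p n) X M <-> exists a y z d, M = slice_dir p n a y z d.
Proof.
split=> [[_ [a [y [z [d ->]]]] <-]|[a [y [z [d ->]]]]].
  by exists a, y, z, d; rewrite (sliceSE p_gt1 pn) addrC addKr.
exists (sliceS p n a y z d); first by exists a, y, z, d.
by rewrite (sliceSE p_gt1 pn) addrC addKr.
Qed.

Lemma slice_transverse : transverse (so R (p + n)) (slice R p n) X.
Proof.
have two0 : 2%:R != 0 :> K by rewrite pnatr_eq0.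
split; apply/seteqP; split=> Z /=.
- move=> /so_skew /(skew_covered p_gt1 pn two0 hX) [Y [a [y [z [d [hY ->]]]]]].
  exists (slice_dir p n a y z d); first by apply/tangent_slice; exists a, y, z, d.
  exists (lie Y X) => //; exists Y => //; exact/so_skew.
- move=> [M /tangent_slice [a [y [z [d ->]]]] [_ [Y /so_skew hY <-] <-]].
  apply/so_skew; apply: skewD; first exact: skewM.
  exact: skew_comm (ch_skew hX) hY.
- move=> [/tangent_slice [a [y [z [d hM]]]] [Y _ hZ]].
  have e : slice_dir p n a y z d = Y *m X - X *m Y by rewrite -hM -hZ.
  by rewrite hM; exact: (slice_dir_comm0 p_gt1 pn two0 hX e).
- move=> ->; split.
    apply/tangent_slice; exists (fun=> 0), (fun=> 0), (fun=> 0), (fun=> 0).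
    exact/esym/slice_dir0.
  exists 0; first by apply/so_skew; exact: skew0.
  by rewrite /lie mul0mx mulmx0 subr0.
Qed.

End Transverse.

Section Lambda.
Variables (R : realType) (p n : nat).
Local Notation K := R[i].
Local Notation N := (p + n + (p + n))%N.
Hypotheses (p_gt1 : (1 < p)%N) (pn : (n < p)%N).
Local Notation X := (nilX R p n).
Local Notation hv := (hv K p n). Local Notation gv := (gv K p n).
Local Notation bvK := (@bv K (p + n)).
Let hX := nilX_chains R p_gt1 pn.

Lemma semisimpleHE : semisimpleH R p n = diag_mx (\row_i (weight p n i *+ 2)%:~R).
Proof.
have A (k : nat) (z : int) : z = k%:Z -> (2 * k)%:R = (z *+ 2)%:~R :> K.
  by move=> ->; rewrite mul2n -addnn natrD mulr2n intrD.
have B (k : nat) (z : int) : z = - k%:Z -> - (2 * k)%:R = (z *+ 2)%:~R :> K.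
  by move=> ->; rewrite mulNrn intrN -(A k k%:Z).
rewrite /semisimpleH; congr diag_mx; apply/rowP => i; rewrite !mxE /weight.
case: splitP => i1 ->; rewrite !mxE; case: splitP => i2 ->; rewrite !mxE;
  have := ltn_ord i1; have := ltn_ord i2 => h1 h2; [apply: A|apply: A|apply: B|apply: B];
  by repeat (case: ifP; cbv iota); lia.
Qed.

Variables (r w : K).
Hypotheses (r_neq0 : r != 0) (hw : expC w = r).

(** The exponential of [w] times an integer weight, that is [r] to the power
    [z]. *)
Definition expw (z : int) : K := expC (w *~ z).

Lemma expwD a b : expw (a + b) = expw a * expw b.
Proof. by rewrite /expw mulrzDr expCD. Qed.
Lemma expw_nat (k : nat) : expw k%:Z = r ^+ k.
Proof. by rewrite /expw -pmulrn expC_natmul hw. Qed.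

Lemma expmx_weight (s : int) : expmx ((s%:~R * (w / 2%:R)) *: semisimpleH R p n)
  = diag_mx (\row_i expw (s * weight p n i)).
Proof.
rewrite semisimpleHE -linearZ /=; apply: (@expmx_diag K) => i; rewrite !mxE.
have -> : s%:~R * (w / 2%:R) * (weight p n i *+ 2)%:~R = w *~ (s * weight p n i).
  rewrite -[RHS]mulrzr intrM mulr2n intrD.
  have : 2%:R != 0 :> K by rewrite pnatr_eq0.
  by move=> h; field.
exact: expC_cvg.
Qed.

Lemma lambda_actE Y : lambda_act (semisimpleH R p n) r w Y =
  r *: (Dm p n expw *m Y *m Dp p n expw).
Proof.
have := expmx_weight (-1); rewrite mulrN1z mulN1r row_expwN => Hm.
have := expmx_weight 1; rewrite mulr1z mul1r row_expw1 => Hp.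
by rewrite /lambda_act Hm Hp.
Qed.

Lemma lambda_slice a y z d :
  lambda_act (semisimpleH R p n) r w (sliceS p n a y z d) =
  sliceS p n (fun k => r * r ^+ k * r ^+ k.-1 * a k)
    (fun k => r * r ^+ p.-1 * r ^+ (n.+1 - k) * y k)
    (fun k => r * r ^+ (p - k) * z k)
    (fun k => r * r ^+ k * r ^+ k.-1 * d k).
Proof.
rewrite lambda_actE !(sliceSE p_gt1 pn).
exact: (lambda_slice_dir p_gt1 pn hX expwD expw_nat).
Qed.

Lemma lambda_slice_image :
  [set lambda_act (semisimpleH R p n) r w Y | Y in slice R p n] = slice R p n.
Proof.
apply/seteqP; split=> [_ [_ [a [y [z [d ->]]]] <-]|_ [a [y [z [d ->]]]]].
  by rewrite lambda_slice; do 4 eexists.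
pose s1 k := r * r ^+ k * r ^+ k.-1; pose s2 k := r * r ^+ p.-1 * r ^+ (n.+1 - k).
pose s3 k := r * r ^+ (p - k).
have n1 k : s1 k != 0 by rewrite !mulf_neq0 // expf_neq0.
have n2 k : s2 k != 0 by rewrite !mulf_neq0 // expf_neq0.
have n3 k : s3 k != 0 by rewrite !mulf_neq0 // expf_neq0.
exists (sliceS p n (fun k => (s1 k)^-1 * a k) (fun k => (s2 k)^-1 * y k)
  (fun k => (s3 k)^-1 * z k) (fun k => (s1 k)^-1 * d k)); first by do 4 eexists.
have cancel (s b : nat -> K) : (forall k, s k != 0) -> (fun k => s k * ((s k)^-1 * b k)) = b.
  by move=> hs; apply/funext => k; rewrite mulVKf.
apply: (etrans (lambda_slice _ _ _ _)).
exact: (f_equal4 (sliceS p n) (cancel s1 a n1) (cancel s2 y n2) (cancel s3 z n3) (cancel s1 d n1)).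
Qed.

End Lambda.

Theorem theorem17 (R : realType) (m n : nat)
    (hm : (2 <= m)%N) (hn : (2 * n + 1 <= m)%N) :
  [/\ lambda_invariant (semisimpleH R (m - n) n) (slice R (m - n) n),
      transverse (so R (m - n + n)) (slice R (m - n) n) (nilX R (m - n) n)
    & forall a y z d : nat -> R[i],
        char_poly (sliceS (m - n) n a y z d) =
          'X^2 * polA n a * polD m n d
          + (-1) ^+ m * polB m n y z * (polB m n y z \Po (- 'X))].
Proof.
have p_gt1 : (1 < m - n)%N by lia.
have pn : (n < m - n)%N by lia.
split.
- by move=> r r0 w hw; exact: lambda_slice_image.
- exact: slice_transverse.
- by move=> a y z d; exact: char_poly_slice.
Qed.
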